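(* Write $c(n)=c_{1/2}(n)$. For real $t$, we have $$\begin{aligned}\zeta^\ast(1/2+it)={}&Z_{1/2}(1/2+it)+Z_{1/2}(1/2-it)+\sum_{m=1}^\infty c(m)^2K_{it/2}(2\pi m)\\&+2\sum_{1\le m<n}c(m)c(n)\cos\Bigl(\frac t4\log\frac nm\Bigr)K_{it/2}(2\pi\sqrt{mn})\\={}&Z_{1/2}(1/2+it)+Z_{1/2}(1/2-it)+\sum_{n=1}^\infty n^{it/4}\Bigl(\sum_{d\mid n}c(d)\,c(n/d)\,d^{-it/2}\Bigr)K_{it/2}(2\pi\sqrt n),\end{aligned}$$ where at $t=0$ the formula is to be read as the limit $t\to0$.
   Context: $\zeta^\ast(s)=\pi^{-s/2}\Gamma(s/2)\zeta(s)$ is the completed Riemann zeta function. The theta series is $\theta(x)=\sum_{n=-\infty}^{\infty}e^{-\pi n^2x}$ for $x>0$. The numbers $c_{1/2}(m)$ $(m=1,2,\dots)$ are defined by $$\theta(x)^{1/2}=\Bigl(1+2\sum_{n=1}^\infty e^{-\pi n^2x}\Bigr)^{1/2}=1+\sum_{m=1}^\infty c_{1/2}(m)e^{-\pi mx},$$ i.e. $c_{1/2}(m)$ is the coefficient of $X^m$ in the formal power series $\bigl(1+2\sum_{n\ge1}X^{n^2}\bigr)^{1/2}$. Further, $$Z_{1/2}(s)=\int_0^\infty\bigl(\theta(t^2)^{1/2}-1\bigr)t^s\,\frac{dt}{t},$$ which converges absolutely for $\mathrm{Re}(s)>1/2$ and is continued meromorphically to $\mathbb{C}$. $K_\nu$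 is the $K$-Bessel function, $K_\nu(x)=\frac12\int_0^\infty e^{-\frac{x}{2}(u+\frac1u)}u^{-\nu}\frac{du}{u}$ for $x>0$, $\nu\in\mathbb{C}$. *)

(* Defs.v *)
From HB Require Import structures.
From mathcomp Require Import all_boot all_order all_algebra.
From mathcomp Require Import complex.
From mathcomp Require Import all_classical all_reals all_analysis.
From mathcomp.analysis.showcase Require summability.

Set Implicit Arguments.
Unset Strict Implicit.
Unset Printing Implicit Defensive.

Import Order.TTheory GRing.Theory Num.Theory.
Import numFieldNormedType.Exports.

Local Open Scope classical_set_scope.
Local Open Scope ring_scope.
Local Open Scope complex_scope.

(* The topology and the norm of the complex numbers are found on R[i]^o. *)
Notation Cplx R := (R[i]^o).

Section Complex_analysis.
Context {R : realType}.
Implicit Types (f g h : Cplx R -> Cplx R) (a z s : Cplx R).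

Definition cexp (z : R[i]) : Cplx R :=
  (expR (complex.Re z))%:C * (cos (complex.Im z) +i* sin (complex.Im z)).

(* x ^ s for x > 0 *)
Definition cpow (x : R) (s : R[i]) : Cplx R := cexp (s * (ln x)%:C).

(* Lebesgue integral over ]0, +oo[ *)
Definition cintegral (f : R -> Cplx R) : Cplx R :=
  (\int[lebesgue_measure]_(x in `]0, +oo[) complex.Re (f x))%R
  +i* (\int[lebesgue_measure]_(x in `]0, +oo[) complex.Im (f x))%R.

Definition analytic_at f a : Prop :=
  exists u : nat -> Cplx R, \forall z \near a,
    series (fun n => u n * (z - a) ^+ n : Cplx R) @ \oo --> f z.

Definition pole_at f a : Prop :=
  exists (n : nat) (h : Cplx R -> Cplx R),
    [/\ (0 < n)%N, analytic_at h a, h a != 0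
      & \forall z \near a^', f z = h z / (z - a) ^+ n].

(* The value of f at a pole is unconstrained. *)
Definition meromorphic f : Prop :=
  forall a, analytic_at f a \/ pole_at f a.

(* The meromorphic function on the whole plane that agrees with f on D; when D
   has an interior point it is unique outside its poles, if it exists. *)
Definition meromorphic_continuation (D : set (Cplx R)) f : Cplx R -> Cplx R :=
  xget (fun=> 0) [set g | meromorphic g /\ forall s, D s -> g s = f s].

End Complex_analysis.

Section Special_functions.
Context {R : realType}.

(* Euler's integral for Re s > 0, continued to the left by
   Gamma s = Gamma (s + n) / (s (s + 1) ... (s + n - 1)). *)
Definition Gamma (s : Cplx R) : Cplx R :=
  let n := if 0 < complex.Re s then 0%N
           else (Num.truncn (- complex.Re s)).+1 in
  cintegral (fun x => (expR (- x))%:C * cpow x (s + n%:R - 1))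
  / \prod_(k < n) (s + k%:R).

Definition zeta : Cplx R -> Cplx R :=
  meromorphic_continuation [set s | 1 < complex.Re s]
    (fun s => limn (fun N : nat =>
       \sum_(1 <= n < N) cpow n%:R (- s) : Cplx R)).

Definition zetastar (s : Cplx R) : Cplx R :=
  cpow pi (- s / 2) * Gamma (s / 2) * zeta s.

Definition theta (x : R) : R :=
  fine (\esum_(n in [set: int]) (expR (- pi * n%:~R ^+ 2 * x))%:E).

Definition Z_half : Cplx R -> Cplx R :=
  meromorphic_continuation [set s | 2^-1 < complex.Re s]
    (fun s => cintegral (fun t =>
       (Num.sqrt (theta (t ^+ 2)) - 1)%:C * cpow t s / t%:C)).

Definition besselK (nu : R[i]) (x : R) : Cplx R :=
  2^-1 * cintegral (fun u =>
    (expR (- (x / 2) * (u + u^-1)))%:C * cpow u (- nu) / u%:C).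

Definition gbinom (a : R) (k : nat) : R :=
  \prod_(i < k) ((a - i%:R) / i.+1%:R).

(* The coefficient of X^m in the formal power series (1 + P)^(1/2), i.e. in the
   sum of the gbinom (1/2) k P^k, where P = 2 (X + X^4 + X^9 + ...). As P has
   no constant term, only the k <= m and the terms of P of degree at most m
   contribute to this coefficient. *)
Definition c_half (m : nat) : R :=
  let P : {poly R} := 2 *: \sum_(1 <= n < m.+1) 'X^(n ^ 2) in
  (\sum_(k < m.+1) gbinom 2^-1 k *: P ^+ k)`_m.

End Special_functions.

Section Sums.
Context {R : realType}.
Implicit Type t : R.
Local Notation c := (@c_half R).
Local Notation K t x := (besselK (0 +i* (t / 2)) x).

Definition Z_sym t : Cplx R :=
  Z_half (2^-1 +i* t) + Z_half (2^-1 +i* - t).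

Definition diag_sum t (N : nat) : Cplx R :=
  \sum_(1 <= m < N) ((c m) ^+ 2)%:C * K t (2 * pi * m%:R).

(* The family is indexed by all pairs and vanishes off 1 <= m < n. *)
Definition pair_term t (p : nat * nat) : Cplx R :=
  let: (m, n) := p in
  if (1 <= m < n)%N then
    (c m * c n * cos (t / 4 * ln (n%:R / m%:R)))%:C
    * K t (2 * pi * Num.sqrt (m%:R * n%:R))
  else 0.

(* Partial sums over finite sets of pairs: the double sum is unordered. *)
Definition pair_sum t :=
  summability.partial_sum (pair_term t).

Definition divisor_sum t (N : nat) : Cplx R :=
  \sum_(1 <= n < N)
    cpow n%:R (0 +i* (t / 4))
    * (\sum_(d <- divisors n)
         (c d * c (n %/ d)%N)%:C * cpow d%:R (0 +i* - (t / 2)))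
    * K t (2 * pi * Num.sqrt n%:R).

End Sums.

(* Main.v *)
(** Idea. By Jacobi's transformation of theta, the functions theta(e^(2y)) and
    phi(y) = theta(e^(2y))^(1/2) satisfy phi(-y) = e^(ky) phi(y) with k = 1 and
    k = 1/2. Folding the Mellin transform of phi - 1 at y = 0 (Riemann's argument)
    writes it as U(s) + U(k - s) + 1/(s - k) - 1/s with U entire; this continues
    zeta and Z_(1/2). On the critical line, the identity
      (phi - 1) (e^(y/2) phi - 1) = e^(y/2) (phi^2 - 1) - (phi - 1) (e^(y/2) + 1)
    turns zeta* - Z_(1/2)(1/2 + it) - Z_(1/2)(1/2 - it) into the Fourier integral of
    (phi(y) - 1) (phi(-y) - 1); expanding both factors in powers of their nomes gives
    the Bessel functions. Absolute convergence of the double series needs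
    sum |c(m)| e^(-mh) <= e^(2/h), which comes from the product formula for theta. *)

(* Both [zeta] and [Z_half] are chosen by [xget], so they are reached only through uniqueness: an
   explicit candidate is shown to be meromorphic on the whole plane and the identity theorem
   identifies it with the chosen function. For zeta the candidate is divided by the Gamma factor, so
   1/Gamma must be entire, that is, Gamma must have no zeros. At t = 0 both arguments 1/2 + it and
   1/2 - it hit the pole 1/2 of Z, where the chosen value is arbitrary. For t != 0 the polar terms
   1/(it) and 1/(-it) cancel, which gives the limit. The constant 2 in e^(2/h) matters. Put X =
   e^(2y) with y large: phi(y) - 1 has size e^(-pi X), while the absolute coefficient sum of phi(-y)
   is taken at h = pi/X and is only known to be at most e^(2X/pi). A bound e^(C/h) suffices when C <
   pi^2; convergence of the power series in the unit disc alone would not be enough. *)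
Require Import Defs.
From HB Require Import structures.
From mathcomp Require Import all_boot all_order all_algebra.
From mathcomp Require Import complex.
From mathcomp Require Import all_classical all_reals all_analysis.
From mathcomp Require Import ring lra zify.
From mathcomp.analysis.showcase Require summability.
From mathcomp Require finmap.
From mathcomp Require Import measurable_realfun.
Set Implicit Arguments.
Unset Strict Implicit.
Unset Printing Implicit Defensive.
Import Order.TTheory GRing.Theory Num.Theory.
Import numFieldNormedType.Exports.
Local Open Scope classical_set_scope.
Local Open Scope ring_scope.
Local Open Scope complex_scope.

(** * Complex numbers and power series *)

Section ComplexModulus.
Context {R : realType}.
Local Notation C := (Cplx R).
Implicit Types z w : C.

(** The norm of [R[i]] has values in [R[i]]; this brings it down to [R], where estimates are carried
    out. *)
Definition cabs (z : R[i]) : R := complex.Re `|z|.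

Lemma cabsE (z : R[i]) : `|z| = (cabs z)%:C.
Proof. by rewrite /cabs normc_def. Qed.

Lemma cabs_sqrt (z : R[i]) :
  cabs z = Num.sqrt (complex.Re z ^+ 2 + complex.Im z ^+ 2).
Proof. by rewrite /cabs normc_def. Qed.

Lemma cabs_sqr (z : R[i]) :
  cabs z ^+ 2 = complex.Re z ^+ 2 + complex.Im z ^+ 2.
Proof. by rewrite cabs_sqrt sqr_sqrtr // addr_ge0 ?sqr_ge0. Qed.

Lemma cabs_ge0 (z : R[i]) : 0 <= cabs z.
Proof. by rewrite cabs_sqrt sqrtr_ge0. Qed.

Lemma cabs0 : cabs 0 = 0 :> R.
Proof. by rewrite /cabs normr0. Qed.

Lemma cabs1 : cabs 1 = 1 :> R.
Proof. by rewrite /cabs normr1. Qed.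

Lemma cabs_eq0 (z : R[i]) : (cabs z == 0) = (z == 0).
Proof. by rewrite -(inj_eq (@complexI R)) -cabsE -[X in _ == X]/(0 : R[i]) normr_eq0. Qed.

Lemma cabs_gt0 (z : R[i]) : (0 < cabs z) = (z != 0).
Proof. by rewrite lt_neqAle cabs_ge0 andbT eq_sym cabs_eq0. Qed.

Lemma cabsM (z w : R[i]) : cabs (z * w) = cabs z * cabs w.
Proof. by apply: complexI; rewrite -cabsE normrM !cabsE -rmorphM. Qed.

Lemma cabsX (z : R[i]) n : cabs (z ^+ n) = cabs z ^+ n.
Proof. by apply: complexI; rewrite -cabsE normrX !cabsE -rmorphXn. Qed.

Lemma cabsV (z : R[i]) : cabs z^-1 = (cabs z)^-1.
Proof. by apply: complexI; rewrite -cabsE normfV !cabsE -fmorphV. Qed.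

Lemma cabsN (z : R[i]) : cabs (- z) = cabs z.
Proof. by rewrite /cabs normrN. Qed.

Lemma cabsB (z w : R[i]) : cabs (z - w) = cabs (w - z).
Proof. by rewrite /cabs distrC. Qed.

Lemma cabsD (z w : R[i]) : cabs (z + w) <= cabs z + cabs w.
Proof. by rewrite -lecR rmorphD -!cabsE ler_normD. Qed.

Lemma cabs_tri (z w v : R[i]) : cabs (z - v) <= cabs (z - w) + cabs (w - v).
Proof. by have := cabsD (z - w) (w - v); rewrite addrA subrK. Qed.

Lemma cabs_dist (z w : R[i]) : cabs z - cabs w <= cabs (z - w).
Proof. by have := cabsD (z - w) w; rewrite subrK lerBlDr. Qed.

Lemma cabs_sum (I : Type) (r : seq I) (P : pred I) (F : I -> R[i]) :
  cabs (\sum_(i <- r | P i) F i) <= \sum_(i <- r | P i) cabs (F i).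
Proof.
elim/big_ind2 : _ => [|x1 x2 y1 y2 h1 h2|//]; first by rewrite cabs0.
exact: le_trans (cabsD _ _) (lerD h1 h2).
Qed.

Lemma cabs_real (x : R) : cabs x%:C = `|x|.
Proof. by rewrite cabs_sqrt /= expr0n addr0 sqrtr_sqr. Qed.

Lemma cabs_nat n : cabs n%:R = n%:R :> R.
Proof. by rewrite -(rmorph_nat (real_complex R)) cabs_real ger0_norm. Qed.

Lemma cReD (z w : R[i]) : complex.Re (z + w) = complex.Re z + complex.Re w.
Proof. by case: z w => ? ? []. Qed.
Lemma cImD (z w : R[i]) : complex.Im (z + w) = complex.Im z + complex.Im w.
Proof. by case: z w => ? ? []. Qed.
Lemma cReN (z : R[i]) : complex.Re (- z) = - complex.Re z.
Proof. by case: z. Qed.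
Lemma cImN (z : R[i]) : complex.Im (- z) = - complex.Im z.
Proof. by case: z. Qed.
Lemma cReB (z w : R[i]) : complex.Re (z - w) = complex.Re z - complex.Re w.
Proof. by rewrite cReD cReN. Qed.
Lemma cImB (z w : R[i]) : complex.Im (z - w) = complex.Im z - complex.Im w.
Proof. by rewrite cImD cImN. Qed.
Lemma cReM (z w : R[i]) : complex.Re (z * w) =
  complex.Re z * complex.Re w - complex.Im z * complex.Im w.
Proof. by case: z w => ? ? []. Qed.
Lemma cImM (z w : R[i]) : complex.Im (z * w) =
  complex.Re z * complex.Im w + complex.Im z * complex.Re w.
Proof. by case: z w => ? ? []. Qed.
Lemma cReMr (x : R) (z : R[i]) : complex.Re (x%:C * z) = x * complex.Re z.
Proof. by rewrite cReM /= mul0r subr0. Qed.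
Lemma cImMr (x : R) (z : R[i]) : complex.Im (x%:C * z) = x * complex.Im z.
Proof. by rewrite cImM /= mul0r addr0. Qed.

Lemma cRe_sum (I : Type) (r : seq I) (P : pred I) (F : I -> R[i]) :
  complex.Re (\sum_(i <- r | P i) F i) = \sum_(i <- r | P i) complex.Re (F i).
Proof. by elim/big_ind2 : _ => // x1 x2 y1 y2 <- <-; rewrite cReD. Qed.
Lemma cIm_sum (I : Type) (r : seq I) (P : pred I) (F : I -> R[i]) :
  complex.Im (\sum_(i <- r | P i) F i) = \sum_(i <- r | P i) complex.Im (F i).
Proof. by elim/big_ind2 : _ => // x1 x2 y1 y2 <- <-; rewrite cImD. Qed.

Lemma natrCE n : n%:R = (n%:R : R)%:C :> R[i].
Proof. by rewrite rmorph_nat. Qed.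

Lemma eqCplx (z w : R[i]) :
  complex.Re z = complex.Re w -> complex.Im z = complex.Im w -> z = w.
Proof. by case: z w => ? ? [? ?] /= -> ->. Qed.

Lemma Re_le_cabs (z : R[i]) : `|complex.Re z| <= cabs z.
Proof. by rewrite cabs_sqrt -sqrtr_sqr ler_sqrt ?addr_ge0 ?sqr_ge0 // lerDl sqr_ge0. Qed.

Lemma Im_le_cabs (z : R[i]) : `|complex.Im z| <= cabs z.
Proof. by rewrite cabs_sqrt -sqrtr_sqr ler_sqrt ?addr_ge0 ?sqr_ge0 // lerDr sqr_ge0. Qed.

Lemma cabs_le (z : R[i]) : cabs z <= `|complex.Re z| + `|complex.Im z|.
Proof.
rewrite -(@ler_pXn2r _ 2) ?nnegrE ?addr_ge0 ?cabs_ge0 // cabs_sqr sqrrD !real_normK ?num_real //.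
by rewrite lerD2r lerDl mulrn_wge0 // mulr_ge0.
Qed.

Lemma cnbhsP (a : C) (P : set C) :
  nbhs a P <-> exists2 r : R, 0 < r & forall z, cabs (z - a) < r -> P z.
Proof.
split=> [/nbhs_normP[e /= e0 he]|[r r0 h]].
  have er : e = (complex.Re e)%:C.
    by move: e0; rewrite ltcE /= => /andP[/eqP e0 _]; apply: eqCplx.
  exists (complex.Re e); first by move: e0; rewrite er ltcR.
  move=> z hz; apply: he => /=; rewrite /ball_ /= er.
  by rewrite cabsE ltcR cabsB.
apply: (iffRL (@nbhs_normP _ C a P)); exists r%:C => /=; first by rewrite ltcR.
by move=> z; rewrite /ball_ /= cabsE ltcR cabsB; exact: h.
Qed.

Lemma ccvgP (T : Type) (F : set_system T) {FF : Filter F} (f : T -> C) (l : C) :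
  f @ F --> l <-> forall e : R, 0 < e -> \forall x \near F, cabs (f x - l) < e.
Proof.
split=> [h e e0|h P /cnbhsP[r r0 hP]].
  by apply: (h (fun z => cabs (z - l) < e)); apply/cnbhsP; exists e.
by rewrite nbhs_filterE /=; apply: filterS (h r r0) => x; exact: hP.
Qed.

Lemma rcvgP (T : Type) (F : set_system T) {FF : Filter F} (f : T -> R) (l : R) :
  f @ F --> l <-> forall e : R, 0 < e -> \forall x \near F, `|f x - l| < e.
Proof.
split=> [/cvgr_distC_lt h|h] //; apply/cvgrPdist_lt => e e0.
by apply: filterS (h e e0) => x; rewrite distrC.
Qed.

Lemma ccvg_ReIm (T : Type) (F : set_system T) {FF : Filter F} (f : T -> C) (l : C) :
  f @ F --> l <-> (fun x => complex.Re (f x)) @ F --> complex.Re l /\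
   (fun x => complex.Im (f x)) @ F --> complex.Im l.
Proof.
split=> [/ccvgP h|[/rcvgP h1 /rcvgP h2]].
  split; apply/rcvgP => e e0; apply: filterS (h e e0) => x; apply: le_lt_trans.
    by rewrite -cReB Re_le_cabs.
  by rewrite -cImB Im_le_cabs.
apply/ccvgP => e e0; have e2 : 0 < e / 2 by rewrite divr_gt0.
near=> x; apply: le_lt_trans (cabs_le _) _; rewrite cReB cImB (splitr e).
by apply: ltrD; near: x; [exact: h1|exact: h2].
Unshelve. all: by end_near. Qed.

Lemma ccvg_unique (T : Type) (F : set_system T) {FF : ProperFilter F} (f : T -> C) (l l' : C) :
  f @ F --> l -> f @ F --> l' -> l = l'.
Proof.
by move=> /ccvg_ReIm[a b] /ccvg_ReIm[c d]; apply: eqCplx; [exact: cvg_unique a c|exact: cvg_unique b d].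
Qed.

Lemma ccvgD (T : Type) (F : set_system T) {FF : Filter F} (f g : T -> C) (l m : C) :
  f @ F --> l -> g @ F --> m -> (fun x => f x + g x : C) @ F --> (l + m : C).
Proof. exact: cvgD. Qed.

Lemma ccvgM (T : Type) (F : set_system T) {FF : Filter F} (f g : T -> C) (l m : C) :
  f @ F --> l -> g @ F --> m -> (fun x => f x * g x : C) @ F --> (l * m : C).
Proof.
move=> /ccvg_ReIm[f1 f2] /ccvg_ReIm[g1 g2]; apply/ccvg_ReIm.
under [X in X @ _]eq_fun do rewrite cReM; under [X in _ /\ (X @ _ --> _)]eq_fun do rewrite cImM.
by rewrite cReM cImM; split; [apply: cvgB|apply: cvgD]; apply: cvgM.
Qed.

Lemma ccvg_cst (T : Type) (F : set_system T) {FF : Filter F} (l : C) :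
  (fun _ : T => l) @ F --> l.
Proof. exact: cvg_cst. Qed.

Lemma ccvgMl (T : Type) (F : set_system T) {FF : Filter F} (f : T -> C) (c l : C) :
  f @ F --> l -> (fun x => c * f x : C) @ F --> (c * l : C).
Proof. by move=> h; apply: (@ccvgM _ _ _ (fun=> c) f c l); [exact: ccvg_cst|exact: h]. Qed.

Lemma ccvg_cabs_le (T : Type) (F : set_system T) {FF : ProperFilter F} (f : T -> C) (l : C) (M : R) :
  f @ F --> l -> (\forall x \near F, cabs (f x) <= M) -> cabs l <= M.
Proof.
move=> /ccvgP h hM; apply/ler_addgt0Pr => e e0.
have [x [h1 h2]] := filter_ex (filterI (h e e0) hM).
have := cabs_dist l (f x); rewrite cabsB; lra.
Qed.

Lemma cdnbhsP (a : C) (P : set C) :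
  nbhs a^' P <-> exists2 r : R, 0 < r & forall z, 0 < cabs (z - a) < r -> P z.
Proof.
rewrite /dnbhs /within nbhs_filterE/=; split.
  move=> /cnbhsP[r r0 h]; exists r => // z /andP[z0 zr].
  by apply: h => //; rewrite -subr_eq0 -cabs_gt0.
move=> [r r0 h]; apply/cnbhsP; exists r => // z zr za; apply: h.
by rewrite zr cabs_gt0 subr_eq0 za.
Qed.

End ComplexModulus.

Section PowerSeries.
Context {R : realType}.
Local Notation C := (Cplx R).
Implicit Types (a z w : C) (u v : nat -> C).

(** Write p = q^4. Bernoulli's inequality bounds n q^n, so n^2 p^n is at most a constant times
    (q^2)^n. *)
Lemma cvg_natsqr_expr (p : R) : 0 <= p < 1 ->
  (fun n : nat => n%:R ^+ 2 * p ^+ n) @ \oo --> 0.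
Proof.
move=> /andP[p0 p1]; have [->|pn0] := eqVneq p 0.
  apply/rcvgP => e e0; near=> n.
  have n0 : (0 < n)%N by near: n; exact: nbhs_infty_gt.
  by rewrite expr0n eqn0Ngt n0 mulr0 subr0 normr0.
have {pn0} p0 : 0 < p by rewrite lt_neqAle eq_sym pn0.
pose s := Num.sqrt p; pose q := Num.sqrt s.
have s0 : 0 < s by rewrite sqrtr_gt0.
have q0 : 0 < q by rewrite sqrtr_gt0.
have sp : s ^+ 2 = p by rewrite sqr_sqrtr // ltW.
have qs : q ^+ 2 = s by rewrite sqr_sqrtr // ltW.
have s1 : s < 1 by rewrite -(@ltr_pXn2r _ 2) ?nnegrE ?ltW // sp expr1n.
have q1 : q < 1 by rewrite -(@ltr_pXn2r _ 2) ?nnegrE ?ltW // qs expr1n.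
pose h := q^-1 - 1; have h0 : 0 < h by rewrite subr_gt0 invf_gt1.
have bern n : n%:R * h <= (q^-1) ^+ n.
  elim: n => [|n IH]; first by rewrite mul0r expr0.
  have h1 : 1 <= q^-1 ^+ n by rewrite exprn_ege1 // ltW // invf_gt1.
  rewrite exprS -natr1 (_ : q^-1 * _ = h * (q^-1 ^+ n - 1) + h + q^-1 ^+ n); last by rewrite /h; ring.
  have : 0 <= h * (q^-1 ^+ n - 1) by apply: mulr_ge0; [exact: ltW|rewrite subr_ge0].
  by move: IH; rewrite -/h; lra.
have b2 n : n%:R * q ^+ n <= h^-1.
  by rewrite -ler_pdivlMr ?exprn_gt0 // -exprVn -ler_pdivrMl ?invr_gt0 // invrK mulrC.
have bnd n : n%:R ^+ 2 * p ^+ n <= (h ^-1) ^+ 2 * s ^+ n.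
  have -> : n%:R ^+ 2 * p ^+ n = (n%:R * q ^+ n) ^+ 2 * s ^+ n.
    rewrite (_ : p = q ^+ 2 * s); last by rewrite qs -sp expr2.
    by rewrite !exprMn -!exprM muln2 -addnn exprD !mulrA.
  have s0' := ltW s0; have q0' := ltW q0; have h0' := ltW h0.
  by rewrite ler_wpM2r ?exprn_ge0 // lerXn2r // nnegrE ?mulr_ge0 ?exprn_ge0 ?invr_ge0.
apply: (@squeeze_cvgr _ _ _ _ (cst 0) (fun n => (h ^-1) ^+ 2 * s ^+ n)).
- by near=> n; rewrite bnd mulr_ge0 ?exprn_ge0 // ltW.
- exact: cvg_cst.
- rewrite -[X in _ --> X](mulr0 ((h^-1) ^+ 2)); apply: cvgMl_tmp.
  by apply: cvg_expr; rewrite ger0_norm ?ltW.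
Unshelve. all: by end_near. Qed.

Definition conv (V : pzSemiRingType) (a b : nat -> V) (n : nat) : V :=
  \sum_(i < n.+1) a i * b (n - i)%N.

(** Partial sums are values at 1 of polynomials of size N. The product of two of them differs from
    the partial sum of the Cauchy product only by its coefficients of index N to 2N - 1; there are N
    of these, each a sum of at most 2N terms bounded by A B p^N. *)
Lemma series_conv (a b : nat -> C) (A B p : R) (la lb : C) :
  0 <= p < 1 ->
  (forall n, cabs (a n) <= A * p ^+ n) -> (forall n, cabs (b n) <= B * p ^+ n) ->
  series a @ \oo --> la -> series b @ \oo --> lb ->
  series (conv a b : nat -> C) @ \oo --> (la * lb : C).
Proof.
move=> p01 ha hb ca cb; have [p0 p1] := andP p01.
have A0 : 0 <= A by have := ha 0%N; rewrite expr0 mulr1; apply: le_trans; exact: cabs_ge0.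
have B0 : 0 <= B by have := hb 0%N; rewrite expr0 mulr1; apply: le_trans; exact: cabs_ge0.
have hab := ccvgM (FF := eventually_filter) ca cb.
pose D := 2 * (2 * A * B).
have key N : cabs (series (conv a b : nat -> C) N - series a N * series b N) <=
    D * (N%:R ^+ 2 * p ^+ N).
  pose P := \poly_(i < N) (a i : R[i]); pose Q := \poly_(i < N) (b i : R[i]).
  have sPQ : (size (P * Q)%R <= N + N)%N.
    apply: leq_trans (size_polyMleq _ _) _; apply: leq_trans (leq_pred _) _.
    by apply: leq_add; exact: size_poly.
  have ev (f : nat -> C) : (\poly_(i < N) (f i : R[i])).[1] = series f N.
    by rewrite horner_poly seriesEord /=; apply: eq_bigr => i _; rewrite expr1n mulr1.
  have -> : series a N * series b N = (P * Q).[1] by rewrite hornerM !ev.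
  rewrite (horner_coef_wide _ sPQ) big_split_ord /= seriesEord /=.
  rewrite opprD addrA -sumrB big1 ?sub0r; last first.
    move=> i _; rewrite expr1n mulr1 coefM; apply/eqP; rewrite subr_eq0; apply/eqP.
    rewrite /conv; apply: eq_bigr => j _; rewrite !coef_poly.
    have -> : (j < N)%N by apply: leq_ltn_trans (ltn_ord i); rewrite -ltnS.
    by have -> : (i - j < N)%N by apply: leq_ltn_trans (ltn_ord i); rewrite leq_subr.
  rewrite cabsN; apply: le_trans (cabs_sum _ _ _) _.
  have -> : D * (N%:R ^+ 2 * p ^+ N) = \sum_(i < N) (D * N%:R * p ^+ N).
    by rewrite sumr_const card_ord -mulr_natl; ring.
  apply: ler_sum => i _; rewrite expr1n mulr1 coefM.
  apply: le_trans (cabs_sum _ _ _) _.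
  have hP j : cabs P`_j <= A * p ^+ j.
    by rewrite coef_poly; case: ifP => _ //; rewrite cabs0 mulr_ge0 ?exprn_ge0.
  have hQ j : cabs Q`_j <= B * p ^+ j.
    by rewrite coef_poly; case: ifP => _ //; rewrite cabs0 mulr_ge0 ?exprn_ge0.
  apply: (@le_trans _ _ (\sum_(j < (N + i).+1) A * B * p ^+ N)).
    apply: ler_sum => j _; rewrite cabsM.
    apply: (@le_trans _ _ ((A * p ^+ j) * (B * p ^+ (N + i - j)))).
      by rewrite ler_pM ?cabs_ge0.
    rewrite mulrACA -exprD subnKC; last by rewrite -ltnS.
    rewrite ler_wpM2l ?mulr_ge0 // exprD ler_piMr ?exprn_ge0 // exprn_ile1 //.
    exact: ltW.
  rewrite sumr_const card_ord -[_ *+ (N + i).+1]mulr_natl.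
  have hN : (N + i).+1%:R <= (2 * N%:R : R).
    by rewrite -natrM ler_nat mul2n -addnn -addnS leq_add2l.
  rewrite (_ : D * N%:R * p ^+ N = (4 * N%:R) * (A * B * p ^+ N)); last by rewrite /D; ring.
  rewrite ler_wpM2r ?mulr_ge0 ?exprn_ge0 //; apply: le_trans hN _.
  by rewrite ler_wpM2r // ?ler_nat.
have c0 : (fun N => D * (N%:R ^+ 2 * p ^+ N)) @ \oo --> 0.
  rewrite -[X in _ --> X](mulr0 D); apply: cvgMl_tmp.
  exact: cvg_natsqr_expr.
apply/ccvgP => e e0; have e2 : 0 < e / 2 by rewrite divr_gt0.
move/rcvgP : c0 => /(_ _ e2) c0; move/ccvgP: hab => /(_ _ e2) hab.
near=> N; apply: le_lt_trans (cabs_tri _ (series a N * series b N) _) _.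
rewrite (splitr e); apply: ltrD; last by near: N; exact: hab.
apply: le_lt_trans (key N) _; apply: le_lt_trans (ler_norm _) _.
by rewrite -[X in `|X|]subr0; near: N; exact: c0.
Unshelve. all: by end_near. Qed.

Lemma cvg_series_geo (a : nat -> C) (A p : R) : 0 <= p < 1 ->
  (forall n, cabs (a n) <= A * p ^+ n) -> exists l : C, series a @ \oo --> l.
Proof.
move=> /andP[p0 p1] ha.
have hg : cvgn (series (fun n => A * p ^+ n)).
  by apply: is_cvg_geometric_series; rewrite ger0_norm.
have A0 : 0 <= A by have := ha 0%N; rewrite expr0 mulr1; apply: le_trans; exact: cabs_ge0.
have hr (f : R[i] -> R) : (forall z, `|f z| <= cabs z) -> cvgn (series (fun n => f (a n))).
  move=> hf; apply: normed_cvg; apply: series_le_cvg hg => n.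
  - exact: normr_ge0.
  - by rewrite mulr_ge0 // exprn_ge0.
  - exact: le_trans (hf _) (ha n).
have /cvg_ex[x hx] := hr (@complex.Re R) (@Re_le_cabs R).
have /cvg_ex[y hy] := hr (@complex.Im R) (@Im_le_cabs R).
exists (x +i* y); apply/ccvg_ReIm => /=; split.
  by rewrite (_ : (fun _ => _) = series (fun n => complex.Re (a n))) //; apply/funext => n; rewrite /series /= cRe_sum.
by rewrite (_ : (fun _ => _) = series (fun n => complex.Im (a n))) //; apply/funext => n; rewrite /series /= cIm_sum.
Qed.

(** Analyticity with the data that estimates need: a radius r of validity and a geometric bound A
    B^n of the coefficients. *)
Definition has_pser u (f : C -> C) a (r A B : R) :=
  [/\ 0 < r, 0 < B, forall n, cabs (u n) <= A * B ^+ n &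
    forall z, cabs (z - a) < r -> series (fun n => u n * (z - a) ^+ n : C) @ \oo --> f z].

Lemma has_pser_ge0 u f a r A B : has_pser u f a r A B -> 0 <= A.
Proof.
by case=> _ _ /(_ 0%N) + _; rewrite expr0 mulr1; apply: le_trans; exact: cabs_ge0.
Qed.

(** Convergence at the single point a + r/2 bounds the terms there, hence the coefficients
    geometrically with B = 2/r. *)
Lemma analytic_has_pser f a : analytic_at f a ->
  exists u r A B, has_pser u f a r A B.
Proof.
move=> [u /cnbhsP[r r0 h]]; exists u, r.
pose z0 : C := a + (r / 2)%:C; pose q := r / 2.
have q0 : 0 < q by rewrite divr_gt0.
have z0a : z0 - a = q%:C by rewrite /z0 addrC addKr.
have hz0 : cabs (z0 - a) < r.
  by rewrite z0a cabs_real gtr0_norm // /q; lra.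
have := h _ hz0; rewrite z0a => /ccvgP /(_ 1 ltr01) [N _ hN].
pose g n := cabs (u n) * q ^+ n.
have gn n : (N <= n)%N -> g n <= 2.
  move=> Nn; have := hN n Nn; have := hN n.+1 (leqW Nn) => /= h1 h2.
  have -> : g n = cabs (u n * q%:C ^+ n) by rewrite cabsM cabsX cabs_real gtr0_norm.
  rewrite -(seriesSB (fun n => u n * q%:C ^+ n : C)).
  apply: le_trans (cabs_tri _ (f z0) _) _; rewrite [X in _ + X]cabsB.
  by move: h1 h2; rewrite /=; lra.
have g0 n : 0 <= g n by rewrite mulr_ge0 ?cabs_ge0 // exprn_ge0 // ltW.
(* From N on, consecutive partial sums are within 1 of the limit, so the terms are at most 2; the
   sum takes care of the finitely many earlier terms. *)
exists (2 + \sum_(i < N) g i), q^-1; split=> //; first by rewrite invr_gt0.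
move=> n; rewrite exprVn ler_pdivlMr ?exprn_gt0 // -/(g n).
have [Nn|nN] := leqP N n.
  by apply: le_trans (gn n Nn) _; rewrite lerDl sumr_ge0.
by rewrite (bigD1 (Ordinal nN)) //= addrCA lerDl addr_ge0 // sumr_ge0.
Qed.

Lemma has_pser_le u f a r A B r' A' B' : has_pser u f a r A B ->
  0 < r' <= r -> A <= A' -> B <= B' -> has_pser u f a r' A' B'.
Proof.
move=> h /andP[r0 rr] AA BB; have A0 := has_pser_ge0 h; case: h => h1 h2 h3 h4.
split=> //; first exact: lt_le_trans BB.
  move=> n; apply: le_trans (h3 n) _; rewrite ler_pM ?exprn_ge0 ?(ltW h2) //.
  by rewrite lerXn2r // nnegrE ltW // (lt_le_trans h2).
by move=> z hz; apply: h4; exact: lt_le_trans rr.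
Qed.

Lemma series_at0 u : series (fun n => u n * 0 ^+ n : C) @ \oo --> u 0%N.
Proof.
apply/ccvgP => e e0; exists 1%N => // -[//|n] _ /=.
by rewrite seriesEord /= big_ord_recl expr0 mulr1 big1 ?addr0 ?subrr ?cabs0 // => i _; rewrite expr0n mulr0.
Qed.

Lemma has_pser_at u f a r A B : has_pser u f a r A B -> f a = u 0%N.
Proof.
case=> r0 _ _ /(_ a); rewrite subrr cabs0 => /(_ r0) h.
exact: ccvg_unique h (@series_at0 u).
Qed.

(** Taylor remainder of order k: with ratio at most 1/2 the majorant tail is at most twice its first
    term. *)
Lemma pser_tail u f a r A B k z : has_pser u f a r A B ->
  cabs (z - a) < r -> B * cabs (z - a) <= 2^-1 ->
  cabs (f z - \sum_(n < k) u n * (z - a) ^+ n) <= 2 * A * (B * cabs (z - a)) ^+ k.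
Proof.
move=> h zr zB; have A0 := has_pser_ge0 h; case: h => r0 B0 hu hf.
set p := B * cabs (z - a) in zB *.
have p0 : 0 <= p by rewrite mulr_ge0 ?cabs_ge0 // ltW.
set S := \sum_(n < k) _.
have c : (fun N => series (fun n => u n * (z - a) ^+ n : C) N + - S : C) @ \oo --> (f z - S : C).
  by apply: ccvgD; [exact: hf|exact: ccvg_cst].
apply: ccvg_cabs_le c _; exists k => // N /= kN.
rewrite /S -(big_mkord xpredT (fun n => u n * (z - a) ^+ n)) /series /=.
rewrite (big_cat_nat (leq0n k) kN) /= addrAC subrr add0r.
apply: le_trans (cabs_sum _ _ _) _.
apply: (@le_trans _ _ (\sum_(k <= i < N) A * p ^+ i)).
  apply: ler_sum => i _; rewrite cabsM cabsX exprMn mulrA ler_wpM2r //.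
  by rewrite exprn_ge0 ?cabs_ge0.
suff : \sum_(k <= i < N) A * p ^+ i <= 2 * A * (p ^+ k - p ^+ N).
  move/le_trans; apply; rewrite ler_wpM2l ?mulr_ge0 // gerBl exprn_ge0 //.
elim: N kN => [|N IH]; first by rewrite leqn0 => /eqP ->; rewrite big_geq // subrr mulr0.
rewrite leq_eqVlt => /predU1P[->|]; first by rewrite big_geq // subrr mulr0.
rewrite ltnS => kN; rewrite big_nat_recr //=; apply: le_trans (lerD (IH kN) (lexx _)) _.
have : A * p ^+ N * p <= A * p ^+ N * 2^-1 by rewrite ler_wpM2l // mulr_ge0 // exprn_ge0.
rewrite exprSr; lra.
Qed.

Lemma analytic_ext f g a : (\forall z \near a, f z = g z) -> analytic_at f a -> analytic_at g a.
Proof. by move=> h [u hu]; exists u; apply: filterS2 h hu => z <-. Qed.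

Lemma eq_analytic f g a : f =1 g -> analytic_at f a -> analytic_at g a.
Proof. by move=> /funext ->. Qed.

Lemma analytic_cst c a : analytic_at (fun=> c) a.
Proof.
exists (fun n => if n is 0%N then c else 0); apply/cnbhsP; exists 1 => // z _.
apply/ccvgP => e e0; exists 1%N => // -[//|n] _ /=.
by rewrite seriesEord /= big_ord_recl expr0 mulr1 big1 ?addr0 ?subrr ?cabs0 // => i _; rewrite mul0r.
Qed.

Lemma analytic_add f g a : analytic_at f a -> analytic_at g a ->
  analytic_at (fun z => f z + g z) a.
Proof.
move=> [u hu] [v hv]; exists (fun n => u n + v n); apply: filterS2 hu hv => z hz1 hz2.
rewrite (_ : series _ = fun N => series (fun n => u n * (z - a) ^+ n : C) N +
   series (fun n => v n * (z - a) ^+ n : C) N).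
  exact: ccvgD hz1 hz2.
by apply/funext => N; rewrite /series /= -big_split /=; apply: eq_bigr => i _; rewrite mulrDl.
Qed.

Lemma analytic_mul f g a : analytic_at f a -> analytic_at g a ->
  analytic_at (fun z => f z * g z) a.
Proof.
move=> /analytic_has_pser[u [r1 [A1 [B1 h1]]]] /analytic_has_pser[v [r2 [A2 [B2 h2]]]].
have B1p : 0 < B1 by case: h1. have B2p : 0 < B2 by case: h2.
pose B := B1 + B2; have B0 : 0 < B by rewrite addr_gt0.
pose r := Num.min (Num.min r1 r2) (2 * B)^-1.
have r0 : 0 < r by case: h1 h2 => ? _ _ _ [? _ _ _]; rewrite !lt_min invr_gt0 mulr_gt0 // andbT; apply/andP.
have {}h1 : has_pser u f a r A1 B.
  by apply: has_pser_le h1 _ _ _; rewrite ?r0 ?ge_min ?lexx // lerDl ltW.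
have {}h2 : has_pser v g a r A2 B.
  by apply: has_pser_le h2 _ _ _; rewrite ?r0 ?ge_min ?lexx ?orbT // lerDr ltW.
exists (conv u v); apply/cnbhsP; exists r => // z zr.
case: h1 => _ _ hu /(_ z zr) cu; case: h2 => _ _ hv /(_ z zr) cv.
pose p := B * cabs (z - a).
have p01 : 0 <= p < 1.
  rewrite mulr_ge0 ?cabs_ge0 ?ltW //= /p -ltr_pdivlMl // mulr1.
  apply: lt_le_trans zr _; rewrite /r ge_min; apply/orP; right.
  by rewrite invfM ler_piMl ?invr_ge0 ?ltW //; lra.
have := @series_conv _ _ A1 A2 p _ _ p01 _ _ cu cv; rewrite (_ : conv _ _ = fun n => conv u v n * (z - a) ^+ n).
  by apply=> n; rewrite cabsM cabsX /p exprMn mulrA ler_wpM2r // exprn_ge0 // cabs_ge0.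
apply/funext => n; rewrite /conv mulr_suml; apply: eq_bigr => i _.
by rewrite mulrACA -exprD subnKC // -ltnS.
Qed.

Lemma analytic_scale (c : C) f a : analytic_at f a -> analytic_at (fun z => c * f z) a.
Proof. by move=> h; apply: (@analytic_mul (fun=> c)); [exact: analytic_cst|exact: h]. Qed.

Lemma analytic_opp f a : analytic_at f a -> analytic_at (fun z => - f z) a.
Proof. by move=> /(analytic_scale (-1)); apply: eq_analytic => z; rewrite mulN1r. Qed.

Lemma analytic_sub f g a : analytic_at f a -> analytic_at g a ->
  analytic_at (fun z => f z - g z) a.
Proof. by move=> h1 h2; apply: (@analytic_add f (fun z => - g z)); [exact: h1|exact: analytic_opp]. Qed.

Lemma analytic_affine (c d : C) f a : analytic_at f (c * a + d) ->
  analytic_at (fun z => f (c * z + d)) a.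
Proof.
move=> /analytic_has_pser[u [r [A [B [r0 B0 hu hf]]]]].
exists (fun n => u n * c ^+ n); apply/cnbhsP.
have c1 : 0 < cabs c + 1 by rewrite ltr_wpDl ?cabs_ge0.
exists (r / (cabs c + 1)); first by rewrite divr_gt0.
move=> z hz; have e : c * z + d - (c * a + d) = c * (z - a) by ring.
have := hf (c * z + d); rewrite e (_ : (fun n => _) = fun n => u n * c ^+ n * (z - a) ^+ n).
  apply; rewrite cabsM; move: hz; rewrite ltr_pdivlMr //; apply: le_lt_trans.
  by rewrite mulrC ler_wpM2l ?cabs_ge0 // lerDl.
by apply/funext => n; rewrite exprMn mulrA.
Qed.

Lemma analytic_id a : analytic_at (fun z => z) a.
Proof.
exists (fun n => match n with 0 => a | 1 => 1 | _ => 0 end); apply/cnbhsP; exists 1 => // z _.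
apply/ccvgP => e e0; exists 2%N => // -[//|[//|n]] _ /=.
rewrite seriesEord /= 2!big_ord_recl expr0 expr1 mulr1 mul1r big1 ?addr0 => [|i _]; last first.
  by rewrite mul0r.
by rewrite addrCA subrr addr0 subrr cabs0.
Qed.

Lemma analytic_cvg f a : analytic_at f a -> f z @[z --> a] --> f a.
Proof.
move=> /analytic_has_pser[u [r [A [B h]]]]; have A0 := has_pser_ge0 h.
have [r0 B0 _ _] := h.
apply: (iffRL (@ccvgP R C (nbhs a) _ f (f a))) => e e0; apply/cnbhsP.
have BA : 0 < 2 * A * B + 1 by rewrite ltr_wpDl // !mulr_ge0 // ltW.
exists (Num.min (Num.min r (2 * B)^-1) (e / (2 * A * B + 1))).
  by rewrite !lt_min r0 invr_gt0 mulr_gt0 // divr_gt0.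
move=> z; rewrite !lt_min => /andP[/andP[zr zB] ze].
have zB' : B * cabs (z - a) <= 2^-1.
  by rewrite -ler_pdivlMl // -invfM mulrC ltW.
have := pser_tail 1 h zr zB'; rewrite big_ord1 expr0 mulr1 -(has_pser_at h) expr1.
move/le_lt_trans; apply; move: ze; rewrite ltr_pdivlMr //; apply: le_lt_trans.
by rewrite mulrA [leRHS]mulrC ler_wpM2r ?cabs_ge0 // lerDl.
Qed.

(** If some coefficient is nonzero, the first such u_k wins: close to a the term u_k (z - a)^k
    exceeds the remainder of order k + 1. *)
Lemma analytic_isolated f a : analytic_at f a ->
  (\forall z \near a, f z = 0) \/ (\forall z \near a^', f z != 0).
Proof.
move=> /analytic_has_pser[u [r [A [B h]]]]; have A0 := has_pser_ge0 h.
have [r0 B0 hu hf] := h.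
have [u0|/existsNP] := pselect (forall n, u n = 0).
  left; apply/cnbhsP; exists r => // z /hf.
  rewrite (_ : (fun n => _) = fun=> 0); last by apply/funext => n; rewrite u0 mul0r.
  move=> hz; apply: ccvg_unique hz _.
  by rewrite (_ : series _ = fun=> 0); [exact: ccvg_cst|apply/funext => n; rewrite /series /= big1].
move=> hex; have {}hex : exists n, u n != 0 by case: hex => n hn; exists n; exact/eqP.
right; pose k := ex_minn hex.
have [uk kmin] : u k != 0 /\ forall n, (n < k)%N -> u n = 0.
  rewrite /k; case: ex_minnP => m hm mm; split=> // n nm; apply/eqP/negPn/negP => /mm.
  by rewrite leqNgt nm.
apply/cdnbhsP; pose D := 2 * A * B ^+ k.+1 + 1.
have D0 : 0 < D by rewrite ltr_wpDl // !mulr_ge0 // exprn_ge0 // ltW.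
exists (Num.min (Num.min r (2 * B)^-1) (cabs (u k) / D)).
  by rewrite !lt_min r0 invr_gt0 mulr_gt0 // divr_gt0 // cabs_gt0.
move=> z /andP[z0]; rewrite !lt_min => /andP[/andP[zr zB] ze].
have zB' : B * cabs (z - a) <= 2^-1.
  by rewrite -ler_pdivlMl // -invfM mulrC ltW.
have := pser_tail k.+1 h zr zB'; rewrite big_ord_recr /= big1 ?add0r; last first.
  by move=> i _; rewrite kmin // mul0r.
move=> hle; apply/eqP => fz; move: hle; rewrite fz sub0r cabsN cabsM cabsX exprMn.
rewrite [cabs (z - a) ^+ k.+1]exprS !mulrA ler_pM2r ?exprn_gt0 // leNgt => /negP; apply.
move: ze; rewrite ltr_pdivlMr //; apply: le_lt_trans.
by rewrite [leRHS]mulrC ler_wpM2r ?cabs_ge0 // lerDl.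
Qed.

End PowerSeries.

(** * Exponential function, reciprocals and the identity theorem *)

Section ComplexExponential.
Context {R : realType}.
Local Notation C := (Cplx R).
Implicit Types (a z w : C) (u v : nat -> C).

Lemma Re_cexp (z : R[i]) : complex.Re (cexp z) = expR (complex.Re z) * cos (complex.Im z).
Proof. by rewrite /cexp cReMr. Qed.

Lemma Im_cexp (z : R[i]) : complex.Im (cexp z) = expR (complex.Re z) * sin (complex.Im z).
Proof. by rewrite /cexp cImMr. Qed.

Lemma cexpD (z w : R[i]) : cexp (z + w) = cexp z * cexp w.
Proof.
by apply: eqCplx; rewrite !(cReM, cImM, Re_cexp, Im_cexp, cReD, cImD, expRD, cosD, sinD); ring.
Qed.

Lemma cexp_real (x : R) : cexp x%:C = (expR x)%:C.
Proof. by apply: eqCplx; rewrite ?Re_cexp ?Im_cexp /= ?cos0 ?sin0 ?mulr1 ?mulr0. Qed.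

Lemma cexp0 : cexp 0 = 1 :> C.
Proof. by rewrite (_ : 0 = 0%:C) // cexp_real expR0. Qed.

Lemma cabs_cexp (z : R[i]) : cabs (cexp z) = expR (complex.Re z).
Proof.
apply/eqP; rewrite -(@eqrXn2 _ 2) ?cabs_ge0 ?expR_ge0 // cabs_sqr Re_cexp Im_cexp.
by rewrite !exprMn -mulrDr cos2Dsin2 mulr1.
Qed.

Lemma cexp_neq0 (z : R[i]) : cexp z != 0.
Proof. by rewrite -cabs_gt0 cabs_cexp expR_gt0. Qed.

Lemma cexpN (z : R[i]) : cexp (- z) = (cexp z)^-1.
Proof.
apply: (mulfI (cexp_neq0 z)); rewrite -cexpD subrr cexp0 divff //.
exact: cexp_neq0.
Qed.

Lemma cexpB (z w : R[i]) : cexp (z - w) = cexp z / cexp w.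
Proof. by rewrite cexpD cexpN. Qed.

Lemma expr_fact_le (x : R) n : 0 <= x -> x ^+ n / n`!%:R <= expR x.
Proof.
move=> x0; case: n => [|n].
  by rewrite expr0 fact0 divr1; apply: le_trans (expR_ge1Dx x); rewrite lerDl.
by apply: le_trans (expR_ge1Dxn n x0); rewrite lerDr.
Qed.

Lemma expr_fact_geo (x : R) n : 0 <= x ->
  x ^+ n / n`!%:R <= expR (2 * x) * 2^-1 ^+ n.
Proof.
move=> x0; rewrite exprVn ler_pdivlMr ?exprn_gt0 // mulrAC -exprMn [x * 2]mulrC.
by apply: expr_fact_le; rewrite mulr_ge0.
Qed.

Definition exp_terms (z : R[i]) (n : nat) : C := z ^+ n / n`!%:R.

Lemma cabs_exp_terms z n : cabs (exp_terms z n) = cabs z ^+ n / n`!%:R.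
Proof. by rewrite /exp_terms cabsM cabsV cabsX cabs_nat. Qed.

Lemma exp_terms_real (x : R) n : exp_terms x%:C n = (exp_coeff x n)%:C.
Proof. by rewrite /exp_terms /exp_coeff /= natrCE -rmorphXn -fmorphV -rmorphM. Qed.

Lemma exp_terms_imag (y : R) n :
  exp_terms (0 +i* y) n = cos_coeff y n +i* sin_coeff y n.
Proof.
have h k : (0 +i* y : R[i]) ^+ k.*2 = ((-1) ^+ k * y ^+ k.*2)%:C.
  rewrite -mul2n !exprM (_ : (0 +i* y) ^+ 2 = (- y ^+ 2)%:C); last first.
    by rewrite expr2; apply: eqCplx; rewrite ?cReM ?cImM /= ?mul0r ?mulr0 ?addr0 ?sub0r.
  by rewrite -rmorphXn /= -exprMn mulN1r.
rewrite /exp_terms /cos_coeff /sin_coeff /= natrCE -fmorphV.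
rewrite -(odd_double_half n); set k := n./2; case: (odd n); rewrite /= ?add0n ?add1n.
  rewrite /= !odd_double /= uphalf_double doubleK exprS h.
  apply: eqCplx; rewrite /= !(mul0r, mulr0, mul1r, subr0, addr0, add0r, oppr0) //.
  by rewrite exprS mulrCA.
rewrite odd_double /= doubleK h -rmorphM.
by apply: eqCplx; rewrite /= !(mul0r, mul1r).
Qed.

Lemma conv_exp_terms z w n : conv (exp_terms z) (exp_terms w) n = exp_terms (z + w) n.
Proof.
have nf (m : nat) : (m`!%:R : R[i]) != 0 by rewrite pnatr_eq0 -lt0n fact_gt0.
rewrite /conv /exp_terms addrC exprDn mulr_suml; apply: eq_bigr => i _.
rewrite mulrACA [RHS]mulrC -mulrnAr -[_ *+ 'C(n, i)]mulr_natr.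
rewrite -(bin_fact (leq_trans (ltn_ord i) (leqnn _) : i <= n)%N) !natrM.
have : ('C(n, i)%:R : R[i]) != 0 by rewrite pnatr_eq0 -lt0n bin_gt0 -ltnS.
move: (nf i) (nf (n - i)%N) => h1 h2 h3; field; by rewrite h1 h2 h3.
Qed.

(** [cexp] is built from the real exponential, cosine and sine. Splitting z = x + iy, the Cauchy
    product reduces the claim to the three real power series. *)
Lemma cvg_exp_terms z : series (exp_terms z) @ \oo --> cexp z.
Proof.
case: z => x y.
have -> : x +i* y = x%:C + (0 +i* y) :> R[i] by apply: eqCplx; rewrite /= ?addr0 ?add0r.
rewrite cexpD; set a := x%:C; set b : R[i] := 0 +i* y.
rewrite (_ : exp_terms (a + b) = conv (exp_terms a) (exp_terms b)); last first.
  by apply/funext => n; rewrite conv_exp_terms.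
pose M := Num.max (expR (2 * cabs a)) (expR (2 * cabs b)).
apply: (@series_conv _ _ _ M M 2^-1).
- by rewrite invr_ge0 ler0n /= invf_lt1 ?ltr1n.
- move=> n; rewrite cabs_exp_terms; apply: le_trans (expr_fact_geo n (cabs_ge0 a)) _.
  by rewrite ler_wpM2r ?exprn_ge0 // le_max lexx.
- move=> n; rewrite cabs_exp_terms; apply: le_trans (expr_fact_geo n (cabs_ge0 b)) _.
  by rewrite ler_wpM2r ?exprn_ge0 // le_max lexx orbT.
- rewrite cexp_real; apply/ccvg_ReIm => /=; split.
    rewrite (_ : (fun _ => _) = series (exp_coeff x)); last first.
      by apply/funext => n; rewrite /series /= cRe_sum; apply: eq_bigr => i _; rewrite exp_terms_real.
    exact: is_cvg_series_exp_coeff.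
  rewrite (_ : (fun _ => _) = fun=> 0); first exact: cvg_cst.
  by apply/funext => n; rewrite /series /= cIm_sum big1 // => i _; rewrite exp_terms_real.
- apply/ccvg_ReIm; rewrite Re_cexp Im_cexp /= expR0 !mul1r; split.
    rewrite (_ : (fun _ => _) = series (cos_coeff y)); last first.
      by apply/funext => n; rewrite /series /= cRe_sum; apply: eq_bigr => i _; rewrite exp_terms_imag.
    by rewrite unlock; exact: is_cvg_series_cos_coeff.
  rewrite (_ : (fun _ => _) = series (sin_coeff y)); last first.
    by apply/funext => n; rewrite /series /= cIm_sum; apply: eq_bigr => i _; rewrite exp_terms_imag.
  by rewrite unlock; exact: is_cvg_series_sin_coeff.
Qed.

Lemma cabs_series_exp_terms z N : cabs (series (exp_terms z) N) <= expR (cabs z).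
Proof.
rewrite /series /=; apply: le_trans (cabs_sum _ _ _) _.
rewrite (eq_bigr (fun i => exp_coeff (cabs z) i)); last first.
  by move=> i _; rewrite cabs_exp_terms.
have hc : series (exp_coeff (cabs z)) @ \oo --> expR (cabs z) by exact: is_cvg_series_exp_coeff.
rewrite -(cvg_lim (@Rhausdorff R) hc); apply: nondecreasing_cvgn_le; last exact: is_cvg_series_exp_coeff.
apply/nondecreasing_seqP => n; rewrite seriesSr lerDl /exp_coeff /=.
by rewrite divr_ge0 // exprn_ge0 // cabs_ge0.
Qed.

Lemma analytic_cexp a : analytic_at (@cexp R) a.
Proof.
exists (fun n => cexp a / n`!%:R); apply/cnbhsP; exists 1 => // z _.
have -> : cexp z = cexp a * cexp (z - a) by rewrite -cexpD addrC subrK.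
rewrite (_ : series _ = fun N => cexp a * series (exp_terms (z - a)) N : C).
  by apply: ccvgMl; exact: cvg_exp_terms.
apply/funext => N; rewrite /series /= mulr_sumr; apply: eq_bigr => i _.
by rewrite /exp_terms mulrA mulrAC.
Qed.

End ComplexExponential.

Section Reciprocal.
Context {R : realType}.
Local Notation C := (Cplx R).
Implicit Types (a z w : C) (u v : nat -> C).

(** The recursion for the coefficients of 1/f uses all the earlier ones, so the whole initial
    segment is carried along. *)
Fixpoint inv_coefs u (n : nat) : seq C :=
  if n is m.+1 then
    rcons (inv_coefs u m) (- \sum_(k < m.+1) u k.+1 * nth 0 (inv_coefs u m) (m - k))
  else [:: 1].

Lemma size_inv_coefs u n : size (inv_coefs u n) = n.+1.
Proof. by elim: n => //= n IH; rewrite size_rcons IH. Qed.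

Definition inv_coef u n : C := nth 0 (inv_coefs u n) n.

Lemma nth_inv_coefs u n k : (k <= n)%N -> nth 0 (inv_coefs u n) k = inv_coef u k.
Proof.
elim: n => [|n IH]; first by rewrite leqn0 => /eqP ->.
rewrite leq_eqVlt => /predU1P[-> //|kn].
by rewrite /= nth_rcons size_inv_coefs kn IH.
Qed.

Lemma inv_coefS u n : inv_coef u n.+1 = - \sum_(k < n.+1) u k.+1 * inv_coef u (n - k)%N.
Proof.
rewrite {1}/inv_coef /= nth_rcons size_inv_coefs ltnn eqxx; congr (- _).
by apply: eq_bigr => k _; rewrite nth_inv_coefs // leq_subr.
Qed.

Lemma conv_inv_coef u n : u 0%N = 1 -> conv u (inv_coef u) n = (n == 0%N)%:R.
Proof.
move=> u0; case: n => [|n]; first by rewrite /conv big_ord1 u0 mul1r.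
rewrite /conv big_ord_recl u0 mul1r subn0 inv_coefS addrC.
by apply/eqP; rewrite subr_eq0; apply/eqP; apply: eq_bigr => i _; rewrite lift0 subSS.
Qed.

(** Doubling the rate closes the induction: the k-th term of the recursion is at most D^(k+1)
    (2D)^(n-k) = (2D)^(n+1) / 2^(k+1), and the factors 1/2^(k+1) add up to less than 1. *)
Lemma inv_coef_geo u (D : R) : 0 < D -> (forall n, cabs (u n.+1) <= D ^+ n.+1) ->
  forall n, cabs (inv_coef u n) <= (2 * D) ^+ n.
Proof.
move=> D0 hu n; elim/ltn_ind: n => -[|n] IH; first by rewrite /inv_coef /= cabs1.
rewrite inv_coefS cabsN; apply: le_trans (cabs_sum _ _ _) _.
apply: (@le_trans _ _ (\sum_(k < n.+1) (2 * D) ^+ n.+1 * 2^-1 ^+ k.+1)).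
  apply: ler_sum => k _; rewrite cabsM.
  apply: le_trans (ler_pM (cabs_ge0 _) (cabs_ge0 _) (hu k) (IH _ _)) _.
    by rewrite ltnS leq_subr.
  have kn : (k <= n)%N by rewrite -ltnS.
  rewrite (_ : (2 * D) ^+ n.+1 = (2 * D) ^+ k.+1 * (2 * D) ^+ (n - k)); last first.
    by rewrite -exprD addSn subnKC.
  by rewrite mulrAC -exprMn (_ : 2 * D / 2 = D); [exact: lexx|field].
rewrite -mulr_sumr ler_piMr ?exprn_ge0 ?mulr_ge0 ?(ltW D0) //.
suff -> : \sum_(k < n.+1) 2^-1 ^+ k.+1 = 1 - 2^-1 ^+ n.+1 :> R.
  by rewrite gerBl exprn_ge0.
elim: {IH} n => [|n IH]; first by rewrite big_ord1; field.
rewrite big_ord_recr /= IH !exprS; set q := 2^-1 ^+ n; by field.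
Qed.

Lemma analytic_inv1 f a : analytic_at f a -> f a = 1 -> analytic_at (fun z => (f z)^-1) a.
Proof.
move=> /analytic_has_pser[u [r [A [B h]]]] fa; have A0 := has_pser_ge0 h.
have u0 : u 0%N = 1 by rewrite -(has_pser_at h).
have [r0 B0 hu hf] := h; pose D := (A + 1) * B.
have D0 : 0 < D by rewrite mulr_gt0 // ltr_wpDl.
have hD n : cabs (u n.+1) <= D ^+ n.+1.
  apply: le_trans (hu _) _; rewrite exprMn ler_wpM2r ?exprn_ge0 ?(ltW B0) //.
  apply: (@le_trans _ _ (A + 1)); first by rewrite lerDl.
  by rewrite exprS ler_peMr ?exprn_ege1 ?addr_ge0 // lerDr.
have hv := inv_coef_geo D0 hD; set v := inv_coef u in hv.
(* The coefficients of the inverse grow like (2D)^n, so this radius makes the terms of both series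
   O(2^-n), as [series_conv] requires. *)
exists v; apply/cnbhsP; exists (Num.min r (4 * (D + B))^-1).
  by rewrite lt_min r0 invr_gt0 mulr_gt0 // addr_gt0.
move=> z; rewrite lt_min => /andP[zr zD].
have {}zD : (D + B) * cabs (z - a) <= 4^-1.
  by rewrite -ler_pdivlMl ?addr_gt0 // -invfM mulrC ltW.
have c0 := cabs_ge0 (z - a).
have half : 0 <= (2^-1 : R) < 1 by rewrite invr_ge0 ler0n /= invf_lt1 ?ltr1n.
have B0' := ltW B0; have D0' := ltW D0.
have Dc : 0 <= D * cabs (z - a) by exact: mulr_ge0.
have Bc : 0 <= B * cabs (z - a) by exact: mulr_ge0.
have b1 n : cabs (u n * (z - a) ^+ n) <= A * 2^-1 ^+ n.
  rewrite cabsM cabsX; apply: le_trans (ler_wpM2r _ (hu n)) _; first by rewrite exprn_ge0.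
  rewrite -mulrA -exprMn; apply: ler_wpM2l => //; apply: lerXn2r; rewrite ?nnegrE ?invr_ge0 //.
  move: zD; rewrite mulrDl; lra.
have b2 n : cabs (v n * (z - a) ^+ n) <= 1 * 2^-1 ^+ n.
  rewrite cabsM cabsX mul1r; apply: le_trans (ler_wpM2r _ (hv n)) _; first by rewrite exprn_ge0.
  have h2 : 2 * (D * cabs (z - a)) <= 2^-1 by move: zD; rewrite mulrDl; lra.
  by rewrite -exprMn -mulrA; apply: lerXn2r; rewrite ?nnegrE ?invr_ge0 ?(mulr_ge0 _ Dc) //.
have [l hl] := cvg_series_geo half b2.
pose M := Num.max A 1.
have M1 n : cabs (u n * (z - a) ^+ n) <= M * 2^-1 ^+ n.
  by apply: le_trans (b1 n) _; rewrite ler_wpM2r ?exprn_ge0 // le_max lexx.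
have M2 n : cabs (v n * (z - a) ^+ n) <= M * 2^-1 ^+ n.
  by apply: le_trans (b2 n) _; rewrite ler_wpM2r ?exprn_ge0 // le_max lexx orbT.
have hp := series_conv half M1 M2 (hf z zr) hl.
suff e1 : f z * l = 1.
  have fz : f z != 0 by apply/eqP => f0; move: e1; rewrite f0 mul0r => /esym/eqP; rewrite oner_eq0.
  have -> : (f z)^-1 = l by apply: (mulfI fz); rewrite e1 divff.
  exact: hl.
apply: ccvg_unique hp _.
rewrite (_ : conv _ _ = fun n => (n == 0%N)%:R * 0 ^+ n).
  exact: (@series_at0 _ (fun n => (n == 0%N)%:R)).
apply/funext => n; rewrite -[in RHS](conv_inv_coef _ u0).
have -> : conv (fun n0 => u n0 * (z - a) ^+ n0) (fun n0 => v n0 * (z - a) ^+ n0) n =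
    conv u v n * (z - a) ^+ n.
  rewrite /conv mulr_suml; apply: eq_bigr => i _.
  by rewrite mulrACA -exprD subnKC // -ltnS.
rewrite (conv_inv_coef n u0); case: n => [|n]; last by rewrite !mul0r.
by rewrite !expr0.
Qed.

Lemma analytic_inv f a : analytic_at f a -> f a != 0 -> analytic_at (fun z => (f z)^-1) a.
Proof.
move=> h fa; have h1 : analytic_at (fun z => (f a)^-1 * f z) a by exact: analytic_scale.
have := analytic_inv1 h1 (mulVf fa) => /(analytic_scale (f a)^-1).
by apply: eq_analytic => z; rewrite invfM invrK mulKf.
Qed.

End Reciprocal.

Section IdentityTheorem.
Context {R : realType}.
Local Notation C := (Cplx R).
Implicit Types (a b z w : C) (f g h : C -> C).

Definition meromorphic_at f a := analytic_at f a \/ pole_at f a.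

Lemma cdnbhs_ex a (P : set C) : nbhs a^' P -> exists z, P z.
Proof.
move=> /cdnbhsP[r r0 h]; exists (a + (r / 2)%:C); apply: h.
by rewrite addrC addKr cabs_real gtr0_norm divr_gt0 //= ltr_pdivrMr // ltr_pMr // ltr1n.
Qed.

Lemma analytic_expB (n : nat) a b : analytic_at (fun z => (z - b) ^+ n) a.
Proof.
elim: n => [|n IH]; first by apply: eq_analytic (analytic_cst 1 a) => z; rewrite expr0.
have h : analytic_at (fun z => z - b) a.
  exact: analytic_sub (analytic_id a) (analytic_cst b a).
by apply: eq_analytic (analytic_mul h IH) => z; rewrite exprS.
Qed.

Lemma meromorphic_form f a : meromorphic_at f a ->
  exists n h, analytic_at h a /\ \forall z \near a^', f z * (z - a) ^+ n = h z.
Proof.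
move=> [h|[n [h [n0 h1 h2 h3]]]].
  exists 0%N, f; split; first exact: h.
  apply/cdnbhsP; exists 1 => // z _.
  by rewrite expr0 mulr1.
exists n, h; split; first exact: h1.
move/cdnbhsP : h3 => [r r0 hr]; apply/cdnbhsP; exists r => // z zr.
rewrite hr // divfK // expf_neq0 // -cabs_gt0; by case/andP: zr.
Qed.

(** After both poles are multiplied away, f - g becomes an analytic function near a, whose zeros are
    isolated unless it vanishes identically. *)
Lemma meromorphic_dichotomy f g a : meromorphic_at f a -> meromorphic_at g a ->
  (\forall z \near a^', f z = g z) \/ (\forall z \near a^', f z != g z).
Proof.
move=> /meromorphic_form[n [h [hh /cdnbhsP[r r0 hr]]]] /meromorphic_form[m [k [hk /cdnbhsP[s s0 hs]]]].
pose D z : C := h z * (z - a) ^+ m - k z * (z - a) ^+ n.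
have aD : analytic_at D a.
  exact: analytic_sub (analytic_mul hh (analytic_expB m a a)) (analytic_mul hk (analytic_expB n a a)).
have DE z : 0 < cabs (z - a) < r -> 0 < cabs (z - a) < s ->
    D z = (f z - g z) * ((z - a) ^+ n * (z - a) ^+ m).
  by move=> zr zs; rewrite /D -hr // -hs //; ring.
have n0 z : 0 < cabs (z - a) -> (z - a) ^+ n * (z - a) ^+ m != 0.
  by rewrite cabs_gt0 => z0; rewrite mulf_neq0 // expf_neq0.
case: (analytic_isolated aD) => [/cnbhsP[q q0 hq]|/cdnbhsP[q q0 hq]]; [left|right];
  apply/cdnbhsP; exists (Num.min q (Num.min r s)); rewrite ?lt_min ?q0 ?r0 //;
  move=> z; rewrite !lt_min => /and4P[z0 zq zr zs].
- have := hq z zq; rewrite DE ?z0 // => /eqP; rewrite mulf_eq0 (negPf (n0 _ z0)) orbF.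
  by rewrite subr_eq0 => /eqP.
- have := hq z; rewrite z0 zq => /(_ isT); rewrite DE ?z0 //.
  by rewrite mulf_eq0 negb_or subr_eq0 => /andP[].
Qed.

(** A punctured neighbourhood of p contains one of every point q close to p, provided it is small
    enough to avoid p. *)
Lemma near_punctured_open a b (P : C -> Prop) :
  open [set x : R | \forall z \near (a + x%:C * (b - a))^', P z].
Proof.
rewrite openE /= => x /= /cdnbhsP[r r0 h].
pose K := cabs (b - a) + 1; have K0 : 0 < K by rewrite ltr_wpDl ?cabs_ge0.
rewrite /interior; apply/nbhs_normP; exists (r / K) => /=; first by rewrite divr_gt0.
move=> y /=; rewrite ltr_pdivlMr // => xy.
set p := a + x%:C * (b - a) in h *; set q := a + y%:C * (b - a).
have pq : cabs (q - p) < r.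
  rewrite (_ : q - p = (y - x)%:C * (b - a)); last by rewrite /q /p rmorphB; ring.
  rewrite cabsM cabs_real distrC; apply: le_lt_trans xy.
  by rewrite ler_wpM2l // lerDl.
have [qp|qp] := eqVneq q p; first by rewrite qp; apply/cdnbhsP; exists r.
(* The bound |q - p| keeps out p itself, where P may fail. *)
apply/cdnbhsP; exists (Num.min (r - cabs (q - p)) (cabs (q - p))).
  by rewrite lt_min subr_gt0 pq cabs_gt0 subr_eq0.
move=> z; rewrite lt_min => /and3P[z0 z1 z2]; apply: h; apply/andP; split.
  rewrite cabs_gt0 subr_eq0; apply/eqP => zp.
  by move: z2; rewrite zp cabsB ltxx.
by apply: le_lt_trans (cabs_tri _ q _) _; rewrite -ltrBrDr.
Qed.

(** Connectedness of [0, 1]: the parameters near whose point f and g agree form an open set, and by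
    the dichotomy the complement is open too. Meromorphy along the segment is enough. *)
Lemma meromorphic_identity f g a b :
  (forall x : R, 0 <= x <= 1 -> meromorphic_at f (a + x%:C * (b - a)) /\
     meromorphic_at g (a + x%:C * (b - a))) ->
  (\forall z \near a^', f z = g z) -> (\forall z \near b^', f z = g z).
Proof.
move=> hm ha; pose p (x : R) : C := a + x%:C * (b - a).
pose B := [set x : R | x \in `[0, 1] /\ \forall z \near (p x)^', f z = g z].
have p0 : p 0 = a by rewrite /p mul0r addr0.
have p1 : p 1 = b by rewrite /p mul1r addrC subrK.
suff : B = [set` `[(0 : R), 1]].
  move=> /seteqP[_ /(_ 1)]; rewrite /B /= in_itv /= ler01 lexx p1 => /(_ isT) [_].
  exact.
apply: (@segment_connected R 0 1).
- by exists 0; split; [rewrite in_itv /= lexx ler01|rewrite p0; exact: ha].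
- exists [set x : R | \forall z \near (p x)^', f z = g z].
    exact: near_punctured_open.
  by apply/seteqP; split=> x h; exact: h.
- exists (~` [set x : R | \forall z \near (p x)^', f z != g z]).
    by rewrite closedC; exact: near_punctured_open.
  apply/seteqP; split=> x /= [x1].
    move=> h1; split; first exact: x1.
    move=> h2.
    have [z [h3 /eqP h4]] := cdnbhs_ex (filterI h1 h2); exact: h4.
  move=> h; split; first exact: x1.
  have [] := hm x; first by move: x1; rewrite in_itv.
  move=> m1 m2; case: (meromorphic_dichotomy m1 m2) => [h1|h1]; first exact: h1.
  by case: (h h1).
Qed.

Lemma analytic_zero_limit f a : analytic_at f a -> (\forall z \near a^', f z = 0) -> f a = 0.
Proof.
move=> hf h; case: (analytic_isolated hf) => [/nbhs_singleton //|h'].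
by have [z [h1 /eqP h2]] := cdnbhs_ex (filterI h h').
Qed.

(** A pole of g at a is impossible: its numerator h would agree with f(z) (z - a)^n near a and so
    vanish at a. *)
Lemma meromorphic_eq_at f g a : analytic_at f a -> meromorphic_at g a ->
  (\forall z \near a^', f z = g z) -> f a = g a.
Proof.
move=> hf [hg|[n [h [n0 hh ha /cdnbhsP[r r0 hr]]]]] /cdnbhsP[s s0 hs].
  apply/eqP; rewrite -subr_eq0; apply/eqP.
  apply: (@analytic_zero_limit (fun z => f z - g z)); first exact: analytic_sub hf hg.
  by apply/cdnbhsP; exists s => // z zs; rewrite hs // subrr.
have hb : analytic_at (fun z => h z - f z * (z - a) ^+ n) a.
  exact: analytic_sub hh (analytic_mul hf (analytic_expB n a a)).
have : \forall z \near a^', h z - f z * (z - a) ^+ n = 0.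
  apply/cdnbhsP; exists (Num.min r s); first by rewrite lt_min r0.
  move=> z; rewrite lt_min => /and3P[z0 zr zs].
  rewrite hs ?z0 // hr ?z0 // divfK ?subrr // expf_neq0 // -cabs_gt0 //.
move=> /(analytic_zero_limit hb); rewrite subrr expr0n eqn0Ngt n0 mulr0 subr0 => h0.
by rewrite h0 eqxx in ha.
Qed.

(** Any candidate F determines the function chosen by [xget] wherever F is analytic; a0 is an
    interior point of D from which agreement spreads along a segment to a. At a pole of F the chosen
    value remains unknown. *)
Lemma meromorphic_continuationE (D : set C) f F a0 :
  (\forall z \near a0, D z) -> meromorphic F -> (forall s, D s -> F s = f s) ->
  forall a, analytic_at F a -> meromorphic_continuation D f a = F a.
Proof.
move=> /cnbhsP[r r0 hD] mF hF a aF; rewrite /meromorphic_continuation.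
case: xgetP => [G _ [mG hG]|/(_ F) []//].
apply/esym; apply: (meromorphic_eq_at aF (mG a)).
apply: (@meromorphic_identity F G a0 a) => [x _|]; first by split; [exact: mF|exact: mG].
apply/cdnbhsP; exists r => // z /andP[_ /hD zD].
by rewrite hF // hG.
Qed.

End IdentityTheorem.

(** * Theta series and Jacobi's transformation *)

Section ThetaSeries.
Context {R : realType}.
Implicit Types x : R.

Definition theta_term x (n : nat) : R := expR (- pi * n.+1%:R ^+ 2 * x).

Lemma theta_term_ge0 x n : 0 <= theta_term x n.
Proof. exact: expR_ge0. Qed.

Lemma theta_term_geo x n : 0 < x -> theta_term x n <= expR (- (pi * x)) * expR (- (pi * x)) ^+ n.
Proof.
move=> x0; rewrite -exprS -expRM_natl ler_expR.
rewrite !(mulNr, mulrN) lerN2 mulrAC [leLHS]mulrC ler_wpM2l ?mulr_ge0 ?pi_ge0 ?(ltW x0) //.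
by rewrite -natrX ler_nat leq_pmulr.
Qed.

Lemma expRNpi_lt1 x : 0 < x -> 0 <= expR (- (pi * x)) < 1.
Proof. by move=> x0; rewrite expR_ge0 expR_lt1 oppr_lt0 mulr_gt0 // pi_gt0. Qed.

Lemma cvg_theta_term x : 0 < x -> cvgn (series (theta_term x)).
Proof.
move=> x0; apply: (@series_le_cvg _ _ (fun n => expR (- (pi * x)) * expR (- (pi * x)) ^+ n)).
- by move=> n; exact: theta_term_ge0.
- by move=> n; rewrite mulr_ge0 ?exprn_ge0 ?expR_ge0.
- by move=> n; exact: theta_term_geo.
- have /andP[h0 h1] := expRNpi_lt1 x0.
  by apply: is_cvg_geometric_series; rewrite ger0_norm.
Qed.

Lemma nneseries_real (f : nat -> R) : (forall n, 0 <= f n) -> cvgn (series f) ->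
  \esum_(n in [set: nat]) (f n)%:E = (limn (series f))%:E.
Proof.
move=> f0 cf; rewrite -nneseries_esumT; last by move=> n; rewrite lee_fin.
rewrite -EFin_lim //; congr (limn _); apply/funext => n /=.
by rewrite -sumEFin.
Qed.

Lemma theta_series x : 0 < x -> theta x = 1 + 2 * limn (series (theta_term x)).
Proof.
move=> x0; pose F (n : int) : R := expR (- pi * n%:~R ^+ 2 * x).
rewrite /theta (esumID [set n : int | 0 <= n]); last by move=> n _; rewrite lee_fin expR_ge0.
rewrite !setTI.
have -> : \esum_(n in [set n : int | 0 <= n]) (F n)%:E =
    \esum_(n in [set: nat]) (F (Posz n))%:E.
  apply: (@reindex_esum _ _ _ [set: nat] [set n : int | 0 <= n] Posz (fun n => (F n)%:E)).
  split; first by move=> n _ /=.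
    by move=> a b _ _ [].
  by case=> [n _|//]; exists n.
have -> : \esum_(n in ~` [set n : int | 0 <= n]) (F n)%:E =
    \esum_(n in [set: nat]) (F (Negz n))%:E.
  apply: (@reindex_esum _ _ _ [set: nat] (~` [set n : int | 0 <= n]) Negz (fun n => (F n)%:E)).
  split; first by move=> n _ /=.
    by move=> a b _ _ [].
  by case=> [n /= h|n _]; [case: h|exists n].
have FP n : F (Posz n.+1) = theta_term x n by [].
have FN n : F (Negz n) = theta_term x n.
  by rewrite /F /theta_term NegzE mulrNz sqrrN.
have ct := cvg_theta_term x0.
rewrite (esumID [set 0%N]); last by move=> n _; rewrite lee_fin expR_ge0.
rewrite !setTI esum_set1 ?lee_fin ?expR_ge0 //.
have -> : \esum_(n in ~` [set 0%N]) (F (Posz n))%:E = \esum_(n in [set: nat]) (theta_term x n)%:E.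
  rewrite (@reindex_esum _ _ _ [set: nat] (~` [set 0%N]) S (fun n => (F (Posz n))%:E)) //.
  split; first by move=> n _ /=.
    by move=> a b _ _ [].
  case=> [h|n _]; [by case: h|by exists n].
under [X in (_ + X)%E]eq_esum do rewrite FN.
rewrite nneseries_real //; last by move=> n; exact: theta_term_ge0.
by rewrite /F /= expr0n /= mulr0 mul0r expR0; ring.
Qed.

Lemma cvg_theta_series x : 0 < x ->
  series (theta_term x) @ \oo --> (theta x - 1) / 2.
Proof.
move=> x0; rewrite theta_series //.
rewrite (_ : (_ - 1) / 2 = limn (series (theta_term x))); last by field.
exact: cvg_theta_term.
Qed.

Lemma theta_ge1 x : 0 < x -> 1 <= theta x.
Proof.
move=> x0; rewrite theta_series // lerDl mulr_ge0 //.
apply: limr_ge; first exact: cvg_theta_term.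
by near=> n; apply: sumr_ge0 => i _; exact: theta_term_ge0.
Unshelve. all: by end_near. Qed.

Lemma sum_geo_le (A p : R) M N : 0 <= A -> 0 <= p < 1 -> 
  \sum_(M <= k < N) A * p ^+ k <= A * p ^+ M / (1 - p).
Proof.
move=> A0 /andP[p0 p1]; have q0 : 0 < 1 - p by rewrite subr_gt0.
have [NM|MN] := leqP N M.
  by rewrite big_geq // !mulr_ge0 ?exprn_ge0 ?invr_ge0 ?(ltW q0).
suff : \sum_(M <= k < N) A * p ^+ k <= A * (p ^+ M - p ^+ N) / (1 - p).
  move/le_trans; apply; rewrite ler_wpM2r ?invr_ge0 ?(ltW q0) // ler_wpM2l //.
  by rewrite gerBl exprn_ge0.
have {MN} := ltnW MN; elim: N => [|N IH]; first by rewrite leqn0 => /eqP ->; rewrite big_geq // subrr mulr0 mul0r.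
rewrite leq_eqVlt => /predU1P[->|]; first by rewrite big_geq // subrr mulr0 mul0r.
rewrite ltnS => kN; rewrite big_nat_recr //=; apply: le_trans (lerD (IH kN) (lexx _)) _.
rewrite le_eqVlt; apply/orP; left; apply/eqP; rewrite exprS.
by field; rewrite gt_eqF.
Qed.

(** Tannery's theorem: dominated convergence for sums whose length also grows. A geometric majorant
    makes the part beyond a fixed M uniformly small. *)
Lemma tannery (f : nat -> nat -> R) (F : nat -> R) (K : nat -> nat) (A p l : R) :
  0 <= p < 1 -> 
  (\forall n \near \oo, forall k, (k < K n)%N -> `|f n k| <= A * p ^+ k) ->
  (forall k, \forall n \near \oo, (k < K n)%N) ->
  (forall k, f n k @[n --> \oo] --> F k) ->
  series F @ \oo --> l ->
  \sum_(k < K n) f n k @[n --> \oo] --> l.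
Proof.
move=> p01 hf hK hF hl; have [p0 p1] := andP p01; have q0 : 0 < 1 - p by rewrite subr_gt0.
pose A' := `|A|; have A0 : 0 <= A' by rewrite normr_ge0.
have {}hf : \forall n \near \oo, forall k, (k < K n)%N -> `|f n k| <= A' * p ^+ k.
  apply: filterS hf => n hn k kn; apply: le_trans (hn k kn) _.
  by rewrite ler_wpM2r ?exprn_ge0 // ler_norm.
apply/rcvgP => e e0; have e3 : 0 < e / 3 by rewrite divr_gt0.
have hgeo : (fun M => A' / (1 - p) * p ^+ M) @ \oo --> A' / (1 - p) * 0.
  by apply: cvgMl_tmp; apply: cvg_expr; rewrite ger0_norm.
rewrite mulr0 in hgeo; move/rcvgP: hgeo => /(_ _ e3) hgeo; move/rcvgP : hl => /(_ _ e3) hl.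
have [M [hM1 hM2]] := filter_ex (filterI hgeo hl).
have hS : \sum_(k < M) f n k @[n --> \oo] --> \sum_(k < M) F k.
  elim: (M) => [|m IH].
    rewrite big_ord0 (_ : (fun _ => _) = fun=> 0); first exact: cvg_cst.
    by apply/funext => n; rewrite big_ord0.
  rewrite big_ord_recr (_ : (fun n => _) = fun n => \sum_(k < m) f n k + f n m).
    by apply: cvgD; [exact: IH|exact: hF].
  by apply/funext => n; rewrite big_ord_recr.
move/rcvgP: hS => /(_ _ e3) hS.
near=> n.
have MK : (M < K n)%N by near: n; exact: hK.
have h1 : `|\sum_(k < M) f n k - \sum_(k < M) F k| < e / 3 by near: n; exact: hS.
have h2 : forall k, (k < K n)%N -> `|f n k| <= A' * p ^+ k by near: n; exact: hf.
rewrite -(big_mkord xpredT (f n)) (big_cat_nat (leq0n M) (ltnW MK)) /= big_mkord.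
have h3 : `|\sum_(M <= k < K n) f n k| < e / 3.
  apply: le_lt_trans (ler_norm_sum _ _ _) _.
  apply: (@le_lt_trans _ _ (\sum_(M <= k < K n) A' * p ^+ k)).
    by rewrite big_nat [leRHS]big_nat; apply: ler_sum => k /andP[_ kn]; exact: h2.
  apply: le_lt_trans (sum_geo_le _ _ A0 p01) _; move: hM1; rewrite subr0.
  by apply: le_lt_trans; rewrite mulrAC ler_norm.
move: hM2; rewrite seriesEord /=; move: h1 h3; rewrite !ltr_norml.
by move=> /andP[? ?] /andP[? ?] /andP[? ?]; apply/andP; split; lra.
Unshelve. all: by end_near. Qed.

End ThetaSeries.

(** * Polya's finite identity between powers of cosines and binomial coefficients *)

Section PolyaIdentity.
Context {R : realType}.

(** A power w^i = 1 with 0 < i < l would have real part 1 = 1 - 2 sin(pi i/l)^2, yet the sine is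
    positive on ]0, pi[. *)
Lemma cexp_turn (l : nat) : (0 < l)%N ->
  l.-primitive_root (cexp (0 +i* (2 * pi / l%:R)) : R[i]).
Proof.
move=> l0; have lR : (0 : R) < l%:R by rewrite ltr0n.
set w := cexp _.
have wX k : w ^+ k = cexp (0 +i* (2 * pi * (k%:R / l%:R))) :> R[i].
  elim: k => [|k IH]; first by rewrite expr0 mul0r mulr0 -[RHS]/(cexp (0 : R[i])) cexp0.
  rewrite exprS IH -cexpD; congr cexp; apply: eqCplx; rewrite /= ?addr0 //.
  by rewrite -natr1; field; rewrite gt_eqF.
rewrite /primitive_root_of_unity l0 /=; apply/forallP => i.
rewrite unity_rootE wX; apply/eqP; have [->|il] := eqVneq i.+1 l.
  rewrite divff ?(gt_eqF lR) // mulr1; apply/eqP; apply: eqCplx.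
    by rewrite Re_cexp /= expR0 mul1r mulr_natl cos2pi.
  by rewrite Im_cexp /= expR0 mul1r mulr_natl sin2pi.
apply/negbTE/eqP => /(congr1 (@complex.Re R)).
rewrite Re_cexp /= expR0 mul1r.
have {}il : (i.+1 < l)%N by rewrite ltn_neqAle il ltn_ord.
pose v : R := pi * (i.+1%:R / l%:R).
have -> : 2 * pi * (i.+1%:R / l%:R) = v *+ 2 by rewrite -[RHS]mulr_natl /v mulrA.
have v0 : 0 < sin v.
  apply: sin_gt0_pi; rewrite /v mulr_gt0 ?pi_gt0 ?divr_gt0 ?ltr0n //=.
  by rewrite gtr_pMr ?pi_gt0 // ltr_pdivrMr // mul1r ltr_nat.
rewrite cos_mulr2n cos2sin2 => h; have : sin v ^+ 2 = 0 by move: h; rewrite -[_ *+ 2]mulr_natl; lra.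
by move/eqP; rewrite sqrf_eq0 gt_eqF.
Qed.

Lemma sum_unity_root (l : nat) (z : R[i]) : z ^+ l = 1 ->
  \sum_(k < l) z ^+ k = if z == 1 then l%:R else 0.
Proof.
move=> zl; case: eqVneq => [->|z1].
  by rewrite (eq_bigr (fun=> 1)) ?sumr_const ?card_ord // => i _; rewrite expr1n.
apply: (mulfI (_ : z - 1 != 0)); first by rewrite subr_eq0.
by rewrite -subrX1 zl subrr mulr0.
Qed.

Lemma one_add_cexp (u : R) : 1 + cexp (0 +i* (2 * u)) = (2 * cos u)%:C * cexp (0 +i* u) :> R[i].
Proof.
have e : 2 * u = u *+ 2 by rewrite mulr_natl.
apply: eqCplx; rewrite ?cReMr ?cImMr ?cReD ?cImD ?Re_cexp ?Im_cexp /= expR0 !mul1r e.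
  by rewrite cos_mulr2n; ring.
by rewrite sin_mulr2n add0r; ring.
Qed.

(** With u = pi k/l and w^k = e^(2iu) one has (2 cos u)^(2m) = (1 + w^k)^(2m) / w^(km). Expanding
    and summing over k leaves geometric sums of l-th roots of unity, which select the indices i = m
    mod l. *)
Lemma polya_roots (l m : nat) : (0 < l)%N ->
  \sum_(k < l) (2 * cos (pi * (k%:R / l%:R))) ^+ (2 * m) =
  \sum_(i < (2 * m).+1) (if i == m %[mod l] then l%:R else 0) * 'C(2 * m, i)%:R :> R.
Proof.
move=> l0; apply: complexI; rewrite !rmorph_sum /=.
have pw := cexp_turn l0; set w := cexp _ in pw.
have lR : (0 : R) < l%:R by rewrite ltr0n.
have wX (k : nat) : w ^+ k = cexp (0 +i* (2 * (pi * (k%:R / l%:R)))) :> R[i].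
  elim: k => [|k IH]; first by rewrite expr0 mul0r !mulr0 -[RHS]/(cexp (0 : R[i])) cexp0.
  rewrite exprS IH -cexpD; congr cexp; apply: eqCplx; rewrite /= ?addr0 //.
  by rewrite -natr1; field; rewrite gt_eqF.
have w0 : w != 0 by exact: cexp_neq0.
transitivity (\sum_(k < l) \sum_(i < (2 * m).+1) (w ^+ i / w ^+ m) ^+ k * 'C(2 * m, i)%:R).
  apply: eq_bigr => k _; rewrite rmorphXn /=; set u := pi * _.
  have eu : cexp (0 +i* u) ^+ 2 = w ^+ k :> R[i].
    rewrite wX expr2 -cexpD; congr cexp; apply: eqCplx; rewrite /= ?addr0 // -/u; ring.
  have -> : (2 * cos u)%:C ^+ (2 * m) = (1 + w ^+ k) ^+ (2 * m) / (w ^+ k) ^+ m :> R[i].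
    have -> : (w ^+ k) ^+ m = cexp (0 +i* u) ^+ (2 * m) by rewrite -eu -exprM.
    rewrite wX -/u one_add_cexp exprMn mulfK // expf_neq0 //; exact: cexp_neq0.
  rewrite exprDn mulr_suml; apply: eq_bigr => i _.
  rewrite expr1n mul1r -mulr_natr mulrAC expr_div_n -!exprM ![(k * _)%N]mulnC //.
rewrite exchange_big /=; apply: eq_bigr => i _; rewrite -mulr_suml sum_unity_root.
  rewrite rmorphM /= -natrCE; congr (_ * _).
  rewrite -(eq_prim_root_expr pw) -(inj_eq (mulIf (expf_neq0 m w0)) _ 1) mul1r divfK ?expf_neq0 //.
  by case: ifP => _ //; rewrite natrCE.
by rewrite expr_div_n -!exprM ![(_ * l)%N]mulnC !exprM (prim_expr_order pw) !expr1n divr1.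
Qed.

(** The terms k and l - k coincide; as l is odd, only k = 0 is left unpaired. *)
Lemma polya_cos_sum (h m : nat) (l := h.*2.+1) :
  \sum_(k < l) (2 * cos (pi * (k%:R / l%:R))) ^+ (2 * m) =
  4 ^+ m * (1 + 2 * \sum_(k < h) cos (pi * (k.+1%:R / l%:R)) ^+ (2 * m)) :> R.
Proof.
pose f (k : nat) : R := (2 * cos (pi * (k%:R / l%:R))) ^+ (2 * m).
have fE k : f k = 4 ^+ m * cos (pi * (k%:R / l%:R)) ^+ (2 * m).
  by rewrite /f exprMn [2 ^+ (2 * m)]exprM -natrX.
have fr k : (k <= l)%N -> f (l - k)%N = f k.
  move=> kl; rewrite !fE !(exprM _ 2 m); congr (_ * _ ^+ m).
  rewrite natrB // mulrBl divff ?pnatr_eq0 // mulrBr mulr1 cosB cospi sinpi mul0r addr0.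
  by rewrite mulN1r sqrrN.
rewrite -/l; transitivity (f 0%N + \sum_(k < h.*2) f k.+1); first by rewrite big_ord_recl.
have -> : \sum_(k < h.*2) f k.+1 = 2 * \sum_(k < h) f k.+1.
  rewrite -addnn big_split_ord /= mulr_natl mulr2n; congr (_ + _).
  rewrite (reindex_inj rev_ord_inj) /=; apply: eq_bigr => k _.
  rewrite -[RHS]fr; last by rewrite /l ltnS -addnn (leq_trans (ltnW (ltn_ord k))) ?leq_addr.
  congr f; rewrite /l -addnn subSS.
  by rewrite -addnS -subSn ?ltn_ord // subSS -addnBA // ltnW.
rewrite (eq_bigr _ (fun (k : 'I_h) _ => fE k.+1)) -mulr_sumr fE mul0r mulr0 cos0 expr1n.
by ring.
Qed.

(** The selected indices are m plus multiples of l, symmetric about m. The sum over k < m is longer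
    than necessary, but binomial coefficients with m + l (k + 1) > 2m vanish. *)
Lemma polya_bin_sum (l m : nat) : (0 < l)%N ->
  \sum_(i < (2 * m).+1) (if i == m %[mod l] then l%:R else 0) * 'C(2 * m, i)%:R =
  l%:R * ('C(2 * m, m)%:R + 2 * \sum_(k < m) 'C(2 * m, m + l * k.+1)%:R) :> R.
Proof.
move=> l0; pose f (i : nat) : R := (if i == m %[mod l] then l%:R else 0) * 'C(2 * m, i)%:R.
pose g (j : nat) : R := if (l %| j)%N then 'C(2 * m, m + j)%:R else 0.
have fp (j : nat) : f (m + j)%N = l%:R * g j.
  rewrite /f /g -[in LHS](addn0 m) -addnA eqn_modDl mod0n /dvdn add0n.
  by rewrite addn0; case: ifP; rewrite ?mul0r ?mulr0.
have fm (j : nat) : (j <= m)%N -> f (m - j)%N = f (m + j)%N.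
  move=> jm; rewrite fp /f /g -(eqn_modDr j) subnK // -[X in X == _ %[mod _]](addn0 m).
  rewrite eqn_modDl mod0n eq_sym -/(dvdn l j) -bin_sub; last first.
    by rewrite (leq_trans (leq_subr _ _)) // mul2n -addnn leq_addr.
  rewrite mul2n -addnn -addnBA ?leq_subr // subKn //.
  by case: ifP; rewrite ?mul0r ?mulr0.
rewrite -[LHS]/(\sum_(i < (2 * m).+1) f i) mul2n -addnn -addnS big_split_ord /=.
rewrite big_ord_recl /= addn0 -[in f m](addn0 m) fp /g dvdn0 addn0.
have -> : \sum_(i < m) f i = \sum_(i < m) f (m + i.+1)%N.
  rewrite (reindex_inj rev_ord_inj) /=; apply: eq_bigr => i _.
  by rewrite -fm.
have -> : \sum_(i < m) f (m + bump 0 i)%N = \sum_(i < m) f (m + i.+1)%N.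
  by apply: eq_bigr => i _.
have -> : \sum_(i < m) f (m + i.+1)%N = l%:R * \sum_(i < m) g i.+1.
  by rewrite mulr_sumr; apply: eq_bigr => i _; exact: fp.
rewrite addrCA -mulr2n -[_ *+ 2]mulr_natl mulrCA -mulrDr addnn -mul2n; congr (_ * (_ + 2 * _)).
transitivity (\sum_(i < m) \sum_(k < m) (if i.+1 == (l * k.+1)%N then ('C(2 * m, m + i.+1)%:R : R) else 0)).
  apply: eq_bigr => i _; rewrite /g; case: ifP => [/dvdnP[q iq]|li].
    have q0 : (0 < q)%N by rewrite lt0n; apply/eqP => q0; move: iq; rewrite q0.
    have qm : (q.-1 < m)%N.
      rewrite prednK //; apply: leq_trans (ltn_ord i); rewrite iq leq_pmulr //.
    rewrite (bigD1 (Ordinal qm)) //= prednK // iq [(q * l)%N]mulnC eqxx big1 ?addr0 // => k kq.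
    rewrite ifF // eqn_pmul2l //; apply/negbTE; apply: contra kq => /eqP qk.
    by apply/eqP/val_inj; rewrite /= qk.
  rewrite big1 // => k _; rewrite ifF //; apply/negbTE; apply: contraFN li => /eqP ->.
  exact: dvdn_mulr.
rewrite exchange_big /=; apply: eq_bigr => k _.
have [lm|ml] := leqP (l * k.+1) m; last first.
  rewrite big1 => [|i _]; first by rewrite bin_small // mul2n -addnn ltn_add2l.
  by rewrite ifF //; apply/negbTE/eqP => ik; move: ml; rewrite -ik ltnS leqNgt ltn_ord.
have kl : ((l * k.+1).-1 < m)%N by rewrite prednK // muln_gt0 l0.
rewrite (bigD1 (Ordinal kl)) //= prednK ?muln_gt0 ?l0 // eqxx big1 ?addr0 ?mul2n ?addnn //.
move=> i ik; rewrite ifF //; apply/negbTE; apply: contra ik => /eqP ik.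
by apply/eqP/val_inj; rewrite /= -ik.
Qed.

(* Polya's elementary route to Jacobi's transformation: the roots of unity filter
   applied to (1 + z)^(2m) equates a theta-like sum of cosines with one of binomial
   coefficients, and both become theta functions when l^2/m tends to a constant. *)
Lemma polya (h m : nat) (l := h.*2.+1) :
  1 + 2 * \sum_(k < h) cos (pi * (k.+1%:R / l%:R)) ^+ (2 * m) =
  l%:R * ('C(2 * m, m)%:R / 4 ^+ m) *
    (1 + 2 * \sum_(k < m) 'C(2 * m, m + l * k.+1)%:R / 'C(2 * m, m)%:R) :> R.
Proof.
have c0 : ('C(2 * m, m)%:R : R) != 0.
  by rewrite pnatr_eq0 -lt0n bin_gt0 mul2n -addnn leq_addr.
have p0 : (4 ^+ m : R) != 0 by rewrite expf_neq0 // pnatr_eq0.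
apply: (mulfI p0); rewrite -polya_cos_sum polya_roots // polya_bin_sum // -mulr_suml.
move: (\sum_(k < m) _) (l%:R : R) => S L; move: p0 c0; move: ('C(2 * m, m)%:R : R) (4 ^+ m : R) => B P p0 c0.
by field; rewrite p0 c0.
Qed.

End PolyaIdentity.

Section ThetaTransformation.
Context {R : realType}.
Implicit Types x : R.

Lemma one_sub_ge_expR (s : R) : 0 <= s < 1 -> expR (- (s / (1 - s))) <= 1 - s.
Proof.
move=> /andP[s0 s1]; have q0 : 0 < 1 - s by rewrite subr_gt0.
rewrite expRN -[leRHS]invrK lef_pV2 ?posrE ?expR_gt0 ?invr_gt0 //.
apply: le_trans (expR_ge1Dx _); rewrite le_eqVlt; apply/orP; left; apply/eqP.
by field; rewrite gt_eqF.
Qed.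

(** Squeeze from e^(-s/(1-s)) <= 1 - s <= e^(-s), raised to the power n. *)
Lemma cvg_one_sub_exp (s : nat -> R) (a : R) :
  (forall n, 0 <= s n <= 1) -> s n @[n --> \oo] --> (0 : R) ->
  n%:R * s n @[n --> \oo] --> a ->
  (1 - s n) ^+ n @[n --> \oo] --> expR (- a).
Proof.
move=> s01 s0 ns.
apply: (@squeeze_cvgr _ _ _ _ (fun n => expR (- (n%:R * s n / (1 - s n))))
  (fun n => expR (- (n%:R * s n)))).
- near=> n; have /andP[sn0 sn1] := s01 n; apply/andP; split.
    rewrite -mulrA -mulrN expRM_natl; apply: lerXn2r; rewrite ?nnegrE ?expR_ge0 ?subr_ge0 //.
    apply: one_sub_ge_expR; rewrite sn0 /=; near: n.
    by move/rcvgP : s0 => /(_ 1 ltr01); apply: filterS => n; rewrite subr0 ltr_norml => /andP[].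
  rewrite -mulrN expRM_natl; apply: lerXn2r; rewrite ?nnegrE ?expR_ge0 ?subr_ge0 //.
  exact: expR_ge1Dx.
- apply: continuous_cvg; first exact: continuous_expR.
  apply: cvgN; rewrite -[X in _ --> X]divr1; apply: cvgM; first exact: ns.
  apply: cvgV; first exact: oner_neq0.
  by rewrite -[X in _ --> X]subr0; apply: cvgB; [exact: cvg_cst|exact: s0].
- apply: continuous_cvg; first exact: continuous_expR.
  by apply: cvgN; exact: ns.
Unshelve. all: by end_near. Qed.

Lemma sin_bounds (u : R) : 0 <= u <= pi / 2 -> u * cos u <= sin u <= u.
Proof.
move=> /andP[u0 u1].
have [c] := @MVT_segment _ (@sin R) (@cos R) 0 u u0 (fun x _ => is_derive_sin x)
  (continuous_subspaceT (@continuous_sin R)).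
rewrite in_itv /= => /andP[c0 cu]; rewrite sin0 !subr0 => ->.
have up : u <= pi by apply: le_trans u1 _; rewrite ler_pdivrMr // ler_peMr ?pi_ge0 // ler1n.
rewrite mulrC ler_wpM2r //=; last first.
  rewrite leNgt; apply/negP; rewrite ltr_cos ?in_itv /= ?u0 ?c0 ?(le_trans cu) //.
  by rewrite ltNge cu.
by rewrite ler_piMl // cos_le1.
Qed.

(** By duplication and [sin_bounds] at u/2, sin u >= u cos(u/2)^2 = u (1 + cos u)/2. *)
Lemma sin_ge_half (u : R) : 0 <= u <= pi / 2 -> u / 2 <= sin u.
Proof.
move=> /andP[u0 u1].
have u20 : 0 <= u / 2 by rewrite divr_ge0.
have h : 0 <= u / 2 <= pi / 2 by rewrite u20 ler_pM2r ?invr_gt0 // (le_trans u1) // ler_pdivrMr // ler_peMr ?pi_ge0 // ler1n.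
have /andP[h1 _] := sin_bounds h.
have c0 : 0 <= cos (u / 2).
  by apply: cos_ge0_pihalf; case/andP: h => [h2 ->]; rewrite (le_trans _ h2) // oppr_le0 divr_ge0 ?pi_ge0.
have cu : 0 <= cos u.
  by apply: cos_ge0_pihalf; rewrite u1 (le_trans _ u0) // oppr_le0 divr_ge0 ?pi_ge0.
have e : u = (u / 2) *+ 2 by rewrite -mulr_natr divfK.
have : cos u = cos (u / 2) ^+ 2 *+ 2 - 1 by rewrite {1}e cos_mulr2n.
have -> : sin u = (cos (u / 2) * sin (u / 2)) *+ 2 by rewrite {1}e sin_mulr2n.
rewrite -[_ *+ 2]mulr_natl -[(_ * _) *+ 2]mulr_natl => ce.
have : cos (u / 2) * (u / 2 * cos (u / 2)) <= cos (u / 2) * sin (u / 2) by rewrite ler_wpM2l.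
have : 0 <= u / 2 * cos u by rewrite mulr_ge0.
rewrite ce; nra.
Qed.

Let bin_ratio (n j : nat) : R := 'C(2 * n, n + j)%:R / 'C(2 * n, n)%:R.

Let bin_mid_neq0 n : 'C(2 * n, n)%:R != 0 :> R.
Proof. by rewrite pnatr_eq0 -lt0n bin_gt0 mul2n -addnn leq_addr. Qed.

Let bin_ratio_ge0 n j : 0 <= bin_ratio n j.
Proof. by rewrite divr_ge0. Qed.

Let bin_ratio0 n : bin_ratio n 0 = 1.
Proof. by rewrite /bin_ratio addn0 divff. Qed.

Let bin_ratioS (n j : nat) : (j < n)%N ->
  bin_ratio n j.+1 = bin_ratio n j * (1 - (2 * j%:R + 1) / (n%:R + j%:R + 1)).
Proof.
move=> jn; have nj1 : (0 : R) < n%:R + j%:R + 1 by rewrite ltr_wpDl // addr_ge0.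
have := mul_bin_left (2 * n) (n + j).
rewrite (_ : 2 * n - (n + j) = n - j)%N; last by rewrite mul2n -addnn subnDl.
move=> /(congr1 (fun k => k%:R : R)); rewrite !natrM natrB ?(ltnW jn) // -[(n + j).+1%:R]natr1 natrD => e.
rewrite /bin_ratio addnS; apply: (mulfI (lt0r_neq0 nj1)); rewrite mulrA e.
by field; rewrite bin_mid_neq0 (gt_eqF nj1).
Qed.

Let odd_ge0 (j : nat) : (0 : R) <= 2 * j%:R + 1.
Proof. by rewrite addr_ge0 // mulr_ge0. Qed.

Let odd_sum (j : nat) : (j.+1%:R : R) ^+ 2 = j%:R ^+ 2 + (2 * j%:R + 1).
Proof. by rewrite -natr1; ring. Qed.

(** Successive ratios are 1 - (2j + 1)/(n + j + 1), and the odd numbers 2j + 1 add up to squares: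
    this is where the Gaussian comes from. A fixed J >= j gives all factors the same denominator;
    the lower bound is obtained likewise. *)
Let bin_ratio_ub (n J j : nat) : (j <= J)%N -> (J <= n)%N ->
  bin_ratio n j <= expR (- (j%:R ^+ 2 / (n%:R + J%:R))).
Proof.
move=> jJ Jn; elim: j jJ => [|j IH] jJ; first by rewrite expr0n !mul0r oppr0 expR0 bin_ratio0.
have jn : (j < n)%N by apply: leq_trans Jn.
have nJ' : (0 : R) < n%:R + J%:R by rewrite ltr_wpDr // ltr0n (leq_ltn_trans _ jn).
have nj1 : (0 : R) < n%:R + j%:R + 1 by rewrite ltr_wpDl // addr_ge0.
rewrite bin_ratioS // odd_sum [X in expR (- X)]mulrDl opprD expRD; apply: ler_pM => //.
- rewrite subr_ge0 ler_pdivrMr // mul1r; have : (j%:R + 1 : R) <= n%:R by rewrite natr1 ler_nat.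
  lra.
- exact: IH (ltnW jJ).
apply: le_trans (expR_ge1Dx _) _; rewrite ler_expR lerN2 ler_wpM2l // lef_pV2 ?posrE //.
by rewrite -addrA lerD2l natr1 ler_nat.
Qed.

Let bin_ratio_lb (n J j : nat) : (j <= J)%N -> (J < n)%N ->
  expR (- (j%:R ^+ 2 / (n%:R - J%:R))) <= bin_ratio n j.
Proof.
move=> jJ Jn; elim: j jJ => [|j IH] jJ; first by rewrite expr0n !mul0r oppr0 expR0 bin_ratio0.
have jn : (j < n)%N by apply: leq_trans jJ (ltnW Jn).
have nJ : (0 : R) < n%:R - J%:R by rewrite subr_gt0 ltr_nat.
have nj : (0 : R) < n%:R - j%:R by rewrite subr_gt0 ltr_nat.
have nj1 : (0 : R) < n%:R + j%:R + 1 by rewrite ltr_wpDl // addr_ge0.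
rewrite bin_ratioS // odd_sum [X in expR (- X)]mulrDl opprD expRD; apply: ler_pM; rewrite ?expR_ge0 //.
  exact: IH (ltnW jJ).
set s := _ / (n%:R + j%:R + 1).
have s0 : 0 <= s by rewrite divr_ge0 // ltW.
have qs : 1 - s = (n%:R - j%:R) / (n%:R + j%:R + 1) by rewrite /s; field; rewrite gt_eqF.
have s1 : s < 1 by rewrite -subr_gt0 qs divr_gt0.
apply: (@le_trans _ _ (expR (- (s / (1 - s))))); last first.
  by apply: one_sub_ge_expR; rewrite s0 s1.
rewrite ler_expR lerN2 qs /s.
have -> : (2 * j%:R + 1) / (n%:R + j%:R + 1) / ((n%:R - j%:R) / (n%:R + j%:R + 1)) =
   (2 * j%:R + 1) / (n%:R - j%:R) :> R by field; rewrite (gt_eqF nj1) (gt_eqF nj).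
by rewrite ler_wpM2l // lef_pV2 ?posrE // lerB // ler_nat ltnW.
Qed.

(** An odd integer within distance 1 of y, since Polya's identity is stated for l = 2h + 1. *)
Definition odd_near (y : R) : nat := (Num.truncn (y / 2)).*2.+1.

Lemma odd_near_bounds y : 0 <= y -> y - 1 < (odd_near y)%:R <= y + 1.
Proof.
move=> y0; have /andP[h1 h2] := @truncn_itv R (y / 2) (divr_ge0 y0 (ler0n _ _)).
rewrite /odd_near -mul2n -[(2 * _).+1%:R]natr1 natrM.
by move: h2; rewrite -[(Num.truncn _).+1%:R]natr1 => h2; apply/andP; split; lra.
Qed.

Section Asymptotics.
Variables (x : R).
Hypothesis x0 : 0 < x.
(** The modulus l(n) follows sqrt(pi x n), so l^2/n tends to pi x. Then (l k)^2/n tends to pi k^2 x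
    on the binomial side, and n (pi k/l)^2 tends to pi k^2/x on the cosine side: the exponents of
    theta(x) and theta(1/x). *)
Let sigma : R := Num.sqrt (pi * x).
Let sigma0 : 0 < sigma.
Proof. by rewrite sqrtr_gt0 mulr_gt0 ?pi_gt0. Qed.

Let y (n : nat) : R := sigma * Num.sqrt n%:R.
Let l (n : nat) : nat := odd_near (y n).

Let px0 : 0 < pi * x. Proof. by rewrite mulr_gt0 ?pi_gt0. Qed.
Let y0 n : 0 <= y n. Proof. by rewrite mulr_ge0 ?sqrtr_ge0. Qed.
Let ysqr n : y n ^+ 2 = pi * x * n%:R.
Proof. by rewrite exprMn !sqr_sqrtr // ltW. Qed.
Let l0 n : (0 : R) < (l n)%:R. Proof. by rewrite ltr0n. Qed.

Let cvg_sqrtV : (Num.sqrt (n%:R : R))^-1 @[n --> \oo] --> (0 : R).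
Proof.
apply/rcvgP => e e0; exists (Num.truncn (e ^- 2)).+1 => // n /= hn.
have ne : e ^- 2 < n%:R.
  by apply: lt_le_trans (truncnS_gt _) _; rewrite ler_nat.
have e2 : 0 < e ^- 2 by rewrite invr_gt0 exprn_gt0.
have n0 : (0 : R) < n%:R by apply: lt_trans ne.
rewrite subr0 ger0_norm ?invr_ge0 ?sqrtr_ge0 // -[ltRHS]invrK ltf_pV2 ?posrE ?invr_gt0 ?sqrtr_gt0 //.
rewrite -(@ltr_pXn2r _ 2) ?nnegrE ?sqrtr_ge0 ?invr_ge0 ?(ltW e0) //.
by rewrite exprVn sqr_sqrtr // ltW.
Qed.

Let cvg_ratio : (l n)%:R / Num.sqrt (n%:R : R) @[n --> \oo] --> sigma.
Proof.
apply/rcvgP => e e0; move/rcvgP: cvg_sqrtV => /(_ _ e0); apply: filterS2 (nbhs_infty_gt 0%N) => n.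
move=> n0; rewrite subr0; apply: le_lt_trans.
have s0 : 0 < Num.sqrt (n%:R : R) by rewrite sqrtr_gt0 ltr0n.
have -> : (l n)%:R / Num.sqrt n%:R - sigma = ((l n)%:R - y n) / Num.sqrt n%:R.
  by rewrite /y; field; rewrite gt_eqF.
rewrite normrM ler_piMl //.
by have := odd_near_bounds (y0 n); rewrite -/(l n) ler_norml => /andP[? ?]; apply/andP; split; lra.
Qed.

Let lsqr_ge n : pi * x * n%:R / 4 <= (l n)%:R ^+ 2.
Proof.
rewrite -ysqr (_ : y n ^+ 2 / 4 = (y n / 2) ^+ 2); last by field.
rewrite lerXn2r ?nnegrE ?divr_ge0 //.
have /andP[h _] := odd_near_bounds (y0 n).
have h1 : (1 : R) <= (l n)%:R by rewrite ler1n.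
move: h h1; rewrite -/(l n); have := y0 n; lra.
Qed.

Let lsqr_le n : (0 < n)%N -> (l n)%:R ^+ 2 <= (2 * (pi * x) + 2) * n%:R.
Proof.
move=> n0; have /andP[_ h] := odd_near_bounds (y0 n); rewrite -/(l n) in h.
have h1 : (1 : R) <= n%:R by rewrite ler1n.
apply: (@le_trans _ _ ((y n + 1) ^+ 2)).
  by rewrite lerXn2r ?nnegrE ?addr_ge0.
have e : (y n + 1) ^+ 2 = 2 * y n ^+ 2 + 2 - (y n - 1) ^+ 2 by ring.
have := sqr_ge0 (y n - 1); rewrite e ysqr mulrDl -mulrA; lra.
Qed.

Let cvg_lsqr k : ((l n)%:R * k) ^+ 2 / n%:R @[n --> \oo] --> pi * x * k ^+ 2.
Proof.
have -> : pi * x * k ^+ 2 = (sigma * k) * (sigma * k).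
  by rewrite -expr2 exprMn sqr_sqrtr // ltW.
have h : (l n)%:R / Num.sqrt (n%:R : R) * k @[n --> \oo] --> sigma * k.
  by apply: cvgMr_tmp; exact: cvg_ratio.
apply: cvg_trans (cvgM h h); apply: near_eq_cvg; near=> n.
have n0 : (0 : R) < n%:R by rewrite ltr0n; near: n; exact: nbhs_infty_gt.
rewrite /= -expr2 !exprMn exprVn sqr_sqrtr ?ler0n //; field; by rewrite gt_eqF.
Unshelve. all: by end_near. Qed.

Let bin_ratio_le (n j : nat) : bin_ratio n j <= expR (- (j%:R ^+ 2 / (2 * n%:R))).
Proof.
have [jn|nj] := leqP j n; last first.
  by rewrite /bin_ratio bin_small ?mul0r ?expR_ge0 // mul2n -addnn ltn_add2l.
case: n jn => [|n] jn.
  by move: jn; rewrite leqn0 => /eqP ->; rewrite expr0n mul0r oppr0 expR0 bin_ratio0.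
apply: le_trans (bin_ratio_ub (leqnn j) jn) _; rewrite ler_expR lerN2 ler_wpM2l ?exprn_ge0 //.
have n0 : (0 : R) < n.+1%:R by rewrite ltr0n.
by rewrite lef_pV2 ?posrE ?mulr_gt0 ?ltr_wpDr // mulr_natl mulr2n lerD2l ler_nat.
Qed.

Lemma cvg_bin_theta :
  1 + 2 * \sum_(k < n) 'C(2 * n, n + l n * k.+1)%:R / 'C(2 * n, n)%:R
    @[n --> \oo] --> theta x.
Proof.
have -> : theta x = 1 + 2 * ((theta x - 1) / 2) by field.
apply: cvgD; first exact: cvg_cst.
apply: cvgMl_tmp.
(* From l^2 >= pi x n/4 and the bound e^(-j^2/(2n)) at j = l (k + 1); the square (k + 1)^2 is then
   weakened to k. *)
pose rho := expR (- (pi * x / 8)).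
have rho01 : 0 <= rho < 1.
  by rewrite expR_ge0 /= expR_lt1 oppr_lt0 divr_gt0.
apply: (@tannery _ (fun n k => bin_ratio n (l n * k.+1)) (theta_term x) (fun n => n) 1 rho).
- exact: rho01.
- near=> n => k kn; have n0 : (0 : R) < n%:R by rewrite ltr0n (leq_ltn_trans _ kn).
  rewrite mul1r ger0_norm //; apply: le_trans (bin_ratio_le _ _) _.
  rewrite -expRM_natl ler_expR mulrN lerN2 natrM exprMn.
  rewrite ler_pdivlMr ?mulr_gt0 //; apply: (@le_trans _ _ (pi * x * n%:R / 4 * k.+1%:R ^+ 2)).
    have -> : pi * x * n%:R / 4 * k.+1%:R ^+ 2 = (k.+1%:R ^+ 2) * (pi * x / 8) * (2 * n%:R) by field.
    rewrite ler_wpM2r ?mulr_ge0 // ler_wpM2r ?divr_ge0 ?(ltW px0) //.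
    by rewrite -natrX ler_nat (leq_trans (leqnSn k)) // leq_pmulr.
  by rewrite ler_wpM2r ?exprn_ge0.
- by move=> k; exists k.+1.
- move=> k; have hk := @cvg_lsqr k.+1%:R.
  have hV : (l n)%:R * k.+1%:R / n%:R @[n --> \oo] --> (0 : R).
    rewrite -(mulr0 (sigma * k.+1%:R)).
    have h1 : (l n)%:R / Num.sqrt (n%:R : R) * k.+1%:R @[n --> \oo] --> sigma * k.+1%:R.
      by apply: cvgMr_tmp; exact: cvg_ratio.
    apply: cvg_trans (cvgM h1 cvg_sqrtV); apply: near_eq_cvg; near=> n.
    have n0 : (0 : R) < n%:R by rewrite ltr0n; near: n; exact: nbhs_infty_gt.
    rewrite /= -[in RHS](sqr_sqrtr (ltW n0)) expr2; field.
    by rewrite gt_eqF // sqrtr_gt0.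
  (* For j = l (k + 1) the exponent is j^2/(n + sg j). The signs -1 and 1 give the lower and upper
     bounds of the binomial ratio; both have the same limit because j/n tends to 0. *)
  have lim_ (sg : R) : expR (- (((l n)%:R * k.+1%:R) ^+ 2 / n%:R / (1 + sg * ((l n)%:R * k.+1%:R / n%:R))))
      @[n --> \oo] --> theta_term x k.
    rewrite /theta_term; have -> : - pi * k.+1%:R ^+ 2 * x = - (pi * x * k.+1%:R ^+ 2 / (1 + sg * 0)) by field.
    apply: continuous_cvg; first exact: continuous_expR.
    apply: cvgN; apply: cvgM; first exact: hk.
    apply: cvgV; first by rewrite mulr0 addr0 oner_neq0.
    by apply: cvgD; [exact: cvg_cst|apply: cvgMl_tmp; exact: hV].
  apply: (@squeeze_cvgr _ _ _ _ _ _ _ _ _ (lim_ (-1)) (lim_ 1)).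
  near=> n; have n0 : (0 : R) < n%:R by rewrite ltr0n; near: n; exact: nbhs_infty_gt.
  have jn : (l n * k.+1 < n)%N.
    rewrite -(ltr_nat R) natrM -[ltRHS]mul1r -ltr_pdivrMr //; near: n.
    by move/rcvgP : hV => /(_ 1 ltr01); apply: filterS => n; rewrite subr0 ltr_norml => /andP[].
  have jn' : (0 : R) < n%:R - (l n)%:R * k.+1%:R by rewrite subr_gt0 -natrM ltr_nat.
  have jn2 : (0 : R) < n%:R + (l n)%:R * k.+1%:R by rewrite ltr_wpDr // mulr_ge0.
  apply/andP; split.
    apply: le_trans (bin_ratio_lb (leqnn _) jn); rewrite ler_expR lerN2 natrM le_eqVlt; apply/orP; left.
    by apply/eqP; move: jn' n0; move: ((l n)%:R * k.+1%:R) (n%:R : R) => J N nJ n0; field; rewrite ?mulN1r !gt_eqF.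
  apply: le_trans (bin_ratio_ub (leqnn _) (ltnW jn)) _; rewrite ler_expR lerN2 natrM le_eqVlt; apply/orP; left.
  by apply/eqP; move: jn2 n0; move: ((l n)%:R * k.+1%:R) (n%:R : R) => J N nJ n0; field; rewrite ?mul1r !gt_eqF.
- exact: cvg_theta_series.
Unshelve. all: by end_near. Qed.

Let hh (n : nat) : nat := Num.truncn (y n / 2).

Lemma cvg_cos_theta :
  1 + 2 * \sum_(k < hh n) cos (pi * (k.+1%:R / (l n)%:R)) ^+ (2 * n)
    @[n --> \oo] --> theta x^-1.
Proof.
have xV : 0 < x^-1 by rewrite invr_gt0.
have -> : theta x^-1 = 1 + 2 * ((theta x^-1 - 1) / 2) by field.
apply: cvgD; first exact: cvg_cst.
apply: cvgMl_tmp.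
(* C is the constant in l^2 <= C n. With sin u >= u/2 the terms (1 - sin(u)^2)^n are at most e^(-n
   u^2/4), and n u^2/4 >= (k + 1)^2 pi^2/(4C). *)
pose C := 2 * (pi * x) + 2; have C0 : 0 < C by rewrite addr_gt0 // mulr_gt0.
pose rho := expR (- (pi ^+ 2 / (4 * C))).
have rho01 : 0 <= rho < 1.
  by rewrite expR_ge0 /= expR_lt1 oppr_lt0 divr_gt0 ?exprn_gt0 ?pi_gt0 ?mulr_gt0.
pose u n k : R := pi * (k.+1%:R / (l n)%:R).
have u_half n k : (k < hh n)%N -> 0 <= u n k <= pi / 2.
  move=> kn; rewrite mulr_ge0 ?pi_ge0 ?divr_ge0 //= ler_wpM2l ?pi_ge0 //.
  rewrite ler_pdivrMr // ler_pdivlMl // -natrM ler_nat mul2n /l /odd_near -/(hh n).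
  by rewrite (leq_trans _ (leqnSn _)) // leq_double.
have cosE n k : cos (u n k) ^+ (2 * n) = (1 - sin (u n k) ^+ 2) ^+ n.
  by rewrite exprM cos2sin2.
have s01 n k : 0 <= sin (u n k) ^+ 2 <= 1.
  by rewrite sqr_ge0 /= sin2cos2 gerBl sqr_ge0.
have hK k : \forall n \near \oo, (k < hh n)%N.
  near=> n.
  have hn : 4 * (k.*2.+1)%:R ^+ 2 / (pi * x) < n%:R.
    near: n; exists (Num.truncn (4 * (k.*2.+1)%:R ^+ 2 / (pi * x) : R)).+1 => // n /= kn.
    by apply: lt_le_trans (truncnS_gt _) _; rewrite ler_nat.
  have : (k.*2.+1 < l n)%N.
    rewrite -(ltr_nat R) -(@ltr_pXn2r _ 2) ?nnegrE ?ler0n //.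
    apply: lt_le_trans (lsqr_ge n); move: hn; rewrite ltr_pdivrMr // => hn.
    by rewrite ltr_pdivlMr // [_ * 4]mulrC [_ * n%:R]mulrC.
  by rewrite /l /odd_near -/(hh n) ltnS ltn_double.
apply: (@tannery _ (fun n k => cos (u n k) ^+ (2 * n)) (theta_term x^-1) hh 1 rho).
- exact: rho01.
- near=> n => k kn; have n0 : (0 < n)%N by near: n; exact: nbhs_infty_gt.
  have nR : (0 : R) < n%:R by rewrite ltr0n.
  rewrite mul1r cosE ger0_norm ?exprn_ge0 ?subr_ge0 ?(andP (s01 n k)).2 //.
  apply: (@le_trans _ _ (expR (- sin (u n k) ^+ 2) ^+ n)).
    apply: lerXn2r; rewrite ?nnegrE ?expR_ge0 ?subr_ge0 ?(andP (s01 n k)).2 //.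
    exact: expR_ge1Dx.
  rewrite -!expRM_natl ler_expR !mulrN lerN2.
  have hs := sin_ge_half (u_half n k kn).
  have u0 : 0 <= u n k by case/andP: (u_half n k kn).
  apply: (@le_trans _ _ (n%:R * (u n k / 2) ^+ 2)); last first.
    by rewrite ler_wpM2l // lerXn2r // nnegrE ?divr_ge0 // (le_trans _ hs) // divr_ge0.
  have lk : (l n)%:R ^+ 2 <= C * n%:R by exact: lsqr_le.
  have -> : n%:R * (u n k / 2) ^+ 2 = k.+1%:R ^+ 2 * (pi ^+ 2 / 4) * (n%:R / (l n)%:R ^+ 2).
    by rewrite /u; field; rewrite (gt_eqF (l0 n)).
  apply: (@le_trans _ _ (k.+1%:R ^+ 2 * (pi ^+ 2 / 4) * C^-1)).
    have -> : k.+1%:R ^+ 2 * (pi ^+ 2 / 4) / C = k.+1%:R ^+ 2 * (pi ^+ 2 / (4 * C)) by field; rewrite gt_eqF.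
    rewrite ler_wpM2r ?divr_ge0 ?sqr_ge0 ?mulr_ge0 ?(ltW C0) //.
    by rewrite -natrX ler_nat (leq_trans (leqnSn k)) // leq_pmulr.
  have hC : C^-1 <= n%:R / (l n)%:R ^+ 2.
    by rewrite ler_pdivlMr ?exprn_gt0 // ler_pdivrMl.
  by apply: ler_wpM2l hC; rewrite mulr_ge0 ?divr_ge0 ?sqr_ge0.
- exact: hK.
- move=> k; rewrite (_ : (fun n => _) = fun n => (1 - sin (u n k) ^+ 2) ^+ n); last first.
    by apply/funext => n; rewrite cosE.
  have u_to0 : u n k @[n --> \oo] --> (0 : R).
    have -> : 0 = pi * k.+1%:R * (sigma^-1 * 0) :> R by rewrite !mulr0.
    have h : ((l n)%:R / Num.sqrt (n%:R : R))^-1 * (Num.sqrt (n%:R : R))^-1 @[n --> \oo] --> sigma^-1 * 0.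
      by apply: cvgM; [apply: cvgV; [rewrite gt_eqF|exact: cvg_ratio]|exact: cvg_sqrtV].
    apply: cvg_trans (cvgMl_tmp (a := pi * k.+1%:R) h); apply: near_eq_cvg; near=> n.
    have n0 : (0 : R) < n%:R by rewrite ltr0n; near: n; exact: nbhs_infty_gt.
    rewrite /u; field; by rewrite (gt_eqF (l0 n)) gt_eqF // sqrtr_gt0.
  have sin0_ : sin (u n k) @[n --> \oo] --> (0 : R).
    by rewrite -[X in _ --> X]sin0; apply: continuous_cvg; [exact: continuous_sin|exact: u_to0].
  have cos1_ : cos (u n k) @[n --> \oo] --> (1 : R).
    by rewrite -[X in _ --> X]cos0; apply: continuous_cvg; [exact: continuous_cos|exact: u_to0].
  have nu2 : n%:R * u n k ^+ 2 @[n --> \oo] --> pi * k.+1%:R ^+ 2 / x.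
    have -> : pi * k.+1%:R ^+ 2 / x = (pi * k.+1%:R) ^+ 2 * (pi * x * 1 ^+ 2)^-1.
      by move: (@pi R) (@pi_gt0 R) => p p0; field; rewrite !gt_eqF.
    have h : (((l n)%:R * 1) ^+ 2 / n%:R)^-1 @[n --> \oo] --> (pi * x * 1 ^+ 2)^-1.
      by apply: cvgV; [rewrite expr1n mulr1 gt_eqF|exact: cvg_lsqr].
    apply: cvg_trans (cvgMl_tmp (a := (pi * k.+1%:R) ^+ 2) h); apply: near_eq_cvg; near=> n.
    have n0 : (0 : R) < n%:R by rewrite ltr0n; near: n; exact: nbhs_infty_gt.
    rewrite /u; field; by rewrite (gt_eqF (l0 n)) gt_eqF.
  rewrite /theta_term (_ : - pi * _ * _ = - (pi * k.+1%:R ^+ 2 / x)); last by rewrite !mulNr.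
  apply: cvg_one_sub_exp; first by move=> n; exact: s01.
    rewrite (_ : (fun n => _) = fun n => sin (u n k) * sin (u n k)); last first.
      by apply/funext => n; rewrite expr2.
    by rewrite -[X in _ --> X](mulr0 0); apply: cvgM; exact: sin0_.
  have lo : n%:R * u n k ^+ 2 * (cos (u n k) * cos (u n k)) @[n --> \oo] --> pi * k.+1%:R ^+ 2 / x.
    by rewrite -[X in _ --> X]mulr1 -[X in _ * X](mulr1 1); apply: cvgM; [exact: nu2|apply: cvgM; exact: cos1_].
  apply: (@squeeze_cvgr _ _ _ _ _ _ _ _ _ lo nu2); near=> n.
  have kn : (k < hh n)%N by near: n; exact: hK.
  have uh := u_half n k kn; have /andP[u0 u1] := uh; have /andP[h1 h2] := sin_bounds uh.
  have c0 : 0 <= cos (u n k).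
    by apply: cos_ge0_pihalf; rewrite u1 (le_trans _ u0) // oppr_le0 divr_ge0 ?pi_ge0.
  have s0 : 0 <= sin (u n k) := le_trans (mulr_ge0 u0 c0) h1.
  rewrite -mulrA -expr2 -exprMn; apply/andP; split; apply: ler_wpM2l => //.
    by apply: lerXn2r; rewrite ?nnegrE ?(mulr_ge0 u0 c0).
  by apply: lerXn2r; rewrite ?nnegrE.
- exact: cvg_theta_series.
Unshelve. all: by end_near. Qed.

(** Polya's identity solved for the central binomial coefficient: the cosine sum tends to
    theta(1/x), the sum of ratios to theta(x), and l/sqrt n to sigma. *)
Lemma cvg_central_bin :
  'C(2 * n, n)%:R / 4 ^+ n * Num.sqrt (n%:R : R) @[n --> \oo] --> theta x^-1 / theta x / sigma.
Proof.
have t0 : theta x != 0 by rewrite gt_eqF // (lt_le_trans ltr01) // theta_ge1.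
have h : (1 + 2 * \sum_(k < hh n) cos (pi * (k.+1%:R / (l n)%:R)) ^+ (2 * n)) *
    (1 + 2 * \sum_(k < n) 'C(2 * n, n + l n * k.+1)%:R / 'C(2 * n, n)%:R)^-1 *
    ((l n)%:R / Num.sqrt (n%:R : R))^-1 @[n --> \oo] --> theta x^-1 / theta x / sigma.
  apply: cvgM; first by apply: cvgM; [exact: cvg_cos_theta|apply: cvgV; [exact: t0|exact: cvg_bin_theta]].
  by apply: cvgV; [rewrite gt_eqF|exact: cvg_ratio].
apply: cvg_trans h; apply: near_eq_cvg; near=> n.
have n0 : (0 : R) < n%:R by rewrite ltr0n; near: n; exact: nbhs_infty_gt.
have s0 : Num.sqrt (n%:R : R) != 0 by rewrite gt_eqF // sqrtr_gt0.
rewrite polya -/(l n); set B := 1 + _; set b := 'C(_, n)%:R / _.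
have B0 : B != 0.
  rewrite gt_eqF // ltr_wpDr // mulr_ge0 // sumr_ge0 // => k _; exact: divr_ge0.
rewrite -[(hh n).*2.+1]/(l n); move: (l0 n); move: (l n)%:R => L L0.
by field; rewrite s0 B0 (gt_eqF L0).
Unshelve. all: by end_near. Qed.

End Asymptotics.

(* The limit in cvg_central_bin does not depend on x; evaluating it at x = 1 as well
   avoids Wallis' product. *)
Theorem theta_inv x : 0 < x -> theta x^-1 = Num.sqrt x * theta x.
Proof.
move=> x0; have h1 := cvg_central_bin x0; have h2 := cvg_central_bin ltr01.
have := cvg_unique (@Rhausdorff R) h1 h2.
have t0 : theta x != 0 by rewrite gt_eqF // (lt_le_trans ltr01) // theta_ge1.
have t1 : theta (1 : R) != 0 by rewrite gt_eqF // (lt_le_trans ltr01) // theta_ge1.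
have s0 : Num.sqrt x != 0 by rewrite gt_eqF // sqrtr_gt0.
have p0 : Num.sqrt (pi : R) != 0 by rewrite gt_eqF // sqrtr_gt0 pi_gt0.
rewrite invr1 divff // mulr1 sqrtrM ?pi_ge0 // div1r => e.
have -> : theta x^-1 = theta x^-1 / theta x / (Num.sqrt pi * Num.sqrt x) * (Num.sqrt pi * Num.sqrt x * theta x).
  by field; rewrite t0 s0 p0.
by rewrite e; field.
Qed.

End ThetaTransformation.

(** * The product formula for theta and the coefficients of its square root *)

Section PowerSeriesCongruence.
Context {F : fieldType}.
Implicit Types (p q u : {poly F}) (N : nat).

(** Formal power series are represented by polynomials modulo a power of X. *)
Definition eqX N p q := 'X^N %| p - q.

Lemma eqX_refl N p : eqX N p p.
Proof. by rewrite /eqX subrr dvdp0. Qed.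

Lemma eqX_sym N p q : eqX N p q -> eqX N q p.
Proof. by rewrite /eqX -opprB dvdpNr. Qed.

Lemma eqX_trans N p q u : eqX N p q -> eqX N q u -> eqX N p u.
Proof. by move=> h1 h2; have := dvdp_add h1 h2; rewrite addrA subrK. Qed.

Lemma eqX_add N p q p' q' : eqX N p q -> eqX N p' q' -> eqX N (p + p') (q + q').
Proof. by move=> h1 h2; have := dvdp_add h1 h2; rewrite /eqX opprD addrACA. Qed.

Lemma eqX_mul N p q p' q' : eqX N p q -> eqX N p' q' -> eqX N (p * p') (q * q').
Proof.
move=> h1 h2; rewrite /eqX (_ : _ - _ = (p - q) * p' + q * (p' - q')); last by ring.
by apply: dvdp_add; [exact: dvdp_mulr|exact: dvdp_mull].
Qed.

Lemma eqX_exp N p q k : eqX N p q -> eqX N (p ^+ k) (q ^+ k).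
Proof.
move=> h; elim: k => [|k IH]; first by rewrite !expr0 eqX_refl.
by rewrite !exprS; exact: eqX_mul.
Qed.

Lemma eqX_sum N (I : Type) (r : seq I) (P : pred I) (f g : I -> {poly F}) :
  (forall i, P i -> eqX N (f i) (g i)) ->
  eqX N (\sum_(i <- r | P i) f i) (\sum_(i <- r | P i) g i).
Proof.
move=> h; elim/big_ind2 : _ => //; first exact: eqX_refl.
by move=> *; exact: eqX_add.
Qed.

Lemma eqX_prod N (I : Type) (r : seq I) (P : pred I) (f g : I -> {poly F}) :
  (forall i, P i -> eqX N (f i) (g i)) ->
  eqX N (\prod_(i <- r | P i) f i) (\prod_(i <- r | P i) g i).
Proof.
move=> h; elim/big_ind2 : _ => //; first exact: eqX_refl.
by move=> *; exact: eqX_mul.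
Qed.

Lemma eqX_le M N p q : (M <= N)%N -> eqX N p q -> eqX M p q.
Proof. by move=> MN; apply: dvdp_trans; exact: dvdp_exp2l. Qed.

Lemma dvdXn_coef N p : 'X^N %| p <-> forall i, (i < N)%N -> p`_i = 0.
Proof.
split=> [/dvdpP[q ->] i iN|h]; first by rewrite coefMXn iN.
rewrite -[p](poly_take_drop N) (_ : take_poly N p = 0) ?add0r ?dvdp_mull //.
by apply/polyP => i; rewrite coef_take_poly coef0; case: ltnP => // /h.
Qed.

Lemma eqXP N p q : eqX N p q <-> forall i, (i < N)%N -> p`_i = q`_i.
Proof.
rewrite /eqX dvdXn_coef; split=> h i iN; have := h i iN; rewrite coefB.
  by move/eqP; rewrite subr_eq0 => /eqP.
by move=> ->; rewrite subrr.
Qed.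

Lemma eqX_cancel N p q u : u`_0 != 0 -> eqX N (u * p) (u * q) -> eqX N p q.
Proof.
move=> u0; rewrite /eqX -mulrBr Gauss_dvdpr // coprimep_expl // coprimep_sym.
by rewrite coprimepX -horner_coef0 in u0 *.
Qed.

Lemma coef0M p q : (p * q)`_0 = p`_0 * q`_0.
Proof. by rewrite coefM big_ord1. Qed.

Lemma coef0_prod (I : Type) (r : seq I) (P : pred I) (f : I -> {poly F}) :
  (forall i, P i -> (f i)`_0 = 1) -> (\prod_(i <- r | P i) f i)`_0 = 1.
Proof.
move=> h; elim/big_rec : _ => [|i p Pi IH]; first by rewrite coef1.
by rewrite coef0M h // mul1r.
Qed.

(** Uniqueness of the square root: in p^2 - q^2 = (p - q)(p + q) the second factor has constant term
    2 and is coprime to X. *)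
Lemma eqX_sqr N p q : (2 : F) != 0 -> p`_0 = 1 -> q`_0 = 1 -> eqX N (p ^+ 2) (q ^+ 2) -> eqX N p q.
Proof.
move=> h2 p0 q0; rewrite /eqX subr_sqr mulrC Gauss_dvdpr // coprimep_expl // coprimep_sym.
rewrite coprimepX -[root _ _]/(_ == 0) horner_coef0 coefD p0 q0; exact: h2.
Qed.

End PowerSeriesCongruence.

(** * Gaussian binomials, towards a finite Jacobi triple product *)

Section GaussBinomial.
Context {F : fieldType}.
Implicit Types (q : {poly F}).

Fixpoint gaussbin q (M i : nat) {struct M} : {poly F} :=
  match M, i with
  | _, 0 => 1
  | 0, _.+1 => 0
  | M'.+1, i'.+1 => gaussbin q M' i' + q ^+ i'.+1 * gaussbin q M' i'.+1
  end.

(** The q-Pochhammer symbol (q; q)_m. *)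
Definition qfact q (m : nat) := \prod_(k < m) (1 - q ^+ k.+1).

Lemma gaussbin0 q M : gaussbin q M 0 = 1. Proof. by case: M. Qed.

Lemma gaussbinS q M i : gaussbin q M.+1 i.+1 = gaussbin q M i + q ^+ i.+1 * gaussbin q M i.+1.
Proof. by []. Qed.

Lemma gaussbin_small q M i : (M < i)%N -> gaussbin q M i = 0.
Proof.
elim: M i => [|M IH] [|i] //; rewrite ltnS => Mi.
by rewrite gaussbinS !IH ?mulr0 ?addr0 // ltnW.
Qed.

Lemma qfactS q m : qfact q m.+1 = qfact q m * (1 - q ^+ m.+1).
Proof. by rewrite /qfact big_ord_recr. Qed.

Lemma gaussbin_qfact q M i : (i <= M)%N ->
  gaussbin q M i * (qfact q i * qfact q (M - i)) = qfact q M.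
Proof.
elim: M i => [|M IH] [|i] // iM.
- by rewrite /qfact !big_ord0 !mulr1.
- by rewrite gaussbin0 /qfact big_ord0 !mul1r subn0.
rewrite subSS gaussbinS mulrDl.
have -> : gaussbin q M i * (qfact q i.+1 * qfact q (M - i)) = qfact q M * (1 - q ^+ i.+1).
  by rewrite -(IH i iM) qfactS; ring.
have -> : q ^+ i.+1 * gaussbin q M i.+1 * (qfact q i.+1 * qfact q (M - i)) =
    qfact q M * (q ^+ i.+1 * (1 - q ^+ (M - i))).
  have [Mi|Mi] := leqP M i.
    by rewrite gaussbin_small // (eqP (_ : M - i == 0)%N) // expr0; ring.
  rewrite -(IH i.+1 Mi) -(subnSK Mi) (qfactS _ (M - i.+1)); ring.
rewrite qfactS mulrBr mulrBr -exprD (_ : i.+1 + (M - i) = M.+1)%N; last by rewrite addSn subnKC.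
by ring.
Qed.

(** The q-binomial theorem in homogeneous form. The extra variable a allows a = X^(2n-1) later,
    which clears the negative exponents of the triple product. *)
Lemma gauss_binomial q (a b : {poly F}) M :
  \prod_(k < M) (a + b * q ^+ k) =
  \sum_(i < M.+1) q ^+ 'C(i, 2) * gaussbin q M i * a ^+ (M - i) * b ^+ i.
Proof.
elim: M b => [|M IH] b; first by rewrite big_ord0 big_ord1 /= !mulr1 expr0.
rewrite big_ord_recl expr0 mulr1.
under eq_bigr => k _ do rewrite lift0 exprS mulrA.
rewrite (IH (b * q)) [RHS]big_ord_recl.
set S1 := \sum_(i < M.+1) _; set S2 := \sum_(i < M.+1) _.
rewrite gaussbin0 subn0 expr0 !mul1r mulr1.
have -> : S2 = b * S1 +
   \sum_(i < M.+1) q ^+ 'C(i.+1, 2) * (q ^+ i.+1 * gaussbin q M i.+1) * a ^+ (M - i) * b ^+ i.+1.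
  rewrite /S1 mulr_sumr -big_split /=; apply: eq_bigr => i _; rewrite lift0 gaussbinS subSS.
  by rewrite !binS !bin1 !exprD exprMn !exprS; ring.
rewrite mulrDl [RHS]addrCA [LHS]addrC; congr (_ + _).
rewrite /S1 big_ord_recl [in RHS]big_ord_recr /= [X in _ + (_ + X)](_ : _ = 0).
  rewrite gaussbin0 subn0 !expr0 !mul1r mulr1 mulrDr -exprS addr0; congr (_ + _).
  rewrite mulr_sumr; apply: eq_bigr => i _; rewrite /bump /= add1n.
  rewrite exprMn -(subnSK (ltn_ord i)) [a ^+ (M - i.+1).+1]exprS; ring.
by rewrite gaussbin_small // !mulr0 !mul0r.
Qed.

End GaussBinomial.

Section ThetaPolynomial.
Context {F : fieldType}.

Definition theta_poly (N : nat) : {poly F} := 1 + 2 *: \sum_(1 <= n < N.+1) 'X^(n ^ 2).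

Definition theta_prod (n : nat) : {poly F} :=
  \prod_(k < n) ((1 - 'X^((2 * k.+1))) * (1 + 'X^((2 * k).+1)) ^+ 2).

Lemma qfact_coef0 m : (qfact ('X^2 : {poly F}) m)`_0 = 1.
Proof. by apply: coef0_prod => k _; rewrite -exprM coefB coef1 coefXn /= subr0. Qed.

Lemma eqX_qfact m n : (m <= n)%N ->
  eqX (2 * m.+1) (qfact ('X^2 : {poly F}) n) (qfact 'X^2 m).
Proof.
elim: n => [|n IH]; first by rewrite leqn0 => /eqP ->; exact: eqX_refl.
rewrite leq_eqVlt => /predU1P[-> |]; first exact: eqX_refl.
rewrite ltnS => mn; apply: eqX_trans (IH mn); rewrite qfactS -[X in eqX _ _ X]mulr1.
apply: eqX_mul; first exact: eqX_refl.
by rewrite /eqX addrAC subrr add0r dvdpNr -exprM dvdp_exp2l // leq_pmul2l.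
Qed.

(** Completion of the square in the exponents of the q-binomial theorem. One of the two truncated
    differences is 0, so the sum of their squares is |n - i|^2. *)
Lemma square_exponents n i : (i <= 2 * n)%N ->
  (2 * 'C(i, 2) + (2 * n).-1 * (2 * n - i) =
   n * n.-1 + (2 * n).-1 * n + ((n - i) ^ 2 + (i - n) ^ 2))%N.
Proof.
move=> i2n; rewrite -(mul_bin_diag i 1) bin1.
case: (leqP i n) => h.
  have [d ->] : exists d, n = (i + d)%N by exists (n - i)%N; rewrite subnKC.
  rewrite (_ : i + d - i = d)%N; last lia.
  rewrite (_ : i - (i + d) = 0)%N; last lia.
  rewrite (_ : 2 * (i + d) - i = i + 2 * d)%N; last lia.
  case: i {i2n h} => [|i]; last first.
    rewrite (_ : (2 * (i.+1 + d)).-1 = 2 * (i + d) + 1)%N; last lia.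
    rewrite (_ : (i.+1 + d).-1 = i + d)%N; last lia.
    by rewrite /= exp0n // !expnS expn0; lia.
  case: d => [|d] //.
  rewrite (_ : (2 * (0 + d.+1)).-1 = 2 * d + 1)%N; last lia.
  by rewrite /= exp0n // !expnS expn0; lia.
have [d [r [e1 e2]]] : exists d r, n = (d + r)%N /\ i = (d + r + d)%N.
  by exists (i - n)%N, (2 * n - i)%N; split; lia.
rewrite e1 e2 {i2n h e1 e2 n i}.
rewrite (_ : d + r + d - (d + r) = d)%N; last lia.
rewrite (_ : d + r - (d + r + d) = 0)%N; last lia.
rewrite (_ : 2 * (d + r) - (d + r + d) = r)%N; last lia.
case: r => [|r]; last first.
  rewrite (_ : (2 * (d + r.+1)).-1 = 2 * (d + r) + 1)%N; last lia.
  rewrite (_ : (d + r.+1 + d).-1 = 2 * d + r)%N; last lia.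
  rewrite (_ : (d + r.+1).-1 = d + r)%N; last lia.
  by rewrite exp0n // !expnS expn0; lia.
rewrite !addn0; case: d => [|d] //.
rewrite (_ : (2 * d.+1).-1 = 2 * d + 1)%N; last lia.
rewrite (_ : (d.+1 + d.+1).-1 = 2 * d + 1)%N; last lia.
by rewrite /= exp0n // !expnS expn0; lia.
Qed.

(** The finite triple product at z = 1. In the product of the X^(2n-1) + X^(2k) over k < 2n, pulling
    out X^(2k) for k < n and X^(2n-1) for k >= n leaves each factor 1 + X^(odd) twice. *)
Lemma theta_square_prod n :
  \prod_(k < n) (1 + 'X^((2 * k).+1) : {poly F}) ^+ 2 =
  \sum_(i < (2 * n).+1) 'X^((n - i) ^ 2 + (i - n) ^ 2) * gaussbin 'X^2 (2 * n) i.
Proof.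
have e0 : ('X^(n * n.-1 + (2 * n).-1 * n) : {poly F}) != 0 by rewrite monic_neq0 // monicXn.
apply: (mulfI e0); rewrite mulr_sumr.
have := gauss_binomial ('X^2 : {poly F}) 'X^((2 * n).-1) 1 (2 * n).
under eq_bigr => k _ do rewrite mul1r.
move=> h; transitivity (\prod_(k < 2 * n) ('X^((2 * n).-1) + 'X^2 ^+ k : {poly F})); last first.
  rewrite h; apply: eq_bigr => i _; rewrite expr1n mulr1 -!exprM.
  have i2 : (i <= 2 * n)%N by rewrite -ltnS.
  by rewrite mulrA -exprD -square_exponents // exprD mulrAC.
rewrite prodrXl expr2 {h} mul2n -addnn big_split_ord /= addnn -mul2n.
have -> : \prod_(i < n) ('X^((2 * n).-1) + 'X^2 ^+ (n + i) : {poly F}) =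
    'X^((2 * n).-1 * n) * \prod_(i < n) (1 + 'X^((2 * i).+1)).
  rewrite exprM -[n in _ ^+ n * _]card_ord -prodr_const -big_split /=; apply: eq_bigr => i _.
  rewrite mulrDr mulr1 -exprM -exprD; congr (_ + 'X^_).
  have := ltn_ord i; lia.
have -> : \prod_(i < n) ('X^((2 * n).-1) + 'X^2 ^+ i : {poly F}) =
    (\prod_(i < n) 'X^(2 * i)) * \prod_(i < n) (1 + 'X^((2 * i).+1)).
  rewrite [X in _ * X](reindex_inj rev_ord_inj) -big_split /=; apply: eq_bigr => i _.
  rewrite mulrDr mulr1 -exprM -exprD addrC; congr (_ + 'X^_).
  have := ltn_ord i; lia.
have -> : \prod_(i < n) 'X^(2 * i) = 'X^(n * n.-1) :> {poly F}.
  elim: (n) => [|k IH]; first by rewrite big_ord0 expr0.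
  by rewrite big_ord_recr /= IH -exprD; congr 'X^_; case: k {IH} => //= k; lia.
by rewrite exprD; ring.
Qed.

Lemma eqX_shift N j (p q : {poly F}) : eqX N p q -> eqX (N + j) ('X^j * p) ('X^j * q).
Proof. by move=> h; rewrite /eqX -mulrBr addnC exprD dvdp_mul2l // monic_neq0 // monicXn. Qed.

(** The Gaussian binomial is (q)_2n / ((q)_i (q)_(2n-i)) with q = X^2, and all (q)_m with m >= s
    agree modulo X^(2(s+1)); here s is the smaller of i and 2n - i. *)
Lemma eqX_gaussbin n i : (i <= 2 * n)%N ->
  eqX (2 * (minn i (2 * n - i)).+1) (qfact ('X^2 : {poly F}) n * gaussbin 'X^2 (2 * n) i) 1.
Proof.
move=> i2n; have e := gaussbin_qfact ('X^2 : {poly F}) i2n.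
set s := minn _ _; pose L := maxn i (2 * n - i).
have sn : (s <= n)%N by rewrite /s; lia.
have sL : (s <= L)%N by rewrite /s /L; lia.
have {}e : qfact 'X^2 L * (gaussbin 'X^2 (2 * n) i * qfact 'X^2 s) = qfact ('X^2 : {poly F}) (2 * n).
  rewrite -e /s /L; case: (leqP i (2 * n - i)) => h; ring.
have h1 : eqX (2 * s.+1) (gaussbin 'X^2 (2 * n) i * qfact 'X^2 s) (1 : {poly F}).
  apply: (@eqX_cancel _ _ _ _ (qfact 'X^2 L)); first by rewrite qfact_coef0 oner_neq0.
  rewrite e mulr1; apply: (@eqX_le _ _ (2 * L.+1)); first by rewrite leq_pmul2l.
  by apply: eqX_qfact; rewrite /L; lia.
apply: eqX_trans h1; rewrite mulrC; apply: eqX_mul; first exact: eqX_refl.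
exact: eqX_qfact.
Qed.

(** The precision lost for i far from N is regained from the factor X^(d^2), d = |N - i|: the right
    side equals 2N + 1 + (d - 1)^2. *)
Lemma square_gap N i : (i <= 2 * N)%N ->
  ((2 * N).+1 <= 2 * (minn i (2 * N - i)).+1 + ((N - i) ^ 2 + (i - N) ^ 2))%N.
Proof.
move=> i2; case: (leqP i N) => h.
  have [d ->] : exists d, N = (i + d)%N by exists (N - i)%N; rewrite subnKC.
  rewrite (_ : minn i _ = i)%N; last lia.
  rewrite (_ : i - (i + d) = 0)%N; last lia.
  rewrite (_ : i + d - i = d)%N; last lia.
  rewrite exp0n // !expnS expn0; case: d => [|[|d]]; lia.
have [d [r [e1 e2]]] : exists d r, N = (d + r)%N /\ i = (d + r + d)%N.
  by exists (i - N)%N, (2 * N - i)%N; split; lia.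
rewrite e1 e2 {i2 h e1 e2 N i}.
rewrite (_ : minn _ _ = r)%N; last lia.
rewrite (_ : d + r + d - (d + r) = d)%N; last lia.
rewrite (_ : d + r - (d + r + d) = 0)%N; last lia.
rewrite exp0n // !expnS expn0; case: d => [|[|d]]; lia.
Qed.

Lemma eqX_theta_prod N : eqX (2 * N).+1 (theta_prod N) (theta_poly N).
Proof.
have -> : theta_prod N = qfact 'X^2 N * \prod_(k < N) (1 + 'X^((2 * k).+1)) ^+ 2.
  by rewrite /theta_prod big_split /=; congr (_ * _); apply: eq_bigr => k _; rewrite -exprM.
rewrite theta_square_prod mulr_sumr.
have -> : theta_poly N = \sum_(i < (2 * N).+1) 'X^((N - i) ^ 2 + (i - N) ^ 2) :> {poly F}.
  rewrite mul2n -addnn -addnS big_split_ord /= big_ord_recl /= addn0 subnn addn0 expr0.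
  have e1 : \sum_(1 <= n < N.+1) 'X^(n ^ 2) = \sum_(i < N) 'X^(i.+1 ^ 2) :> {poly F}.
    by rewrite big_add1 /= big_mkord.
  have -> : \sum_(i < N) 'X^((N - i) ^ 2 + (i - N) ^ 2) = \sum_(i < N) 'X^(i.+1 ^ 2) :> {poly F}.
    rewrite (reindex_inj rev_ord_inj) /=; apply: eq_bigr => i _; congr 'X^_.
    by have := ltn_ord i => iN; rewrite subKn // (eqP (_ : N - i.+1 - N == 0)%N) ?addn0 //; lia.
  have -> : \sum_(i < N) 'X^((N - (N + bump 0 i)) ^ 2 + (N + bump 0 i - N) ^ 2) = \sum_(i < N) 'X^(i.+1 ^ 2) :> {poly F}.
    by apply: eq_bigr => i _; rewrite addKn subnDA subnn.
  by rewrite /theta_poly e1 scaler_nat mulr2n addrCA.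
apply: eqX_sum => i _; rewrite mulrCA -[X in eqX _ _ X]mulr1.
set j := ((N - i) ^ 2 + (i - N) ^ 2)%N; have i2 : (i <= 2 * N)%N by rewrite -ltnS.
by apply: eqX_le (eqX_shift j (eqX_gaussbin i2)); exact: square_gap.
Qed.

End ThetaPolynomial.

Section GeneralizedBinomial.
Context {R : realType}.
Implicit Types a : R.

Lemma gbinom0 a : gbinom a 0 = 1.
Proof. by rewrite /gbinom big_ord0. Qed.

Lemma gbinomS a k : k.+1%:R * gbinom a k.+1 = (a - k%:R) * gbinom a k.
Proof.
rewrite /gbinom big_ord_recr /=; set P := \prod_(i < k) _.
by field; rewrite addrC natr1 pnatr_eq0.
Qed.

(** Vandermonde's identity for equal exponents. By the symmetry between i and n - i the sum W n of i
    g_i g_(n-i) is n/2 times the convolution, which turns the recurrence [gbinomS] for a into the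
    one for 2a. *)
Lemma gbinom_conv a k : conv (gbinom a) (gbinom a) k = gbinom (2 * a) k.
Proof.
elim: k => [|k IH]; first by rewrite /conv big_ord1 !gbinom0 mulr1.
have k0 : (k.+1%:R : R) != 0 by rewrite pnatr_eq0.
apply: (mulfI k0); rewrite gbinomS -IH.
pose g := gbinom a; pose W n := \sum_(i < n.+1) i%:R * g i * g (n - i)%N.
have sym n : \sum_(i < n.+1) (n - i)%:R * g i * g (n - i)%N = W n.
  rewrite (reindex_inj rev_ord_inj) /=; apply: eq_bigr => i _.
  have ik : (i <= n)%N by rewrite -ltnS.
  by rewrite subSS subKn // mulrAC.
have e1 : k.+1%:R * conv g g k.+1 = 2 * W k.+1.
  rewrite [2 * _]mulr_natl mulr2n -{2}sym -big_split /= /conv mulr_sumr; apply: eq_bigr => i _.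
  by rewrite -!mulrA -mulrDl -natrD subnKC // -ltnS.
have e2 : W k.+1 = a * conv g g k - W k.
  rewrite /W big_ord_recl !mul0r add0r /conv mulr_sumr -sumrB; apply: eq_bigr => i _.
  rewrite lift0 subSS gbinomS -/g; move: (g i) (g (k - i)%N) => u v; ring.
have e3 : 2 * W k = k%:R * conv g g k.
  rewrite [2 * _]mulr_natl mulr2n -{2}sym -big_split /= /conv mulr_sumr; apply: eq_bigr => i _.
  by rewrite -!mulrA -mulrDl -natrD subnKC // -ltnS.
by rewrite -/g e1 e2 mulrBr e3; ring.
Qed.

Lemma gbinom1 k : gbinom (1 : R) k = ((k == 0%N) || (k == 1%N))%:R.
Proof.
case: k => [|[|k]]; first by rewrite gbinom0.
  by rewrite /gbinom big_ord1 subr0 divr1.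
by rewrite /gbinom 2!big_ord_recl /= subrr !mul0r mulr0.
Qed.

Lemma gbinomN1 k : gbinom (-1 : R) k = (-1) ^+ k.
Proof.
rewrite /gbinom (eq_bigr (fun=> -1)) ?prodr_const ?card_ord // => i _.
have h : (i.+1%:R : R) != 0 by rewrite pnatr_eq0.
by apply: (mulIf h); rewrite divfK // mulN1r -natr1 opprD addrC.
Qed.

(** The coefficients of (1 - X)^(-1/2). That they lie in [0, 1] is what makes the norm estimates
    easy. *)
Definition inv_sqrt_coef (k : nat) : R := (-1) ^+ k * gbinom (- 2^-1) k.

Lemma inv_sqrt_coef_prod k : inv_sqrt_coef k = \prod_(i < k) ((2^-1 + i%:R) / i.+1%:R).
Proof.
rewrite /inv_sqrt_coef /gbinom -[X in _ ^+ X]card_ord -prodr_const -big_split /=.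
by apply: eq_bigr => i _; rewrite mulrA mulN1r opprB opprK addrC.
Qed.

Lemma inv_sqrt_coef_itv k : 0 <= inv_sqrt_coef k <= 1.
Proof.
rewrite inv_sqrt_coef_prod; apply/andP; split.
  by apply: prodr_ge0 => i _; rewrite divr_ge0 // addr_ge0 // invr_ge0.
apply: prodr_ile1 => i _; rewrite divr_ge0 ?addr_ge0 ?invr_ge0 //=.
rewrite ler_pdivrMr ?ltr0n // mul1r -[i.+1%:R]natr1; lra.
Qed.

Lemma inv_sqrt_coef_conv k : conv inv_sqrt_coef inv_sqrt_coef k = 1.
Proof.
transitivity ((-1) ^+ k * conv (gbinom (- 2^-1 : R)) (gbinom (- 2^-1)) k).
  rewrite /conv mulr_sumr; apply: eq_bigr => i _; rewrite /inv_sqrt_coef.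
  have ik : (i <= k)%N by rewrite -ltnS.
  by rewrite mulrACA -exprD subnKC.
rewrite gbinom_conv (_ : 2 * - 2^-1 = -1); last by field.
by rewrite gbinomN1 -exprMn mulrNN mulr1 expr1n.
Qed.

Lemma poly_conv (f : nat -> R) N i : (i < N)%N ->
  ((\poly_(k < N) f k) ^+ 2)`_i = conv f f i.
Proof.
move=> iN; rewrite expr2 coefM /conv; apply: eq_bigr => j _; rewrite !coef_poly.
have -> : (j < N)%N by apply: leq_ltn_trans iN; rewrite -ltnS.
by rewrite (leq_ltn_trans (leq_subr _ _) iN).
Qed.

Lemma eqX_comp N (p q r : {poly R}) : r`_0 = 0 -> eqX N p q -> eqX N (p \Po r) (q \Po r).
Proof.
move=> r0 /dvdpP[s e]; rewrite /eqX -rmorphB /= e rmorphM rmorphXn /= comp_polyX.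
apply: dvdp_mull; apply: dvdp_exp2r.
by apply/(@dvdXn_coef R 1) => -[|i].
Qed.

(** [c_half m] is read off a truncation that depends on m. The truncations [Q L] with L >= m agree
    modulo X^(m+1), so the single [Q N] carries all coefficients up to N; its square is 1 + P
    because the convolution of the coefficients for exponent 1/2 is that for exponent 1. *)
Lemma c_half_sqr N :
  eqX N.+1 ((\poly_(m < N.+1) @c_half R m) ^+ 2) (theta_poly N).
Proof.
pose P M : {poly R} := 2 *: \sum_(1 <= n < M.+1) 'X^(n ^ 2).
have P0 M : (P M)`_0 = 0.
  rewrite coefZ coef_sum big_nat big1 ?mulr0 // => n /andP[n0 _].
  by rewrite coefXn eq_sym expn_eq0 /= eqn0Ngt n0.
have PX M : 'X %| P M by apply/(@dvdXn_coef R 1) => -[|i].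
pose G M : {poly R} := \poly_(k < M.+1) gbinom 2^-1 k.
have GE M L : (G M) \Po (P L) = \sum_(k < M.+1) gbinom 2^-1 k *: P L ^+ k.
  rewrite /G poly_def rmorph_sum /=; apply: eq_bigr => k _.
  by rewrite comp_polyZ rmorphXn /= comp_polyX.
pose Q M := G M \Po P M.
have cE m : @c_half R m = (Q m)`_m by rewrite /Q GE.
have PP M L : (M <= L)%N -> eqX M.+1 (P L) (P M).
  move=> ML; rewrite /eqX /P -scalerBr (big_cat_nat (ltn0Sn M) (ML : (M.+1 <= L.+1)%N)) /=.
  rewrite addrAC subrr add0r -mul_polyC; apply: dvdp_mull; rewrite big_nat.
  elim/big_ind : _ => [|p q|n /andP[Mn _]]; first exact: dvdp0.
    exact: dvdp_add.
  by apply: dvdp_exp2l; rewrite (leq_trans Mn) // -{1}(expn1 n) leq_pexp2l // (leq_ltn_trans _ Mn).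
have QQ M L : (M <= L)%N -> eqX M.+1 (Q L) (Q M).
  move=> ML; apply: (@eqX_trans _ _ _ (G M \Po P L)).
    apply: eqX_comp => //; apply/eqXP => i iM; rewrite !coef_poly iM.
    by rewrite (leq_trans iM).
  rewrite /Q !GE; apply: eqX_sum => k _; rewrite /eqX -scalerBr -mul_polyC; apply: dvdp_mull.
  exact: eqX_exp (PP M L ML).
have h1 : eqX N.+1 (\poly_(m < N.+1) @c_half R m) (Q N).
  apply/eqXP => i iN; rewrite coef_poly iN cE; apply/esym.
  by move/eqXP: (QQ i N iN); apply.
apply: eqX_trans (eqX_exp 2 h1) _.
have -> : theta_poly N = (1 + 'X) \Po P N :> {poly R}.
  by rewrite comp_polyD comp_polyX comp_polyC.
rewrite /Q -rmorphXn; apply: eqX_comp => //; apply/eqXP => i iN.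
rewrite poly_conv // gbinom_conv mulfV ?pnatr_eq0 // gbinom1 coefD coef1 coefX.
by case: i {iN} => [|[|i]]; rewrite /= ?addr0 ?add0r.
Qed.

(* A square root of the product of the (1 - X^(2n)) (1 + X^(2n-1))^2: the factor
   1 - X^(2n) has the square root (1 - X^(2n)) (1 - X^(2n))^(-1/2). *)
Definition sqrt_theta_prod N : {poly R} :=
  \prod_(k < N) ((1 + 'X^((2 * k).+1)) * (1 - 'X^(2 * k.+1)) *
     \sum_(j < N.+1) inv_sqrt_coef j *: 'X^(2 * k.+1 * j)).

Lemma sqrt_theta_prod_sqr N : eqX N.+1 (sqrt_theta_prod N ^+ 2) (theta_poly N).
Proof.
apply: (@eqX_trans _ _ _ (theta_prod N)); last first.
  by apply: eqX_le (eqX_theta_prod N); rewrite ltnS leq_pmull.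
rewrite /sqrt_theta_prod -prodrXl; apply: eqX_prod => k _.
pose H : {poly R} := \poly_(j < N.+1) inv_sqrt_coef j.
have hH : eqX N.+1 (H ^+ 2 * (1 - 'X)) 1.
  apply/eqXP => i iN; rewrite mulrBr mulr1 coefB coefMX coef1 poly_conv // inv_sqrt_coef_conv.
  case: i iN => [|i] iN; first by rewrite subr0.
  by rewrite /= poly_conv ?inv_sqrt_coef_conv ?subrr // ltnW.
have r0 : ('X^(2 * k.+1) : {poly R})`_0 = 0 by rewrite coefXn.
have := eqX_comp r0 hH.
rewrite rmorphM rmorphXn rmorphB /= comp_polyX !comp_polyC.
have -> : H \Po 'X^(2 * k.+1) = \sum_(j < N.+1) inv_sqrt_coef j *: 'X^(2 * k.+1 * j).
  rewrite /H poly_def rmorph_sum /=; apply: eq_bigr => j _.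
  by rewrite comp_polyZ rmorphXn /= comp_polyX -exprM.
set B := \sum_(j < N.+1) _ => hB.
rewrite [X in eqX _ X _](_ : _ = (1 - 'X^(2 * k.+1)) * (1 + 'X^((2 * k).+1)) ^+ 2 * (B ^+ 2 * (1 - 'X^(2 * k.+1)))); last by ring.
rewrite -[X in eqX _ _ X]mulr1; apply: eqX_mul => //; exact: eqX_refl.
Qed.

Lemma sqrt_theta_prod_coef0 N : (sqrt_theta_prod N)`_0 = 1.
Proof.
apply: coef0_prod => k _; rewrite !coef0M coefD coefB !coef1 !coefXn /= addr0 subr0 !mul1r.
rewrite coef_sum big_ord_recl coefZ muln0 expr0 coef1 big1 ?addr0.
  by rewrite mulr1 inv_sqrt_coef_prod big_ord0.
by move=> j _; rewrite coefZ coefXn eq_sym muln_eq0 /= mulr0.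
Qed.

Lemma c_half0 : @c_half R 0 = 1.
Proof. by rewrite /c_half big_ord1 expr0 gbinom0 scale1r coef1. Qed.

Lemma eqX_c_half N : eqX N.+1 (\poly_(m < N.+1) @c_half R m) (sqrt_theta_prod N).
Proof.
apply: eqX_sqr; first by rewrite pnatr_eq0.
- by rewrite coef_poly /= c_half0.
- exact: sqrt_theta_prod_coef0.
- exact: eqX_trans (c_half_sqr N) (eqX_sym (sqrt_theta_prod_sqr N)).
Qed.

End GeneralizedBinomial.

Section PolyNorm.
Context {R : realType}.
Implicit Types p q : {poly R}.

Definition pabs p : {poly R} := \poly_(i < size p) `|p`_i|.

Lemma coef_pabs p i : (pabs p)`_i = `|p`_i|.
Proof. by rewrite coef_poly; case: ltnP => // h; rewrite nth_default // normr0. Qed.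

(** The weighted l^1 norm of the coefficients. It is submultiplicative, so a product formula yields
    bounds on absolute coefficient sums. *)
Definition pnorm p (x : R) := (pabs p).[x].

Lemma horner_le p q x : 0 <= x -> (forall i, p`_i <= q`_i) -> p.[x] <= q.[x].
Proof.
move=> x0 h; rewrite (@horner_coef_wide _ (maxn (size p) (size q))) ?leq_maxl //.
rewrite (@horner_coef_wide _ (maxn (size p) (size q)) q) ?leq_maxr //.
by apply: ler_sum => i _; rewrite ler_wpM2r // exprn_ge0.
Qed.

Lemma pnorm_sumE p N x : (size p <= N)%N -> pnorm p x = \sum_(i < N) `|p`_i| * x ^+ i.
Proof.
move=> h; rewrite /pnorm (@horner_coef_wide _ N); last exact: leq_trans (size_poly _ _) h.
by apply: eq_bigr => i _; rewrite coef_pabs.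
Qed.

Lemma pnormD p q x : 0 <= x -> pnorm (p + q) x <= pnorm p x + pnorm q x.
Proof.
move=> x0; rewrite /pnorm -hornerD; apply: horner_le => // i.
by rewrite coefD !coef_pabs coefD ler_normD.
Qed.

Lemma pnormM p q x : 0 <= x -> pnorm (p * q) x <= pnorm p x * pnorm q x.
Proof.
move=> x0; rewrite /pnorm -hornerM; apply: horner_le => // i.
rewrite coef_pabs !coefM; apply: le_trans (ler_norm_sum _ _ _) _.
by apply: ler_sum => j _; rewrite !coef_pabs normrM.
Qed.

Lemma pnorm_ge0 p x : 0 <= x -> 0 <= pnorm p x.
Proof.
by move=> x0; rewrite (pnorm_sumE _ (leqnn _)); apply: sumr_ge0 => i _; rewrite mulr_ge0 ?exprn_ge0.
Qed.

Lemma pnorm_monomial c n x : pnorm (c *: 'X^n) x = `|c| * x ^+ n.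
Proof.
rewrite (@pnorm_sumE _ n.+1); last by rewrite (leq_trans (size_scale_leq _ _)) // size_polyXn.
rewrite big_ord_recr big1 /= ?add0r; last first.
  by move=> i _; rewrite coefZ coefXn ltn_eqF // mulr0 normr0 mul0r.
by rewrite coefZ coefXn eqxx mulr1.
Qed.

Lemma pnorm1 x : pnorm 1 x = 1.
Proof.
have -> : (1 : {poly R}) = 1 *: 'X^0 by rewrite scale1r expr0.
by rewrite pnorm_monomial normr1 mul1r expr0.
Qed.

Lemma pnormN p x : pnorm (- p) x = pnorm p x.
Proof.
by rewrite !(@pnorm_sumE _ (size p)) ?size_polyN //; apply: eq_bigr => i _; rewrite coefN normrN.
Qed.

Lemma pnorm_sum (I : Type) (r : seq I) (P : pred I) (f : I -> {poly R}) x : 0 <= x ->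
  pnorm (\sum_(i <- r | P i) f i) x <= \sum_(i <- r | P i) pnorm (f i) x.
Proof.
move=> x0; elim/big_ind2 : _ => [|p a q b h1 h2|//].
  by rewrite (@pnorm_sumE _ 0) ?size_poly0 // big_ord0.
exact: le_trans (pnormD _ _ x0) (lerD h1 h2).
Qed.

Lemma pnorm_prod (I : Type) (r : seq I) (P : pred I) (f : I -> {poly R}) (g : I -> R) x : 0 <= x ->
  (forall i, P i -> pnorm (f i) x <= g i) ->
  pnorm (\prod_(i <- r | P i) f i) x <= \prod_(i <- r | P i) g i.
Proof.
move=> x0 h; suff : 0 <= pnorm (\prod_(i <- r | P i) f i) x <= \prod_(i <- r | P i) g i by case/andP.
elim/big_ind2 : _ => [|p a q b /andP[a0 ha] /andP[b0 hb]|i Pi].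
- by rewrite pnorm1 ler01 lexx.
- rewrite pnorm_ge0 //=; apply: le_trans (pnormM _ _ x0) _.
  by apply: ler_pM => //; exact: pnorm_ge0.
- by rewrite pnorm_ge0 //= h.
Qed.

(** This turns congruences modulo X^M into numerical estimates: inside a larger radius z,
    divisibility by X^M gains the factor (y/z)^M. *)
Lemma horner_small p M (y z : R) : 0 <= y <= z -> 0 < z -> 'X^M %| p ->
  `|p.[y]| <= (y / z) ^+ M * pnorm p z.
Proof.
move=> /andP[y0 yz] z0 /dvdXn_coef h.
rewrite (pnorm_sumE _ (leqnn _)) horner_coef mulr_sumr.
apply: le_trans (ler_norm_sum _ _ _) _; apply: ler_sum => i _.
have [iM|Mi] := ltnP i M; first by rewrite h // mul0r normr0 mul0r mulr0.
rewrite normrM normrX (ger0_norm y0) mulrCA ler_wpM2l //.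
have -> : y ^+ i = (y / z) ^+ i * z ^+ i by rewrite -exprMn divfK // gt_eqF.
rewrite ler_wpM2r ?exprn_ge0 ?(ltW z0) // ler_wiXn2l ?divr_ge0 ?(ltW z0) //.
by rewrite ler_pdivrMr // mul1r.
Qed.

End PolyNorm.

(** * Growth of the absolute coefficient sums near the unit circle *)

Section CoefficientBounds.
Context {R : realType}.
Local Notation c := (@c_half R).

Lemma sum_expRN_le (h : R) N : 0 < h -> \sum_(s < N) expR (- h) ^+ s.+1 <= h^-1.
Proof.
move=> h0; set x := expR (- h).
have x0 : 0 < x by exact: expR_gt0.
have hx : h * x <= 1 - x.
  have := expR_ge1Dx h; rewrite -[expR h]invrK -expRN -/x => H.
  have : (1 + h) * x <= x^-1 * x by rewrite ler_pM2r.
  rewrite mulVf ?gt_eqF // mulrDl; lra.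
suff : \sum_(s < N) x ^+ s.+1 <= h^-1 * (1 - x ^+ N).
  by move/le_trans; apply; rewrite ler_piMr ?invr_ge0 ?(ltW h0) // gerBl exprn_ge0 // ltW.
elim: N => [|N IH]; first by rewrite big_ord0 expr0 subrr mulr0.
rewrite big_ord_recr /=; apply: le_trans (lerD IH (lexx _)) _.
have : x ^+ N.+1 <= h^-1 * (x ^+ N - x ^+ N.+1).
  rewrite ler_pdivlMl // exprS -mulrCA.
  have : 0 <= x ^+ N by rewrite exprn_ge0 // ltW.
  nra.
lra.
Qed.

(** Partial product of Euler's generating function of partitions. *)
Definition euler_prod (N : nat) (x : R) := \prod_(s < N) (1 - x ^+ s.+1)^-1.

(** Factor by factor, 1/(1 - y) = (1 + y)/(1 - y^2) <= e^y/(1 - y^2); the exponents y = x^(s+1) add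
    up to at most 1/h. *)
Lemma euler_prod_double N (h : R) : 0 < h ->
  euler_prod N (expR (- h)) <= expR h^-1 * euler_prod N (expR (- (2 * h))).
Proof.
move=> h0; set x := expR (- h).
have x0 : 0 < x by exact: expR_gt0.
have x1 : x < 1 by rewrite expR_lt1 oppr_lt0.
have -> : expR (- (2 * h)) = x ^+ 2 by rewrite -mulrN expRM_natl.
apply: (@le_trans _ _ ((\prod_(s < N) expR (x ^+ s.+1)) * euler_prod N (x ^+ 2))); last first.
  rewrite ler_wpM2r //.
    by apply: prodr_ge0 => s _; rewrite invr_ge0 subr_ge0 exprn_ile1 ?exprn_ge0 ?exprn_ile1 ?(ltW x0) ?(ltW x1).
  by rewrite -expR_sum ler_expR sum_expRN_le.
rewrite /euler_prod -big_split /=; apply: ler_prod => s _.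
have y0 : 0 < x ^+ s.+1 by rewrite exprn_gt0.
have y1 : x ^+ s.+1 < 1 by rewrite exprn_ilt1 // ltW.
rewrite -exprM mulnC exprM; set y := x ^+ s.+1 in y0 y1 *.
have y2 : y ^+ 2 < 1 by rewrite exprn_ilt1 // ltW.
rewrite invr_ge0 subr_ge0 (ltW y1) /= ler_pdivlMr ?subr_gt0 //.
have -> : (1 - y)^-1 * (1 - y ^+ 2) = 1 + y by field; rewrite subr_eq0 gt_eqF.
exact: expR_ge1Dx.
Qed.

(** Doubling h repeatedly collects 1/h + 1/(2h) + ... <= 2/h. The product left at 2^J h is at most
    e^(N/(2^J h)), which tends to 1 for fixed N, so the bound does not depend on N. *)
Lemma euler_prod_le N (h : R) : 0 < h -> euler_prod N (expR (- h)) <= expR (2 / h).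
Proof.
move=> h0.
have ep_gt0 k : 0 < k -> 0 < euler_prod N (expR (- k)).
  by move=> k0; apply: prodr_gt0 => s _; rewrite invr_gt0 subr_gt0 exprn_ilt1 ?expR_ge0 // expR_lt1 oppr_lt0.
have base k : 0 < k -> euler_prod N (expR (- k)) <= expR (N%:R / k).
  move=> k0; rewrite /euler_prod mulr_natl -[X in _ *+ X]card_ord -sumr_const expR_sum.
  apply: ler_prod => s _; set x := expR (- k).
  have x0 : 0 < x by exact: expR_gt0.
  have x1 : x < 1 by rewrite expR_lt1 oppr_lt0.
  have y1 : x ^+ s.+1 <= x by rewrite exprS ler_piMr ?(ltW x0) // exprn_ile1 ?(ltW x0) ?(ltW x1).
  have xk : 1 - x >= k * x.
    have := expR_ge1Dx k; rewrite -[expR k]invrK -expRN -/x => H.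
    have : (1 + k) * x <= x^-1 * x by rewrite ler_pM2r.
    rewrite mulVf ?gt_eqF // mulrDl; lra.
  rewrite invr_ge0 subr_ge0 (le_trans y1 (ltW x1)) /=.
  apply: (@le_trans _ _ (1 - x)^-1).
    by rewrite lef_pV2 ?posrE ?subr_gt0 // ?lerB // (le_lt_trans y1).
  apply: le_trans (expR_ge1Dx _); rewrite -div1r ler_pdivrMr ?subr_gt0 //.
  have : x <= k^-1 * (1 - x) by rewrite ler_pdivlMl.
  by rewrite mulrDl mul1r; lra.
have iter J : euler_prod N (expR (- h)) <= expR ((2 - 2 * 2^-1 ^+ J) / h) * euler_prod N (expR (- (2 ^+ J * h))).
  elim: J => [|J IH]; first by rewrite !expr0 mulr1 subrr mul0r expR0 !mul1r.
  apply: le_trans IH _.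
  have hJ : 0 < 2 ^+ J * h by rewrite mulr_gt0 // exprn_gt0.
  apply: le_trans (ler_wpM2l (expR_ge0 _) (euler_prod_double N hJ)) _.
  rewrite [expR _ * (_ * _)]mulrA -expRD [2 * (_ * _)]mulrA -exprS le_eqVlt; apply/orP; left; apply/eqP.
  congr (expR _ * _); rewrite exprS exprVn; set P := 2 ^+ J.
  by field; rewrite (gt_eqF h0) gt_eqF // exprn_gt0.
rewrite -[leLHS]lnK ?posrE ?ep_gt0 // ler_expR; apply/ler_addgt0Pr => e e0.
have [J hJ] : exists J, N%:R / (2 ^+ J * h) <= e.
  exists (Num.truncn (N%:R / (h * e))).+1; set J := (Num.truncn _).+1.
  have hj : N%:R / (h * e) < J%:R := truncnS_gt _.
  have h2 : (J%:R : R) <= 2 ^+ J by rewrite -natrX ler_nat ltnW // ltn_expl.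
  rewrite ler_pdivrMr ?mulr_gt0 ?exprn_gt0 //.
  move: hj; rewrite ltr_pdivrMr ?mulr_gt0 // => hj.
  have : J%:R * (h * e) <= 2 ^+ J * (h * e) by rewrite ler_wpM2r // mulr_ge0 // ltW.
  move: hj; set A := 2 ^+ J; set B := J%:R; nra.
rewrite -ler_expR lnK ?posrE ?ep_gt0 //; apply: le_trans (iter J) _.
have hJ0 : 0 < 2 ^+ J * h by rewrite mulr_gt0 // exprn_gt0.
apply: le_trans (ler_wpM2l (expR_ge0 _) (base _ hJ0)) _.
rewrite -expRD ler_expR lerD // ler_wpM2r ?invr_ge0 ?(ltW h0) //.
by rewrite gerBl mulr_ge0 // exprn_ge0.
Qed.

(** The factors 1 + X^(2k+1) and 1 - X^(2k+2) have norms at most e^(x^(2k+1)) and e^(x^(2k+2)),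
    together e^(1/h). The inverse square roots contribute at most the Euler product at x^2 =
    e^(-2h), which is again at most e^(1/h). *)
Lemma pnorm_sqrt_theta_prod N (h : R) : 0 < h ->
  pnorm (sqrt_theta_prod N) (expR (- h)) <= expR (2 / h).
Proof.
move=> h0; set x := expR (- h).
have x0 : 0 < x by exact: expR_gt0.
have x1 : x < 1 by rewrite expR_lt1 oppr_lt0.
have x0' := ltW x0; have x1' := ltW x1.
pose g (k : 'I_N) : R := expR (x ^+ (2 * k).+1 + x ^+ (2 * k.+1)) * (1 - (x ^+ 2) ^+ k.+1)^-1.
apply: (@le_trans _ _ (\prod_(k < N) g k)).
  apply: pnorm_prod => // k _; rewrite /g expRD.
  apply: le_trans (pnormM _ _ x0') _; apply: ler_pM; rewrite ?pnorm_ge0 //.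
    apply: le_trans (pnormM _ _ x0') _; apply: ler_pM; rewrite ?pnorm_ge0 //.
      apply: le_trans (pnormD _ _ x0') _; rewrite pnorm1 -['X^_]scale1r pnorm_monomial normr1 mul1r.
      exact: expR_ge1Dx.
    apply: le_trans (pnormD _ _ x0') _; rewrite pnormN pnorm1 -['X^_]scale1r pnorm_monomial normr1 mul1r.
    exact: expR_ge1Dx.
  apply: le_trans (pnorm_sum _ _ _ x0') _.
  rewrite -exprM; set y := x ^+ (2 * k.+1).
  have y01 : 0 <= y < 1 by rewrite exprn_ge0 // exprn_ilt1.
  apply: (@le_trans _ _ (\sum_(j < N.+1) 1 * y ^+ j)).
    apply: ler_sum => j _; rewrite pnorm_monomial exprM -/y.
    have /andP[b0 b1] := @inv_sqrt_coef_itv R j.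
    by rewrite ger0_norm // ler_wpM2r // exprn_ge0 //; case/andP: y01.
  rewrite -(big_mkord xpredT (fun j => 1 * y ^+ j)).
  by apply: le_trans (sum_geo_le _ _ ler01 y01) _; rewrite expr0 !mul1r.
rewrite /g big_split /= -expR_sum.
have -> : \sum_(k < N) (x ^+ (2 * k).+1 + x ^+ (2 * k.+1)) = \sum_(s < (2 * N)) x ^+ s.+1.
  elim: (N) => [|n IH]; first by rewrite muln0 !big_ord0.
  by rewrite big_ord_recr IH mulnS add2n !big_ord_recr /= addrA.
have -> : 2 / h = h^-1 + 2 / (2 * h) by field; rewrite gt_eqF.
rewrite expRD; apply: ler_pM; rewrite ?expR_ge0 //.
- by apply: prodr_ge0 => s _; rewrite invr_ge0 subr_ge0 exprn_ile1 ?exprn_ge0 ?exprn_ile1.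
- by rewrite ler_expR sum_expRN_le.
- have -> : x ^+ 2 = expR (- (2 * h)) by rewrite -mulrN expRM_natl.
  by apply: euler_prod_le; rewrite mulr_gt0.
Qed.

Lemma c_half_abs_sum N (h : R) : 0 < h ->
  \sum_(m < N) `|c m| * expR (- h) ^+ m <= expR (2 / h).
Proof.
move=> h0; case: N => [|N]; first by rewrite big_ord0 expR_ge0.
apply: le_trans (pnorm_sqrt_theta_prod N h0).
set S := sqrt_theta_prod N.
have e m : (m < N.+1)%N -> c m = S`_m.
  by move=> mN; have /eqXP/(_ m mN) := @eqX_c_half R N; rewrite coef_poly mN.
rewrite (@pnorm_sumE _ _ (N.+1 + size S)); last exact: leq_addl.
rewrite big_split_ord /= -[leLHS]addr0; apply: lerD.
  by apply: ler_sum => i _; rewrite e.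
by apply: sumr_ge0 => i _; rewrite mulr_ge0 // exprn_ge0 // expR_ge0.
Qed.

Lemma sqrt_theta_prod_ge0 N (y : R) : 0 <= y <= 1 -> 0 <= (sqrt_theta_prod N).[y].
Proof.
move=> /andP[y0 y1]; rewrite horner_prod; apply: prodr_ge0 => k _.
rewrite !hornerM !hornerD hornerN !hornerXn !hornerC; apply: mulr_ge0; first apply: mulr_ge0.
- by rewrite addr_ge0 // exprn_ge0.
- by rewrite subr_ge0 exprn_ile1.
rewrite horner_sum; apply: sumr_ge0 => j _; rewrite hornerZ hornerXn mulr_ge0 ?exprn_ge0 //.
by case/andP: (@inv_sqrt_coef_itv R j).
Qed.

Lemma cvg_theta_poly (x : R) : 0 < x ->
  (@theta_poly R N).[expR (- (pi * x))] @[N --> \oo] --> theta x.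
Proof.
move=> x0; have -> : theta x = 1 + 2 * ((theta x - 1) / 2) by field.
rewrite (_ : (fun _ => _) = fun N => 1 + 2 * series (theta_term x) N).
  by apply: cvgD; [exact: cvg_cst|apply: cvgMl_tmp; exact: cvg_theta_series].
apply/funext => N; rewrite /theta_poly hornerD hornerC hornerZ horner_sum big_add1 /=.
rewrite /series /=; congr (_ + _ * _); apply: eq_bigr => n _.
by rewrite hornerXn -expRM_natl natrX /theta_term; congr expR; ring.
Qed.

Lemma c_half_series (x : R) : 0 < x ->
  \sum_(m < N) c m * expR (- (pi * x)) ^+ m @[N --> \oo] --> Num.sqrt (theta x).
Proof.
(* z is the square root of the nome y, so y/z = z: a polynomial divisible by X^(N+1) has value at
   most z^(N+1) times its norm at z, and the norms at z are bounded uniformly in N. *)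
move=> x0; set y := expR (- (pi * x)); pose h := pi * x / 2; pose z := expR (- h).
have h0 : 0 < h by rewrite divr_gt0 // mulr_gt0 // pi_gt0.
have z0 : 0 < z by exact: expR_gt0.
have yz : y = z * z by rewrite -expRD /y /h; congr expR; field.
have z1 : z < 1 by rewrite expR_lt1 oppr_lt0.
have y0 : 0 <= y by exact: expR_ge0.
have yz' : 0 <= y <= z by rewrite y0 yz ler_piMr // ltW.
have yzz : y / z = z by rewrite yz mulfK // gt_eqF.
have y1 : 0 <= y <= 1 by rewrite y0 yz; nra.
pose M := expR (2 / h); pose D N := sqrt_theta_prod N : {poly R}.
have M0 : 0 < M by exact: expR_gt0.
have zX (K : R) : K * z ^+ N.+1 @[N --> \oo] --> (0 : R).
  rewrite -(mulr0 K); apply: cvgMl_tmp; have := @cvg_expr R z; rewrite ger0_norm ?(ltW z0) // => /(_ z1).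
  by rewrite -(cvg_shiftS (fun n => z ^+ n)).
have squeeze (f : nat -> R) (K : R) : (forall N, `|f N| <= K * z ^+ N.+1) -> f N @[N --> \oo] --> (0 : R).
  move=> hf; apply: (@squeeze_cvgr _ _ _ _ (fun N => - (K * z ^+ N.+1)) (fun N => K * z ^+ N.+1)).
  - by near=> N; rewrite -ler_norml.
  - by rewrite -oppr0; apply: cvgN; exact: zX.
  - exact: zX.
have cD : (D N).[y] ^+ 2 @[N --> \oo] --> theta x.
  have h1 : (D N).[y] ^+ 2 - (@theta_poly R N).[y] @[N --> \oo] --> (0 : R).
    have [K hK] : exists K, forall N, pnorm (@theta_poly R N) z <= K.
      exists (1 + 2 * h^-1) => N; apply: le_trans (pnormD _ _ (ltW z0)) _.
      rewrite pnorm1 lerD2l -mul_polyC; apply: le_trans (pnormM _ _ (ltW z0)) _.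
      rewrite -[2%:P]mulr1 mul_polyC -(expr0 'X) pnorm_monomial expr0 mulr1 ger0_norm // ler_wpM2l //.
      apply: le_trans (pnorm_sum _ _ _ (ltW z0)) _; apply: le_trans (sum_expRN_le N h0).
      rewrite big_add1 /= big_mkord; apply: ler_sum => i _.
      rewrite -['X^_]scale1r pnorm_monomial normr1 mul1r ler_wiXn2l ?(ltW z0) ?(ltW z1) //.
      by rewrite -{1}(expn1 i.+1) leq_pexp2l.
    apply: (@squeeze _ (M * M + K)) => N.
    have := @horner_small R (D N ^+ 2 - theta_poly N) N.+1 y z yz' z0 (@sqrt_theta_prod_sqr R N).
    rewrite hornerD hornerN horner_exp yzz mulrC => /le_trans; apply.
    rewrite ler_wpM2r ?exprn_ge0 ?(ltW z0) //.
    apply: le_trans (pnormD _ _ (ltW z0)) _; rewrite pnormN; apply: lerD; last exact: hK.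
    rewrite expr2; apply: le_trans (pnormM _ _ (ltW z0)) _.
    by apply: ler_pM; rewrite ?pnorm_ge0 ?(ltW z0) // pnorm_sqrt_theta_prod.
  rewrite -[X in _ --> X]add0r (_ : (fun N => _) =
    fun N => ((D N).[y] ^+ 2 - (theta_poly N).[y]) + (theta_poly N).[y]).
    by apply: cvgD; [exact: h1|exact: cvg_theta_poly].
  by apply/funext => N; rewrite subrK.
(* Only the squares are known to converge; nonnegativity of the product on [0, 1] selects the
   positive root. *)
have cD1 : (D N).[y] @[N --> \oo] --> Num.sqrt (theta x).
  rewrite (_ : (fun N => _) = fun N => Num.sqrt ((D N).[y] ^+ 2)); last first.
    by apply/funext => N; rewrite sqrtr_sqr ger0_norm // sqrt_theta_prod_ge0.
  by apply: continuous_cvg; [exact: sqrt_continuous|exact: cD].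
have h2 : \sum_(m < N.+1) c m * y ^+ m - (D N).[y] @[N --> \oo] --> (0 : R).
  apply: (@squeeze _ (M + M)) => N.
  have := @horner_small R (\poly_(m < N.+1) c m - D N) N.+1 y z yz' z0 (@eqX_c_half R N).
  rewrite hornerD hornerN horner_poly yzz mulrC => /le_trans; apply.
  rewrite ler_wpM2r ?exprn_ge0 ?(ltW z0) //.
  apply: le_trans (pnormD _ _ (ltW z0)) _; rewrite pnormN; apply: lerD; last exact: pnorm_sqrt_theta_prod.
  rewrite (@pnorm_sumE _ _ N.+1) ?size_poly //; apply: le_trans (c_half_abs_sum N.+1 h0).
  by apply: ler_sum => i _; rewrite coef_poly ltn_ord.
have h3 : \sum_(m < N.+1) c m * y ^+ m @[N --> \oo] --> Num.sqrt (theta x).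
  rewrite -[X in _ --> X]add0r (_ : (fun n => _) =
    fun N => (\sum_(m < N.+1) c m * y ^+ m - (D N).[y]) + (D N).[y]).
    by apply: cvgD; [exact: h2|exact: cD1].
  by apply/funext => N; rewrite subrK.
by rewrite -(cvg_shiftS (fun N => \sum_(m < N) c m * y ^+ m)); exact: h3.
Unshelve. all: by end_near. Qed.

End CoefficientBounds.

(** * Integrals over the line and Mellin transforms *)

Section RealLineIntegral.
Context {R : realType}.
Local Notation mu := (@lebesgue_measure R).
Implicit Types f g : R -> R.

Definition rint f : R := (\int[mu]_(y in [set: R]) f y)%R.
Definition rintegrable f : Prop := mu.-integrable setT (EFin \o f).

Lemma rintegrable_le f g : measurable_fun setT f -> rintegrable g ->
  (forall y, `|f y| <= g y) -> rintegrable f.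
Proof.
move=> mf ig h; apply: (le_integrable measurableT _ _ ig); first exact/measurable_EFinP.
by move=> y _ /=; rewrite lee_fin (le_trans (h y)) // ler_norm.
Qed.

Lemma rintegrable_meas f : rintegrable f -> measurable_fun setT f.
Proof. by move=> /measurable_int/measurable_EFinP. Qed.

Lemma rintegrable_oneDsqrV : rintegrable (fun y : R => (1 + y ^+ 2)^-1).
Proof.
have c : continuous (fun y : R => (1 + y ^+ 2)^-1) by exact: continuous_oneDsqrV.
apply/integrableP; split; first by apply/measurable_EFinP; exact: continuous_measurable_fun.
under eq_integral => y _.
  rewrite /= ger0_norm ?invr_ge0 ?addr_ge0 ?sqr_ge0 //; over.
rewrite ge0_symfun_integralT //.
- have -> : [set x : R | 0 <= x] = `[0, +oo[%classic by apply/seteqP; split=> x /=; rewrite in_itv /= andbT.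
  by rewrite integral0y_oneDsqr -EFinM ltry.
- by move=> x; rewrite invr_ge0 addr_ge0 // sqr_ge0.
- by move=> x /=; rewrite sqrrN.
Qed.

(** Exponential decay is compared with 1/(1 + y^2), whose integrability is already available. *)
Lemma rintegrable_two_sided f (C p q : R) : measurable_fun setT f -> 0 < p -> 0 < q ->
  (forall y, `|f y| <= C * expR (p * y)) -> (forall y, `|f y| <= C * expR (- (q * y))) ->
  rintegrable f.
Proof.
move=> mf p0 q0 h1 h2.
pose m := Num.min p q; have m0 : 0 < m by rewrite lt_min p0.
have C0 : 0 <= C by have := h1 0; rewrite mulr0 expR0 mulr1; apply: le_trans.
(* With t = m |y|, the inequality 1 + t^2/2 <= e^t gives 1 + y^2 <= (2/m^2 + 1) e^t. *)
pose K := C * (2 / m ^+ 2 + 1).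
have hK : rintegrable (fun y : R => K * (1 + y ^+ 2)^-1).
  have := @integrableZl _ _ _ mu setT measurableT K _ rintegrable_oneDsqrV.
  by apply: eq_integrable => // y _ /=; rewrite EFinM.
apply: (rintegrable_le mf hK) => y.
have hy : `|f y| <= C * expR (- (m * `|y|)).
  have [y0|y0] := leP 0 y.
    rewrite (ger0_norm y0); apply: le_trans (h2 y) _; rewrite ler_wpM2l // ler_expR lerN2.
    by rewrite ler_wpM2r // ge_min lexx orbT.
  rewrite (ltr0_norm y0) mulrN opprK; apply: le_trans (h1 y) _; rewrite ler_wpM2l // ler_expR.
  by apply: ler_wnM2r; [exact: ltW|rewrite ge_min lexx].
apply: le_trans hy _; rewrite /K -mulrA ler_wpM2l // expRN.
set t := m * `|y|; have t0 : 0 <= t by rewrite mulr_ge0 // ltW.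
have y2 : y ^+ 2 = t ^+ 2 / m ^+ 2 by rewrite /t exprMn real_normK ?num_real //; field; rewrite gt_eqF.
have e2 : 1 + t ^+ 2 / 2 <= expR t by have := expR_ge1Dxn 1 t0.
have m2 : 0 < (m ^+ 2)^-1 by rewrite invr_gt0 exprn_gt0.
rewrite ler_pdivlMr; last by rewrite ltr_pwDl // sqr_ge0.
rewrite ler_pdivrMl ?expR_gt0 // y2; set a := (m ^+ 2)^-1 in m2 *.
apply: (@le_trans _ _ ((1 + t ^+ 2 / 2) * (2 * a + 1))); last first.
  by rewrite ler_wpM2r // addr_ge0 // mulr_ge0 // ltW.
have : 0 <= t ^+ 2 by exact: sqr_ge0.
nra.
Qed.

Lemma rint_dct (f_ : nat -> R -> R) f g :
  (forall n, measurable_fun setT (f_ n)) -> measurable_fun setT f ->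
  (forall y, f_ n y @[n --> \oo] --> f y) -> rintegrable g ->
  (forall n y, `|f_ n y| <= g y) ->
  rintegrable f /\ rint (f_ n) @[n --> \oo] --> rint f.
Proof.
move=> mf_ mf cf ig h.
have c1 : {ae mu, forall y, setT y -> (EFin \o f_ n) y @[n --> \oo] --> (EFin \o f) y}.
  apply: aeW => y _; apply: cvg_EFin; first by apply: nearW => n.
  exact: cf.
have c2 : {ae mu, forall y n, setT y -> (`|(EFin \o f_ n) y| <= (EFin \o g) y)%E}.
  by apply: aeW => y n _ /=; rewrite lee_fin.
have [i1 _ i3] := @dominated_convergence _ _ R mu setT measurableT (fun n => EFin \o f_ n)
  (EFin \o f) (EFin \o g) (fun n => iffRL (measurable_EFinP _ _) (mf_ n)) (iffRL (measurable_EFinP _ _) mf)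
  c1 ig c2.
split; first exact: i1.
by apply: fine_cvg; rewrite fineK //; exact: integrable_fin_num.
Qed.

Lemma rintD f g : rintegrable f -> rintegrable g -> rint (fun y => f y + g y) = rint f + rint g.
Proof. by move=> h1 h2; rewrite /rint -RintegralD. Qed.

Lemma rintB f g : rintegrable f -> rintegrable g -> rint (fun y => f y - g y) = rint f - rint g.
Proof. by move=> h1 h2; rewrite /rint -RintegralB. Qed.

Lemma rintZ f (k : R) : rintegrable f -> rint (fun y => k * f y) = k * rint f.
Proof. by move=> h; rewrite /rint -RintegralZl. Qed.

Lemma rintegrableD f g : rintegrable f -> rintegrable g -> rintegrable (fun y => f y + g y).
Proof.
move=> h1 h2; have := integrableD measurableT h1 h2.
by apply: eq_integrable => // y _ /=; rewrite EFinD.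
Qed.

Lemma rintegrableB f g : rintegrable f -> rintegrable g -> rintegrable (fun y => f y - g y).
Proof.
move=> h1 h2; have := integrableB measurableT h1 h2.
by apply: eq_integrable => // y _ /=; rewrite EFinB.
Qed.

Lemma rintegrableZ f (k : R) : rintegrable f -> rintegrable (fun y => k * f y).
Proof.
move=> h1; have := integrableZl measurableT k h1.
by apply: eq_integrable => // y _ /=; rewrite EFinM.
Qed.

Lemma le_rint f g : rintegrable f -> rintegrable g -> (forall y, f y <= g y) -> rint f <= rint g.
Proof. by move=> h1 h2 h; apply: le_Rintegral => // y _; exact: h. Qed.

Lemma rint_abs_le f g : rintegrable f -> rintegrable g -> (forall y, `|f y| <= g y) ->
  `|rint f| <= rint g.
Proof.
move=> h1 h2 h; apply: le_trans (le_normr_Rintegral measurableT h1) _.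
by apply: le_Rintegral => //; exact: integrable_norm.
Qed.

Lemma continuous_affine (a c : R) : continuous (fun y : R => a * y + c).
Proof. by move=> y; apply: cvgD; [apply: cvgMl_tmp; exact: cvg_id|exact: cvg_cst]. Qed.

Lemma continuous_cmp f g : continuous f -> continuous g -> continuous (fun y => f (g y)).
Proof. by move=> cf cg y; apply: continuous_comp; [exact: cg|exact: cf]. Qed.

Lemma continuous_funrpos f : continuous f -> continuous (f^\+)%R.
Proof. by move=> cf y; apply: (@continuous_max _ _ f (cst 0)); [exact: cf|exact: cst_continuous]. Qed.

Lemma continuous_funrneg f : continuous f -> continuous (f^\-)%R.
Proof. by move=> cf y; apply: (@continuous_max _ _ (fun x => - f x) (cst 0)); [apply: continuousN; exact: cf|exact: cst_continuous]. Qed.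

Lemma ge0_integral_affine (a c : R) f : 0 < a -> continuous f -> (forall y, 0 <= f y) ->
  (\int[mu]_y (f y)%:E = \int[mu]_y (a * f (a * y + c))%:E)%E.
Proof.
move=> a0 cf f0; pose phi (y : R) := a * y + c.
have dphi (y : R) : is_derive y 1 phi a.
  rewrite (_ : phi = (a \*: (id : R -> R)) + cst c); last by [].
  by apply: is_derive_eq; rewrite addr0 -[LHS]/(a * 1) mulr1.
have dE : derive1 phi = cst a by apply/funext => y; rewrite derive1E derive_val.
rewrite (@increasing_ge0_integration_by_substitutionT _ phi f) //.
- by apply: eq_integral => y _; rewrite dE /= mulrC.
- by move=> x y xy; rewrite ltrD2r ltr_pM2l.
- by rewrite dE; exact: cst_continuous.
- by rewrite dE; exact: is_cvg_cst.
- by rewrite dE; exact: is_cvg_cst.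
- apply/cvgrNyPle => A; exists ((A - c) / a); split; first exact: num_real.
  by move=> y; rewrite ltr_pdivlMr // /phi mulrC => h; rewrite ltW // -ltrBrDr.
- apply/cvgryPge => A; exists ((A - c) / a); split; first exact: num_real.
  by move=> y; rewrite ltr_pdivrMr // /phi mulrC => h; rewrite ltW // -ltrBlDr.
Qed.

Lemma rint_pos_neg (D : set R) f : (\int[mu]_(y in D) f y)%R =
  fine (\int[mu]_(y in D) (f^\+ y)%:E - \int[mu]_(y in D) (f^\- y)%:E)%E.
Proof. by rewrite /Rintegral integralE funerpos funerneg. Qed.

Lemma rint_affine (a c : R) f : 0 < a -> continuous f ->
  rint f = rint (fun y => a * f (a * y + c)).
Proof.
move=> a0 cf; rewrite /rint !rint_pos_neg.
rewrite (ge0_integral_affine c a0 (continuous_funrpos cf)); last by move=> y; rewrite funrpos_ge0.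
rewrite (ge0_integral_affine c a0 (continuous_funrneg cf)); last by move=> y; rewrite funrneg_ge0.
have h (u : R) : a * Num.max u 0 = Num.max (a * u) 0 by rewrite maxr_pMr ?mulr0 // ltW.
congr (fine (_ - _)%E); apply: eq_integral => y _; congr EFin; rewrite /funrpos /funrneg h //.
by rewrite mulrN.
Qed.

Lemma rintegrable_affine (a c : R) f : 0 < a -> continuous f -> rintegrable f ->
  rintegrable (fun y => a * f (a * y + c)).
Proof.
move=> a0 cf /integrableP[_ h]; apply/integrableP; split.
  apply/measurable_EFinP; apply: continuous_measurable_fun => y.
  by apply: cvgMl_tmp; have h3 := @continuous_cmp f _ cf (@continuous_affine a c); exact: h3.
rewrite (@eq_integral _ _ _ mu _ (fun y => (a * `|f (a * y + c)|)%:E)); last first.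
  by move=> y _; rewrite /= normrM (gtr0_norm a0).
rewrite -(@ge0_integral_affine a c (fun y => `|f y|)) //.
by move=> y; apply: continuous_comp; [exact: cf|exact: norm_continuous].
Qed.

(** Used as a factor, so that integrals over the half-line remain integrals over the whole line. *)
Definition ind0 (y : R) : R := if 0 <= y then 1 else 0.

Lemma ind0E : ind0 = \1_(`[0, +oo[%classic : set R).
Proof. by apply/funext => y; rewrite /ind0 indicE mem_setE in_itv /= andbT; case: (0 <= y). Qed.

Lemma measurable_ind0 : measurable_fun setT ind0.
Proof. by rewrite ind0E; exact: measurable_indic. Qed.

Lemma ind0_bound y : 0 <= ind0 y <= 1.
Proof. by rewrite /ind0; case: (0 <= y); rewrite ?lexx ?ler01. Qed.

Lemma rintegrable_ind0 f : rintegrable f -> rintegrable (fun y => ind0 y * f y).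
Proof.
move=> h; apply: (@rintegrable_le _ (fun y => `|f y|)).
- by apply: measurable_funM; [exact: measurable_ind0|exact: rintegrable_meas].
- exact: integrable_norm.
- move=> y; have /andP[h0 h1] := ind0_bound y.
  by rewrite normrM ger0_norm // ler_piMl.
Qed.

Lemma rint_ind0 f : rint (fun y => ind0 y * f y) = (\int[mu]_(y in `[0, +oo[) f y)%R.
Proof.
rewrite /rint [RHS]Rintegral_mkcond; apply: eq_Rintegral => y _.
by rewrite patchE mem_setE in_itv /= andbT /ind0; case: (0 <= y); rewrite ?mul1r ?mul0r.
Qed.

Lemma ge0_integral_opp f : continuous f -> (forall y, 0 <= f y) ->
  (\int[mu]_(y in `]-oo, 0%R[) (f y)%:E = \int[mu]_(y in `[0%R, +oo[) (f (- y)%R)%:E)%E.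
Proof.
move=> cf f0; have := @ge0_integration_by_substitutionNy R f 0.
rewrite oppr0 => <- //; last exact: continuous_subspaceT.
rewrite integral_itv_bndo_bndc //; apply/measurable_EFinP.
by apply: measurable_funTS; exact: continuous_measurable_fun.
Qed.

Lemma rint_fold f : continuous f -> rintegrable f ->
  rint f = rint (fun y => ind0 y * (f y + f (- y))).
Proof.
move=> cf hf.
have cfN : continuous (fun y => f (- y)).
  by apply: continuous_cmp => //; exact: opp_continuous.
have neg : (\int[mu]_(y in `]-oo, 0[) f y)%R = (\int[mu]_(y in `[0, +oo[) f (- y))%R.
  have fp y : 0 <= (f^\+)%R y by rewrite funrpos_ge0.
  have fn y : 0 <= (f^\-)%R y by rewrite funrneg_ge0.
  by rewrite !rint_pos_neg (ge0_integral_opp (continuous_funrpos cf) fp) (ge0_integral_opp (continuous_funrneg cf) fn).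
have hfN : rintegrable (fun y => ind0 y * f (- y)).
  apply/integrableP; split.
    apply/measurable_EFinP; apply: measurable_funM; first exact: measurable_ind0.
    exact: continuous_measurable_fun.
  have hm : mu.-integrable `]-oo, 0%R[%classic (EFin \o f).
    by apply: (integrableS measurableT _ _ hf).
  case/integrableP : hm => _.
  rewrite (@ge0_integral_opp (fun y => `|f y|)) //; last first.
    by move=> y; apply: continuous_comp; [exact: cf|exact: norm_continuous].
  apply: le_lt_trans; rewrite [leRHS]integral_mkcond; apply: ge0_le_integral => //.
  - apply: measurableT_comp => //; apply/measurable_EFinP; apply: measurable_funM; first exact: measurable_ind0.
    exact: continuous_measurable_fun.
  - apply/(measurable_restrictT _ _).1 => //; apply/measurable_EFinP; apply: measurable_funTS.
    apply: measurableT_comp => //; exact: continuous_measurable_fun.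
  - move=> y _; rewrite patchE mem_setE in_itv /= andbT /ind0; case: (0 <= y).
      by rewrite mul1r.
    by rewrite mul0r normr0.
rewrite (_ : (fun y => ind0 y * _) = fun y => ind0 y * f y + ind0 y * f (- y)); last first.
  by apply/funext => y; rewrite mulrDr.
rewrite rintD //; last exact: rintegrable_ind0.
rewrite !rint_ind0 -neg /rint addrC -Rintegral_setU //.
- congr (Rintegral _ _ _); apply/seteqP; split=> // y _ /=.
  by rewrite !in_itv /= andbT; apply/orP; rewrite ltNge orbC orbN.
- by apply: (integrableS measurableT _ _ hf) => //; apply: measurableU.
- apply/disj_setPLR => y /=; rewrite !in_itv /= andbT => h; apply/negP; by rewrite -ltNge.
Qed.

(** Substitution x = e^y on the compact intervals [-n, n], followed by monotone convergence on both
    sides. *)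
Lemma ge0_integral_expR f : {in `]0, +oo[, continuous f} -> (forall x, 0 <= f x) ->
  (\int[mu]_(x in `]0%R, +oo[) (f x)%:E = \int[mu]_y (f (expR y) * expR y)%:E)%E.
Proof.
move=> cf f0.
have dexp : derive1 (@expR R) = @expR R by apply/funext => y; rewrite derive1E derive_val.
have cg : continuous (fun y => f (expR y) * expR y).
  move=> y; apply: cvgM; last exact: continuous_expR.
  by apply: continuous_comp; [exact: continuous_expR|apply: cf; rewrite in_itv /= expR_gt0].
have step (n : nat) : (\int[mu]_(x in `[expR (- n%:R)%R, expR n%:R]) (f x)%:E =
   \int[mu]_(y in `[(- n%:R)%R, n%:R%R]) (f (expR y) * expR y)%:E)%E.
  rewrite (@integration_by_substitution_increasing _ (@expR R) f).
  - by apply: eq_integral => y _; rewrite dexp.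
  - by rewrite ge0_cp // oppr_le0.
  - by move=> x y _ _; rewrite ltr_expR.
  - by rewrite dexp => x _; exact: continuous_expR.
  - by rewrite dexp; apply/cvg_ex; exists (expR (- n%:R)); apply: cvg_at_right_filter; exact: continuous_expR.
  - by rewrite dexp; apply/cvg_ex; exists (expR n%:R); apply: cvg_at_left_filter; exact: continuous_expR.
  - split.
    + by move=> x _; exact: derivable_expR.
    + by apply: cvg_at_right_filter; exact: continuous_expR.
    + by apply: cvg_at_left_filter; exact: continuous_expR.
  - apply: continuous_in_subspaceT => x; rewrite inE /= in_itv /= => /andP[h _].
    by apply: cf; rewrite in_itv /= andbT (lt_le_trans (expR_gt0 _) h).
pose F (n : nat) : set R := `[expR (- n%:R), expR n%:R]%classic.
pose G (n : nat) : set R := `[- n%:R, n%:R]%classic.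
have ndF : nondecreasing_seq F.
  move=> n m nm; apply/subsetPset => x; rewrite /F /G /= !in_itv /= => /andP[h1 h2].
  by rewrite (le_trans _ h1) ?(le_trans h2) // ler_expR ?lerN2 ler_nat.
have ndG : nondecreasing_seq G.
  move=> n m nm; apply/subsetPset => x; rewrite /F /G /= !in_itv /= => /andP[h1 h2].
  by rewrite (le_trans _ h1) ?(le_trans h2) // ?lerN2 ler_nat.
have UG : \bigcup_n G n = setT.
  apply/seteqP; split=> // y _; exists (Num.truncn `|y|).+1 => //; rewrite /G /= in_itv /=.
  by rewrite -ler_norml ltW // truncnS_gt.
have UF : \bigcup_n F n = `]0, +oo[%classic.
  apply/seteqP; split=> [x [n _]|x]; rewrite /F /= !in_itv /=.
    by move=> /andP[h _]; rewrite andbT (lt_le_trans (expR_gt0 _) h).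
  rewrite andbT => x0; have [n _] : (\bigcup_n G n) (ln x) by rewrite UG.
  rewrite /G /= in_itv /= => /andP[h1 h2]; exists n => //; rewrite /F /= in_itv /=.
  have xE : x = expR (ln x) by rewrite lnK ?posrE.
  by rewrite xE !ler_expR h1 h2.
have mf0 : measurable_fun (`]0, +oo[%classic : set (measurableTypeR R)) f.
  apply: open_continuous_measurable_fun; first exact: interval_open.
  by move=> x; rewrite inE; apply: cf.
have mf_ n : measurable_fun (F n : set (measurableTypeR R)) (EFin \o f).
  apply/measurable_EFinP; apply: measurable_funS mf0; first exact: measurable_itv.
  by rewrite -UF; exact: bigcup_sup.
have h1 := @ge0_nondecreasing_set_cvg_integral _ (measurableTypeR R) R F (EFin \o f) mu ndF
  (fun n => measurable_itv _) mf_ (fun n x _ => f0 x).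
have mg n : measurable_fun (G n) (fun y => (f (expR y) * expR y)%:E).
  by apply/measurable_EFinP; apply: measurable_funTS; exact: continuous_measurable_fun.
have h2 := @ge0_nondecreasing_set_cvg_integral _ (measurableTypeR R) R G (fun y => (f (expR y) * expR y)%:E) mu ndG
  (fun n => measurable_itv _) mg (fun n x _ => mulr_ge0 (f0 _) (expR_ge0 _)).
rewrite UF in h1; rewrite UG in h2.
have e : (fun n => \int[mu]_(x in F n) (EFin \o f) x)%E = (fun n => \int[mu]_(y in G n) (f (expR y) * expR y)%:E)%E.
  by apply/funext => n; exact: step.
rewrite e in h1; exact: (cvg_unique (@ereal_hausdorff R) h1 h2).
Qed.

Lemma rint_expR f : {in `]0, +oo[, continuous f} ->
  (\int[mu]_(x in `]0%R, +oo[) f x)%R = rint (fun y => f (expR y) * expR y).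
Proof.
move=> cf; rewrite /rint !rint_pos_neg.
have h (u v : R) : 0 <= v -> Num.max u 0 * v = Num.max (u * v) 0.
  by move=> v0; rewrite maxr_pMl ?mul0r.
rewrite !ge0_integral_expR.
- congr (fine (_ - _)%E); apply: eq_integral => y _; congr EFin; rewrite /funrpos /funrneg h ?expR_ge0 //.
  by rewrite mulNr.
- by move=> x x0; apply: (@continuous_max _ _ (fun x => - f x) (cst 0)); [apply: continuousN; exact: cf|exact: cst_continuous].
- by move=> x; rewrite funrneg_ge0.
- by move=> x x0; apply: (@continuous_max _ _ f (cst 0)); [exact: cf|exact: cst_continuous].
- by move=> x; rewrite funrpos_ge0.
Qed.

End RealLineIntegral.

Section ComplexIntegral.
Context {R : realType}.
Local Notation C := (Cplx R).
Local Notation mu := (@lebesgue_measure R).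
Implicit Types (h k : R -> C) (s z w : C).

Definition cint h : C := rint (fun y => complex.Re (h y)) +i* rint (fun y => complex.Im (h y)).

Definition cintegrable h := rintegrable (fun y => complex.Re (h y)) /\
  rintegrable (fun y => complex.Im (h y)).

Definition cmeas h := measurable_fun setT (fun y => complex.Re (h y)) /\
  measurable_fun setT (fun y => complex.Im (h y)).

Lemma cmeas_real (f : R -> R) : measurable_fun setT f -> cmeas (fun y => (f y)%:C).
Proof. by split=> //=; exact: measurable_cst. Qed.

Lemma cmeas_cst (c : C) : cmeas (fun=> c).
Proof. by split; exact: measurable_cst. Qed.

Lemma cmeasM h k : cmeas h -> cmeas k -> cmeas (fun y => h y * k y).
Proof.
move=> [h1 h2] [k1 k2]; split.
  rewrite (_ : (fun y => _) = (fun y => complex.Re (h y) * complex.Re (k y) - complex.Im (h y) * complex.Im (k y))).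
    by apply: measurable_funB; apply: measurable_funM.
  by apply/funext => y; rewrite cReM.
rewrite (_ : (fun y => _) = (fun y => complex.Re (h y) * complex.Im (k y) + complex.Im (h y) * complex.Re (k y))).
  by apply: measurable_funD; apply: measurable_funM.
by apply/funext => y; rewrite cImM.
Qed.

Lemma cmeasD h k : cmeas h -> cmeas k -> cmeas (fun y => h y + k y).
Proof.
move=> [h1 h2] [k1 k2]; split.
  rewrite (_ : (fun y => _) = (fun y => complex.Re (h y) + complex.Re (k y))).
    exact: measurable_funD.
  by apply/funext => y; rewrite cReD.
rewrite (_ : (fun y => _) = (fun y => complex.Im (h y) + complex.Im (k y))).
  exact: measurable_funD.
by apply/funext => y; rewrite cImD.
Qed.

Lemma cmeasX h n : cmeas h -> cmeas (fun y => h y ^+ n).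
Proof.
move=> hh; elim: n => [|n IH].
  by rewrite (_ : (fun y => _) = fun=> 1); [exact: cmeas_cst|apply/funext => y; rewrite expr0].
by rewrite (_ : (fun y => _) = fun y => h y * h y ^+ n); [exact: cmeasM|apply/funext => y; rewrite exprS].
Qed.

Lemma cmeas_sum (I : Type) (r : seq I) (f : I -> R -> C) :
  (forall i, cmeas (f i)) -> cmeas (fun y => \sum_(i <- r) f i y).
Proof.
move=> hf; elim: r => [|i r IH].
  by rewrite (_ : (fun y => _) = fun=> 0); [exact: cmeas_cst|apply/funext => y; rewrite big_nil].
rewrite (_ : (fun y => _) = fun y => f i y + \sum_(j <- r) f j y); first exact: cmeasD.
by apply/funext => y; rewrite big_cons.
Qed.

Lemma cexp_line s (y : R) : cexp (s * y%:C) =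
  (expR (complex.Re s * y))%:C * (cos (complex.Im s * y) +i* sin (complex.Im s * y)).
Proof. by rewrite /cexp cReM cImM /= !mulr0 subr0 add0r. Qed.

Lemma Re_cexp_line s (y : R) : complex.Re (cexp (s * y%:C)) =
  expR (complex.Re s * y) * cos (complex.Im s * y).
Proof. by rewrite cexp_line cReMr. Qed.

Lemma Im_cexp_line s (y : R) : complex.Im (cexp (s * y%:C)) =
  expR (complex.Re s * y) * sin (complex.Im s * y).
Proof. by rewrite cexp_line cImMr. Qed.

Lemma cabs_cexp_line s (y : R) : cabs (cexp (s * y%:C)) = expR (complex.Re s * y).
Proof. by rewrite cabs_cexp cReM /= mulr0 subr0. Qed.

Lemma continuous_scale_line (a : R) : continuous (fun y : R => a * y).
Proof. by move=> y; apply: cvgMl_tmp; exact: cvg_id. Qed.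

Lemma continuous_Re_cexp_line s : continuous (fun y : R => complex.Re (cexp (s * y%:C))).
Proof.
rewrite (_ : (fun y => _) = fun y => expR (complex.Re s * y) * cos (complex.Im s * y)); last first.
  by apply/funext => y; rewrite Re_cexp_line.
move=> y; apply: cvgM.
  by apply: (@continuous_cmp _ (@expR R) _ (@continuous_expR R) (@continuous_scale_line _)).
by apply: (@continuous_cmp _ (@cos R) _ (@continuous_cos R) (@continuous_scale_line _)).
Qed.

Lemma continuous_Im_cexp_line s : continuous (fun y : R => complex.Im (cexp (s * y%:C))).
Proof.
rewrite (_ : (fun y => _) = fun y => expR (complex.Re s * y) * sin (complex.Im s * y)); last first.
  by apply/funext => y; rewrite Im_cexp_line.
move=> y; apply: cvgM.
  by apply: (@continuous_cmp _ (@expR R) _ (@continuous_expR R) (@continuous_scale_line _)).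
by apply: (@continuous_cmp _ (@sin R) _ (@continuous_sin R) (@continuous_scale_line _)).
Qed.

Lemma cmeas_cexp_line s : cmeas (fun y : R => cexp (s * y%:C)).
Proof.
by split; apply: continuous_measurable_fun; [exact: continuous_Re_cexp_line|exact: continuous_Im_cexp_line].
Qed.

Lemma cintegrable_le h (g : R -> R) : cmeas h -> rintegrable g ->
  (forall y, cabs (h y) <= g y) -> cintegrable h.
Proof.
move=> [h1 h2] ig hg; split; apply: rintegrable_le ig _ => // y.
  exact: le_trans (Re_le_cabs _) (hg y).
exact: le_trans (Im_le_cabs _) (hg y).
Qed.

Lemma cint_dct (h_ : nat -> R -> C) h (g : R -> R) :
  (forall n, cmeas (h_ n)) -> cmeas h -> (forall y, h_ n y @[n --> \oo] --> h y) ->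
  rintegrable g -> (forall n y, cabs (h_ n y) <= g y) ->
  cint (h_ n) @[n --> \oo] --> cint h.
Proof.
move=> mh_ [mh1 mh2] ch ig hg; apply/ccvg_ReIm => /=; split.
  apply: (@rint_dct _ (fun n y => complex.Re (h_ n y)) _ g _ mh1 _ ig _).2.
  - by move=> n; case: (mh_ n).
  - by move=> y; have /ccvg_ReIm[] := ch y.
  - by move=> n y; exact: le_trans (Re_le_cabs _) (hg n y).
apply: (@rint_dct _ (fun n y => complex.Im (h_ n y)) _ g _ mh2 _ ig _).2.
- by move=> n; case: (mh_ n).
- by move=> y; have /ccvg_ReIm[] := ch y.
- by move=> n y; exact: le_trans (Im_le_cabs _) (hg n y).
Qed.

Lemma eq_cint h k : h =1 k -> cint h = cint k.
Proof. by move=> /funext ->. Qed.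

Lemma cintD h k : cintegrable h -> cintegrable k ->
  cint (fun y => h y + k y) = cint h + cint k.
Proof.
move=> [h1 h2] [k1 k2]; apply: eqCplx; rewrite ?cReD ?cImD /= -rintD //; congr rint;
  by apply/funext => y; rewrite ?cReD ?cImD.
Qed.

Lemma cintegrableD h k : cintegrable h -> cintegrable k -> cintegrable (fun y => h y + k y).
Proof.
move=> [h1 h2] [k1 k2]; split.
  by rewrite (_ : (fun y => _) = fun y => complex.Re (h y) + complex.Re (k y)); [exact: rintegrableD|apply/funext => y; rewrite cReD].
by rewrite (_ : (fun y => _) = fun y => complex.Im (h y) + complex.Im (k y)); [exact: rintegrableD|apply/funext => y; rewrite cImD].
Qed.

Lemma cintZ (c : C) h : cintegrable h -> cint (fun y => c * h y) = c * cint h.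
Proof.
move=> [h1 h2]; apply: eqCplx; rewrite ?cReM ?cImM /= -!rintZ //.
  by rewrite -rintB; [congr rint; apply/funext => y; rewrite cReM|exact: rintegrableZ|exact: rintegrableZ].
by rewrite -rintD; [congr rint; apply/funext => y; rewrite cImM|exact: rintegrableZ|exact: rintegrableZ].
Qed.

Lemma cintegrableZ (c : C) h : cintegrable h -> cintegrable (fun y => c * h y).
Proof.
move=> [h1 h2]; split.
  rewrite (_ : (fun y => _) = fun y => complex.Re c * complex.Re (h y) - complex.Im c * complex.Im (h y)).
    by apply: rintegrableB; exact: rintegrableZ.
  by apply/funext => y; rewrite cReM.
rewrite (_ : (fun y => _) = fun y => complex.Re c * complex.Im (h y) + complex.Im c * complex.Re (h y)).
  by apply: rintegrableD; exact: rintegrableZ.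
by apply/funext => y; rewrite cImM.
Qed.

Lemma cintB h k : cintegrable h -> cintegrable k ->
  cint (fun y => h y - k y) = cint h - cint k.
Proof.
move=> ih ik; rewrite -[- cint k]mulN1r -cintZ // -cintD //; last exact: cintegrableZ.
by apply: eq_cint => y; rewrite mulN1r.
Qed.

Lemma cint0 : cint (fun=> 0) = 0.
Proof. by rewrite /cint /rint !Rintegral_cst //= !mul0r. Qed.

Lemma cintegrable0 : cintegrable (fun=> 0).
Proof. by split; exact: integrable0. Qed.

Lemma cintegrable_sum (I : Type) (r : seq I) (f : I -> R -> C) :
  (forall i, cintegrable (f i)) -> cintegrable (fun y => \sum_(i <- r) f i y).
Proof.
move=> hf; elim: r => [|i r IH].
  by rewrite (_ : (fun y => _) = fun=> 0); [exact: cintegrable0|apply/funext => y; rewrite big_nil].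
rewrite (_ : (fun y => _) = fun y => f i y + \sum_(j <- r) f j y); first exact: cintegrableD.
by apply/funext => y; rewrite big_cons.
Qed.

Lemma cint_sum (I : Type) (r : seq I) (f : I -> R -> C) :
  (forall i, cintegrable (f i)) ->
  cint (fun y => \sum_(i <- r) f i y) = \sum_(i <- r) cint (f i).
Proof.
move=> hf; elim: r => [|i r IH].
  rewrite big_nil (_ : (fun y => _) = fun=> 0); first exact: cint0.
  by apply/funext => y; rewrite big_nil.
rewrite big_cons -IH -cintD //; last exact: cintegrable_sum.
by apply: eq_cint => y; rewrite big_cons.
Qed.

Lemma cabs_cint_le h (g : R -> R) : cmeas h -> rintegrable g ->
  (forall y, cabs (h y) <= g y) -> cabs (cint h) <= 2 * rint g.
Proof.
move=> mh ig hg; have [h1 h2] := cintegrable_le mh ig hg.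
apply: le_trans (cabs_le _) _; rewrite /= mulr_natl mulr2n; apply: lerD.
  by apply: rint_abs_le => // y; exact: le_trans (Re_le_cabs _) (hg y).
by apply: rint_abs_le => // y; exact: le_trans (Im_le_cabs _) (hg y).
Qed.

Lemma cintegral_expR (f : R -> C) :
  {in `]0, +oo[, continuous (fun x => complex.Re (f x))} ->
  {in `]0, +oo[, continuous (fun x => complex.Im (f x))} ->
  cintegral f = cint (fun y => (expR y)%:C * f (expR y)).
Proof.
move=> c1 c2; rewrite /cintegral /cint !rint_expR //; congr (_ +i* _); congr rint;
  by apply/funext => y; rewrite ?cReMr ?cImMr mulrC.
Qed.

Definition ccont h := continuous (fun y => complex.Re (h y)) /\ continuous (fun y => complex.Im (h y)).

Lemma cint_affine (a c : R) h : 0 < a -> ccont h ->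
  cint h = cint (fun y => a%:C * h (a * y + c)).
Proof.
move=> a0 [h1 h2]; rewrite /cint (rint_affine c a0 h1) (rint_affine c a0 h2).
by congr (_ +i* _); congr rint; apply/funext => y; rewrite ?cReMr ?cImMr.
Qed.

Lemma cintegrable_affine (a c : R) h : 0 < a -> ccont h -> cintegrable h ->
  cintegrable (fun y => a%:C * h (a * y + c)).
Proof.
move=> a0 [c1 c2] [h1 h2]; split.
  rewrite (_ : (fun y => _) = fun y => a * complex.Re (h (a * y + c))); first exact: (@rintegrable_affine _ a c _ a0 c1 h1).
  by apply/funext => y; rewrite cReMr.
rewrite (_ : (fun y => _) = fun y => a * complex.Im (h (a * y + c))); first exact: (@rintegrable_affine _ a c _ a0 c2 h2).
by apply/funext => y; rewrite cImMr.
Qed.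

Lemma cint_fold h : ccont h -> cintegrable h ->
  cint h = cint (fun y => (ind0 y)%:C * (h y + h (- y))).
Proof.
move=> [c1 c2] [h1 h2]; rewrite /cint rint_fold // [X in _ +i* X]rint_fold //.
by congr (_ +i* _); congr rint; apply/funext => y; rewrite ?cReMr ?cImMr ?cReD ?cImD.
Qed.

End ComplexIntegral.

Section Mellin.
Context {R : realType}.
Local Notation C := (Cplx R).
Implicit Types (g : R -> R) (s z w : C) (a b : R).

(** The Mellin transform in the variable y = log t, that is, a two-sided Laplace transform. *)
Definition mellin g s : C := cint (fun y => (g y)%:C * cexp (s * y%:C)).

(** For a < b, the bound with a governs y -> -oo and the one with b governs y -> +oo: the transform
    converges in the strip a < Re s < b. *)
Definition decay g a b := measurable_fun setT g /\
  exists D : R, forall y, `|g y| <= D * expR (- (a * y)) /\ `|g y| <= D * expR (- (b * y)).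

Lemma rintegrable_decay g a b (x r : R) : decay g a b -> 0 <= r -> a < x - r -> x + r < b ->
  rintegrable (fun y => `|g y| * expR (x * y) * (expR (r * y) + expR (- (r * y)))).
Proof.
move=> [mg [D hD]] r0 ax xb.
have one (x' : R) : a < x' -> x' < b -> rintegrable (fun y => `|g y| * expR (x' * y)).
  move=> ax' xb'; apply: (@rintegrable_two_sided _ _ D (x' - a) (b - x')); rewrite ?subr_gt0 //.
  - apply: measurable_funM; first exact: measurableT_comp.
    by apply: continuous_measurable_fun; apply: (@continuous_cmp _ (@expR R) _ (@continuous_expR R) (@continuous_scale_line _ _)).
  - move=> y; rewrite normrM normr_id (ger0_norm (expR_ge0 _)).
    have [h _] := hD y; apply: le_trans (ler_wpM2r (expR_ge0 _) h) _.
    by rewrite -mulrA -expRD mulrBl addrC.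
  - move=> y; rewrite normrM normr_id (ger0_norm (expR_ge0 _)).
    have [_ h] := hD y; apply: le_trans (ler_wpM2r (expR_ge0 _) h) _.
    by rewrite -mulrA -expRD mulrBl opprB addrC.
rewrite (_ : (fun y => _) = fun y => `|g y| * expR ((x + r) * y) + `|g y| * expR ((x - r) * y)).
  by apply: rintegrableD; apply: one; lra.
by apply/funext => y; rewrite mulrDr -!mulrA -!expRD mulrDl mulrBl.
Qed.

Lemma mellin_dominated g a b s (r : R) (k : R -> C) (K : R) : decay g a b -> 0 <= r ->
  a < complex.Re s - r -> complex.Re s + r < b -> (forall y, cabs (k y) <= K * expR (r * `|y|)) ->
  forall y, cabs ((g y)%:C * cexp (s * y%:C) * k y) <=
    K * (`|g y| * expR (complex.Re s * y) * (expR (r * y) + expR (- (r * y)))).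
Proof.
move=> dg r0 ha hb hk y; rewrite cabsM (cabsM (g y)%:C) cabs_real cabs_cexp_line.
have K0 : 0 <= K by have := hk 0; rewrite normr0 mulr0 expR0 mulr1; apply: le_trans; exact: cabs_ge0.
apply: le_trans (ler_wpM2l _ (hk y)) _; first by rewrite mulr_ge0 // expR_ge0.
rewrite mulrCA ler_wpM2l // ler_wpM2l ?mulr_ge0 ?expR_ge0 //.
have [y0|y0] := leP 0 y; first by rewrite ger0_norm // lerDl expR_ge0.
by rewrite ltr0_norm // mulrN lerDr expR_ge0.
Qed.

Lemma mellin_integrable_weight g a b s (r : R) (k : R -> C) (K : R) : decay g a b -> 0 <= r ->
  a < complex.Re s - r -> complex.Re s + r < b -> cmeas k ->
  (forall y, cabs (k y) <= K * expR (r * `|y|)) ->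
  cintegrable (fun y => (g y)%:C * cexp (s * y%:C) * k y).
Proof.
move=> dg r0 ha hb mk hk; apply: cintegrable_le (mellin_dominated dg r0 ha hb hk).
  apply: cmeasM => //; apply: cmeasM; last exact: cmeas_cexp_line.
  by apply: cmeas_real; case: dg.
by apply: rintegrableZ; exact: rintegrable_decay dg r0 ha hb.
Qed.

Lemma mellin_integrable g a b s : decay g a b -> a < complex.Re s < b ->
  cintegrable (fun y => (g y)%:C * cexp (s * y%:C)).
Proof.
move=> dg /andP[ha hb].
have := @mellin_integrable_weight g a b s 0 (fun=> 1) 1 dg (lexx _).
rewrite subr0 addr0 => /(_ ha hb (cmeas_cst _)).
rewrite (_ : (fun y => _ * 1) = fun y => (g y)%:C * cexp (s * y%:C)).
  by apply => y; rewrite cabs1 mul1r mul0r expR0.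
by apply/funext => y; rewrite mulr1.
Qed.

(** Expand e^((z-s)y) in powers of z - s and integrate term by term. The partial sums are dominated
    by e^(r|y|), where r is half the distance from Re s to the boundary of the strip. *)
Theorem analytic_mellin g a b s : decay g a b -> a < complex.Re s < b ->
  analytic_at (mellin g) s.
Proof.
move=> dg /andP[ha hb]; pose x := complex.Re s.
pose r := Num.min (x - a) (b - x) / 2.
have m0 : 0 < Num.min (x - a) (b - x) by rewrite lt_min !subr_gt0 ha.
have r0 : 0 < r by rewrite divr_gt0.
have r1 : r < Num.min (x - a) (b - x) by rewrite ltr_pdivrMr // ltr_pMr // ltr1n.
have [ha' hb'] : a < x - r /\ x + r < b.
  by move: r1; rewrite lt_min => /andP[? ?]; split; lra.
have r0' := ltW r0.
have pw n (y : R) : cabs (exp_terms y%:C n) <= r^-1 ^+ n * expR (r * `|y|).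
  rewrite cabs_exp_terms cabs_real exprVn ler_pdivlMl ?exprn_gt0 // mulrA -exprMn.
  by apply: expr_fact_le; rewrite mulr_ge0.
have my : cmeas (fun y : R => (y%:C : C)) by apply: cmeas_real; exact: measurable_id.
have mexp n w : cmeas (fun y : R => exp_terms (w * y%:C) n).
  apply: cmeasM; last exact: cmeas_cst.
  by apply: cmeasX; apply: cmeasM => //; exact: cmeas_cst.
pose u n := cint (fun y => (g y)%:C * cexp (s * y%:C) * exp_terms y%:C n).
have mexp1 n : cmeas (fun y : R => exp_terms y%:C n).
  by apply: cmeasM; [exact: cmeasX|exact: cmeas_cst].
have iu n : cintegrable (fun y => (g y)%:C * cexp (s * y%:C) * exp_terms y%:C n).
  exact: (mellin_integrable_weight dg r0' ha' hb' (mexp1 n) (pw n)).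
exists u; apply/cnbhsP; exists r => // z zr.
set w := z - s in zr *.
have seriesE N : series (fun n => u n * w ^+ n : C) N =
    cint (fun y => (g y)%:C * cexp (s * y%:C) * series (exp_terms (w * y%:C)) N).
  rewrite /series /=; transitivity (\sum_(0 <= n < N) cint (fun y => w ^+ n * ((g y)%:C * cexp (s * y%:C) * exp_terms y%:C n))).
    by apply: eq_bigr => n _; rewrite cintZ // mulrC.
  rewrite -cint_sum; last by move=> n; exact: cintegrableZ.
  apply: eq_cint => y; rewrite mulr_sumr; apply: eq_bigr => n _.
  by rewrite /exp_terms exprMn; ring.
rewrite (_ : series _ = fun N => cint (fun y => (g y)%:C * cexp (s * y%:C) * series (exp_terms (w * y%:C)) N)); last first.
  by apply/funext => N; exact: seriesE.
have -> : mellin g z = cint (fun y => (g y)%:C * cexp (s * y%:C) * cexp (w * y%:C)).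
  rewrite /mellin; apply: eq_cint => y.
  have -> : z * y%:C = s * y%:C + w * y%:C by rewrite /w mulrBl addrC subrK.
  by rewrite cexpD mulrA.
have wr := ltW zr.
have bnd (y : R) : expR (cabs (w * y%:C)) <= 1 * expR (r * `|y|).
  by rewrite mul1r ler_expR cabsM cabs_real ler_wpM2r.
have mg : cmeas (fun y => (g y)%:C * cexp (s * y%:C)).
  by apply: cmeasM; [apply: cmeas_real; case: dg|exact: cmeas_cexp_line].
apply: (@cint_dct _ _ _ (fun y => 1 * (`|g y| * expR (complex.Re s * y) * (expR (r * y) + expR (- (r * y)))))).
- move=> N; apply: cmeasM => //; rewrite /series /=.
  by apply: cmeas_sum => n; exact: mexp.
- by apply: cmeasM => //; exact: cmeas_cexp_line.
- by move=> y; apply: ccvgMl; exact: cvg_exp_terms.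
- by apply: rintegrableZ; exact: rintegrable_decay dg r0' ha' hb'.
- move=> N; apply: (mellin_dominated dg r0' ha' hb') => y.
  exact: le_trans (cabs_series_exp_terms _ _) (bnd y).
Qed.

End Mellin.

Section FundamentalTheorem.
Context {R : realType}.
Local Notation C := (Cplx R).
Local Notation mu := (@lebesgue_measure R).

Lemma cvg_expRN_nat (D c : R) : 0 < c -> D * expR (- (c * n.+1%:R)) @[n --> \oo] --> (0 : R).
Proof.
move=> c0; rewrite -(mulr0 D); apply: cvgMl_tmp.
have h : expR (- c) ^+ n @[n --> \oo] --> (0 : R).
  by apply: cvg_expr; rewrite ger0_norm ?expR_ge0 // expR_lt1 oppr_lt0.
rewrite (_ : (fun n => _) = fun n => expR (- c) ^+ n.+1).
  by rewrite (cvg_shiftS (fun n => expR (- c) ^+ n)); exact: h.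
by apply/funext => n; rewrite -expRM_natr mulNr.
Qed.

Lemma rint_interval_deriv (F f : R -> R) (a b : R) : a < b -> continuous f ->
  (forall y : R, is_derive y 1 F (f y)) ->
  rint (fun y => \1_(`[a, b]%classic : set R) y * f y) = F b - F a.
Proof.
move=> ab cf dF.
have cF : continuous F by move=> y; apply/differentiable_continuous/derivable1_diffP; case: (dF y).
rewrite /rint (@eq_Rintegral _ _ R mu setT (f \_ `[a, b]%classic)); last first.
  by move=> y _; rewrite patchE indicE; case: (y \in _); rewrite ?mul1r ?mul0r.
rewrite -Rintegral_mkcond /Rintegral (@continuous_FTC2 _ f F) //.
- exact: continuous_subspaceT.
- split.
  + by move=> y _; case: (dF y).
  + by apply: cvg_at_right_filter; exact: cF.
  + by apply: cvg_at_left_filter; exact: cF.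
- by move=> y _; rewrite derive1E; apply: derive_val; exact: dF.
Qed.

Lemma is_derive_cexp_line (s : R[i]) (y : R) :
  is_derive y 1 (fun x : R => complex.Re (cexp (s * x%:C))) (complex.Re (s * cexp (s * y%:C))) /\
  is_derive y 1 (fun x : R => complex.Im (cexp (s * x%:C))) (complex.Im (s * cexp (s * y%:C))).
Proof.
pose p := complex.Re s; pose q := complex.Im s.
have dl (c : R) : is_derive y 1 (fun x : R => c * x) c.
  rewrite (_ : (fun x => c * x) = c \*: (id : R -> R)); last by [].
  by apply: is_derive_eq; rewrite -[LHS]/(c * 1) mulr1.
have de : is_derive y 1 (fun x : R => expR (p * x)) (expR (p * y) * p).
  exact: (@is_derive1_comp _ (@expR R) (fun x => p * x)).
have dc : is_derive y 1 (fun x : R => cos (q * x)) (- sin (q * y) * q).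
  exact: (@is_derive1_comp _ (@cos R) (fun x => q * x)).
have ds : is_derive y 1 (fun x : R => sin (q * x)) (cos (q * y) * q).
  exact: (@is_derive1_comp _ (@sin R) (fun x => q * x)).
split.
  rewrite (_ : (fun x : R => _) = (fun x => expR (p * x)) * (fun x => cos (q * x))).
    apply: is_derive_eq; rewrite cReM Re_cexp_line Im_cexp_line -/p -/q.
    by rewrite -[X in X + _]/(expR (p * y) * (- sin (q * y) * q)) -[X in _ + X]/(cos (q * y) * (expR (p * y) * p)); ring.
  by apply/funext => x; rewrite Re_cexp_line.
rewrite (_ : (fun x : R => _) = (fun x => expR (p * x)) * (fun x => sin (q * x))).
  apply: is_derive_eq; rewrite cImM Re_cexp_line Im_cexp_line -/p -/q.
  by rewrite -[X in X + _]/(expR (p * y) * (cos (q * y) * q)) -[X in _ + X]/(sin (q * y) * (expR (p * y) * p)); ring.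
by apply/funext => x; rewrite Im_cexp_line.
Qed.

Lemma is_deriveMr (c : R) (F : R -> R) (y d : R) : is_derive y 1 F d -> is_derive y 1 (fun x => c * F x) (c * d).
Proof.
move=> h; rewrite (_ : (fun x => c * F x) = c \*: F); last by [].
by apply: is_derive_eq.
Qed.

Lemma rint_half_deriv (F f : R -> R) : continuous f -> (forall y : R, is_derive y 1 F (f y)) ->
  rintegrable (fun y => ind0 y * f y) -> F n.+1%:R @[n --> \oo] --> (0 : R) ->
  rint (fun y => ind0 y * f y) = - F 0.
Proof.
move=> cf dF hf hF.
have cF : continuous F by move=> y; apply/differentiable_continuous/derivable1_diffP; case: (dF y).
pose f_ n y : R := \1_(`[0, n.+1%:R]%classic : set R) y * f y.
have cf_ y : f_ n y @[n --> \oo] --> ind0 y * f y.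
  apply/rcvgP => e e0; exists (Num.truncn `|y|).+1 => // n /= hn.
  have yn : y <= n.+1%:R.
    apply: le_trans (ler_norm _) _; apply: ltW; apply: lt_le_trans (truncnS_gt _) _.
    by rewrite ler_nat leqW.
  rewrite /f_ indicE mem_setE in_itv /= yn andbT /ind0; case: (0 <= y); by rewrite subrr normr0.
have mi := rintegrable_meas hf.
have f_E n y : f_ n y = \1_(`[0, n.+1%:R]%classic : set R) y * (ind0 y * f y).
  rewrite /f_ indicE mem_setE in_itv /= /ind0; case: (0 <= y) => /=; rewrite ?mul0r ?mul1r //.
have mf_ n : measurable_fun setT (f_ n).
  rewrite (_ : f_ n = fun y => \1_(`[0, n.+1%:R]%classic : set R) y * (ind0 y * f y)).
    by apply: measurable_funM => //; exact: measurable_indic.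
  by apply/funext => y; exact: f_E.
have bf_ n y : `|f_ n y| <= `|ind0 y * f y|.
  by rewrite f_E normrM ler_piMl // indicE; case: (y \in _); rewrite ?normr1 ?normr0.
have [_ h] := @rint_dct R f_ _ (fun y => `|ind0 y * f y|) mf_ mi cf_ (integrable_norm hf) bf_.
rewrite (_ : (fun n => rint (f_ n)) = fun n => F n.+1%:R - F 0) in h.
  rewrite -sub0r; apply: (cvg_unique (@Rhausdorff R) h).
  by apply: cvgB; [exact: hF|exact: cvg_cst].
apply/funext => n; exact: rint_interval_deriv.
Qed.

Lemma rint_total_deriv (F f : R -> R) : continuous f -> (forall y : R, is_derive y 1 F (f y)) ->
  rintegrable f -> F n.+1%:R @[n --> \oo] --> (0 : R) -> F (- n.+1%:R) @[n --> \oo] --> (0 : R) ->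
  rint f = 0.
Proof.
move=> cf dF hf h1 h2.
pose f_ n y : R := \1_(`[- n.+1%:R, n.+1%:R]%classic : set R) y * f y.
have cf_ y : f_ n y @[n --> \oo] --> f y.
  apply/rcvgP => e e0; exists (Num.truncn `|y|).+1 => // n /= hn.
  have yn : `|y| <= n.+1%:R.
    by apply: ltW; apply: lt_le_trans (truncnS_gt _) _; rewrite ler_nat leqW.
  by rewrite /f_ indicE mem_setE in_itv /= -ler_norml yn mul1r subrr normr0.
have mf_ n : measurable_fun setT (f_ n).
  by apply: measurable_funM; [exact: measurable_indic|exact: rintegrable_meas].
have bf_ n y : `|f_ n y| <= `|f y|.
  by rewrite normrM ler_piMl // indicE; case: (y \in _); rewrite ?normr1 ?normr0.
have [_ h] := @rint_dct R f_ _ (fun y => `|f y|) mf_ (rintegrable_meas hf) cf_ (integrable_norm hf) bf_.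
rewrite (_ : (fun n => rint (f_ n)) = fun n => F n.+1%:R - F (- n.+1%:R)) in h.
  rewrite -(subr0 0); apply: (cvg_unique (@Rhausdorff R) h).
  by apply: cvgB; [exact: h1|exact: h2].
apply/funext => n; apply: rint_interval_deriv => //.
by rewrite (@lt_trans _ _ 0) // oppr_lt0.
Qed.

End FundamentalTheorem.

(** * Riemann's folding of a Mellin transform at the symmetry point *)

Section Reflection.
Context {R : realType}.
Local Notation C := (Cplx R).
Implicit Types s : C.

Lemma decay_ind0 (a : R) : a <= 0 -> decay (@ind0 R) a 0.
Proof.
move=> a0; split; first exact: measurable_ind0.
exists 1 => y; rewrite mul0r oppr0 expR0 !mul1r /ind0.
have [y0|y0] := boolP (0 <= y); last by rewrite normr0 expR_ge0.
rewrite normr1; split=> //; rewrite -[X in X <= _](@expR0 R) ler_expR oppr_ge0.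
exact: mulr_le0_ge0.
Qed.

Lemma mellin_ind0 s : 0 < complex.Re s -> mellin (@ind0 R) (- s) = s^-1.
Proof.
move=> s0; pose w : C := - s.
have sn0 : s != 0 by apply/eqP => e; move: s0; rewrite e /= ltxx.
have wn0 : w != 0 by rewrite oppr_eq0.
have [i1 i2] : cintegrable (fun y => (ind0 y)%:C * cexp (w * y%:C)).
  apply: (@mellin_integrable _ _ (- complex.Re s - 1) 0); first by apply: decay_ind0; lra.
  by rewrite /w cReN; apply/andP; split; lra.
pose H (y : R) : C := w^-1 * cexp (w * y%:C).
have dre (y : R) : is_derive y 1 (fun x => complex.Re (H x)) (complex.Re (cexp (w * y%:C))).
  rewrite (_ : (fun x : R => _) = (fun x => complex.Re w^-1 * complex.Re (cexp (w * x%:C)))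
     - (fun x => complex.Im w^-1 * complex.Im (cexp (w * x%:C)))); last by apply/funext => x; rewrite /H cReM.
  have [d1 d2] := is_derive_cexp_line w y.
  have d1' := is_deriveMr (complex.Re w^-1) d1; have d2' := is_deriveMr (complex.Im w^-1) d2.
  by apply: is_derive_eq; rewrite -cReM mulrA mulVf // mul1r.
have dim (y : R) : is_derive y 1 (fun x => complex.Im (H x)) (complex.Im (cexp (w * y%:C))).
  rewrite (_ : (fun x : R => _) = (fun x => complex.Re w^-1 * complex.Im (cexp (w * x%:C)))
     + (fun x => complex.Im w^-1 * complex.Re (cexp (w * x%:C)))); last by apply/funext => x; rewrite /H cImM.
  have [d1 d2] := is_derive_cexp_line w y.
  have d1' := is_deriveMr (complex.Im w^-1) d1; have d2' := is_deriveMr (complex.Re w^-1) d2.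
  by apply: is_derive_eq; rewrite -cImM mulrA mulVf // mul1r.
have hH : H n.+1%:R @[n --> \oo] --> (0 : C).
  apply/ccvgP => e e0; have := @cvg_expRN_nat R (cabs w^-1) _ s0 => /rcvgP /(_ _ e0).
  apply: filterS => n; rewrite !subr0 /H cabsM cabs_cexp_line /w cReN mulNr.
  by apply: le_lt_trans; exact: ler_norm.
have /ccvg_ReIm[/= h1 h2] := hH.
have H0 : H 0 = - s^-1 by rewrite /H mulr0 cexp0 mulr1 /w invrN.
have e1 (y : R) : complex.Re ((ind0 y)%:C * cexp (w * y%:C)) = ind0 y * complex.Re (cexp (w * y%:C)) by rewrite cReMr.
have e2 (y : R) : complex.Im ((ind0 y)%:C * cexp (w * y%:C)) = ind0 y * complex.Im (cexp (w * y%:C)) by rewrite cImMr.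
rewrite (funext e1) in i1; rewrite (funext e2) in i2.
rewrite /mellin /cint -/w (funext e1) (funext e2).
rewrite (rint_half_deriv (@continuous_Re_cexp_line _ w) dre i1 h1).
rewrite (rint_half_deriv (@continuous_Im_cexp_line _ w) dim i2 h2).
by rewrite H0; apply: eqCplx; rewrite /= ?cReN ?cImN opprK.
Qed.

Section Fold.
Variables (phi : R -> R) (k : R).
Hypothesis k0 : 0 < k.
Hypothesis cphi : continuous phi.
Hypothesis phiN : forall y, phi (- y) = expR (k * y) * phi y.
Hypothesis phi_fast : forall b : R, exists D : R, forall y, 0 <= y -> `|phi y - 1| <= D * expR (- (b * y)).

Let tail (y : R) : R := ind0 y * (phi y - 1).

Let mphi1 : measurable_fun setT (fun y => phi y - 1).
Proof.
by apply: continuous_measurable_fun => y; apply: cvgB; [exact: cphi|exact: cvg_cst].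
Qed.

Lemma decay_tail a b : decay tail a b.
Proof.
split; first by apply: measurable_funM; [exact: measurable_ind0|exact: mphi1].
have [D1 h1] := phi_fast a; have [D2 h2] := phi_fast b.
have D10 : 0 <= D1 by have := h1 0 (lexx _); rewrite mulr0 oppr0 expR0 mulr1; apply: le_trans.
have D20 : 0 <= D2 by have := h2 0 (lexx _); rewrite mulr0 oppr0 expR0 mulr1; apply: le_trans.
exists (D1 + D2) => y; rewrite /tail /ind0; have [y0|y0] := boolP (0 <= y); last first.
  by rewrite mul0r normr0 !mulr_ge0 ?addr_ge0 ?expR_ge0.
rewrite mul1r; split.
  by apply: le_trans (h1 y y0) _; rewrite ler_wpM2r ?expR_ge0 // lerDl.
by apply: le_trans (h2 y y0) _; rewrite ler_wpM2r ?expR_ge0 // lerDr.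
Qed.

Lemma decay_full b : k <= b -> decay (fun y => phi y - 1) k b.
Proof.
move=> kb; split; first exact: mphi1.
have [D h] := phi_fast b.
have D0 : 0 <= D by have := h 0 (lexx _); rewrite mulr0 oppr0 expR0 mulr1; apply: le_trans.
exists (D + 2) => y; have [y0|y0] := leP 0 y.
  have E : `|phi y - 1| <= (D + 2) * expR (- (b * y)).
    by apply: le_trans (h y y0) _; rewrite ler_wpM2r ?expR_ge0 // lerDl.
  split=> //; apply: le_trans E _; rewrite ler_wpM2l ?addr_ge0 // ler_expR lerN2.
  by rewrite ler_wpM2r.
have E : `|phi y - 1| <= (D + 2) * expR (- (k * y)).
  have y0' : 0 <= - y by rewrite oppr_ge0 ltW.
  have e1 : 1 <= expR (- (k * y)) by rewrite -expR0 ler_expR oppr_ge0 mulr_ge0_le0 // ltW.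
  have -> : phi y - 1 = expR (- (k * y)) * (phi (- y) - 1) + (expR (- (k * y)) - 1).
    by have := phiN (- y); rewrite opprK => ->; rewrite mulrN; ring.
  apply: le_trans (ler_normD _ _) _; rewrite normrM (ger0_norm (expR_ge0 _)) [X in _ + X]ger0_norm ?subr_ge0 //.
  have hb : `|phi (- y) - 1| <= D.
    apply: le_trans (h _ y0') _; rewrite ler_piMr // expR_le1 oppr_le0 mulr_ge0 //.
    by apply: le_trans kb; exact: ltW.
  have : expR (- (k * y)) * `|phi (- y) - 1| <= expR (- (k * y)) * D by rewrite ler_wpM2l ?expR_ge0.
  by rewrite mulrDl; lra.
split=> //; apply: le_trans E _; rewrite ler_wpM2l ?addr_ge0 // ler_expR lerN2.
by rewrite ler_wnM2r // ltW.
Qed.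

(** For y >= 0, phi(-y) - 1 = e^(ky) (phi(y) - 1) + e^(ky) - 1. Integrated against e^(-sy), the
    three terms give the tail at k - s, the polar term 1/(s - k) and -1/s. *)
Lemma mellin_fold s : k < complex.Re s ->
  mellin (fun y => phi y - 1) s =
  mellin tail s + mellin tail (k%:C - s) + (s - k%:C)^-1 - s^-1.
Proof.
move=> ks; have s0 : 0 < complex.Re s by apply: lt_trans ks.
pose b := complex.Re s + 1.
have ifull : cintegrable (fun y => (phi y - 1)%:C * cexp (s * y%:C)).
  apply: (@mellin_integrable _ _ k b); first by apply: decay_full; rewrite /b; lra.
  by rewrite ks /b ltrDl ltr01.
have cfull : ccont (fun y => (phi y - 1)%:C * cexp (s * y%:C)).
  have c1 : continuous (fun y => phi y - 1).
    by move=> y; apply: cvgB; [exact: cphi|exact: cvg_cst].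
  split.
    rewrite (_ : (fun y => _) = fun y => (phi y - 1) * complex.Re (cexp (s * y%:C))).
      by move=> y; apply: cvgM; [exact: c1|exact: continuous_Re_cexp_line].
    by apply/funext => y; rewrite cReMr.
  rewrite (_ : (fun y => _) = fun y => (phi y - 1) * complex.Im (cexp (s * y%:C))).
    by move=> y; apply: cvgM; [exact: c1|exact: continuous_Im_cexp_line].
  by apply/funext => y; rewrite cImMr.
rewrite {1}/mellin cint_fold //.
have it (z : C) : cintegrable (fun y => (tail y)%:C * cexp (z * y%:C)).
  apply: (@mellin_integrable _ _ (complex.Re z - 1) (complex.Re z + 1)); first exact: decay_tail.
  by apply/andP; split; lra.
have ij (z : C) : 0 < complex.Re z -> cintegrable (fun y => (ind0 y)%:C * cexp (- z * y%:C)).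
  move=> z0; have z1 : - complex.Re z - 1 <= 0 by lra.
  apply: (@mellin_integrable R (@ind0 R) (- complex.Re z - 1) 0 _ (decay_ind0 z1)).
  by rewrite cReN; apply/andP; split; lra.
have sk0 : 0 < complex.Re (s - k%:C) by rewrite cReB /= subr_gt0.
rewrite -(mellin_ind0 sk0) -(mellin_ind0 s0) /mellin -cintD //.
rewrite -cintD; [|by apply: cintegrableD|exact: ij].
rewrite -cintB; [|by apply: cintegrableD; [exact: cintegrableD|exact: ij]|exact: ij].
apply: eq_cint => y; rewrite phiN /tail !rmorphM /= !rmorphB !rmorphM /= -cexp_real.
have -> : (k%:C - s) * y%:C = (k * y)%:C + s * (- y)%:C by rewrite rmorphM rmorphN /=; ring.
have -> : - (s - k%:C) * y%:C = (k * y)%:C + s * (- y)%:C by rewrite rmorphM rmorphN /=; ring.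
have -> : - s * y%:C = s * (- y)%:C by rewrite rmorphN /=; ring.
by rewrite cexpD; ring.
Qed.

End Fold.
End Reflection.

(** * The Gamma function *)

Section GammaIntegral.
Context {R : realType}.
Local Notation C := (Cplx R).
Implicit Types (s a z : C).

Lemma sin_abs_le (v : R) : `|sin v| <= `|v|.
Proof.
have main (u : R) : 0 < u -> `|sin u| <= u.
  move=> u0; have [c _] := @MVT R (@sin R) (@cos R) 0 u u0 (fun x _ => is_derive_sin x)
    (continuous_subspaceT (@continuous_sin R)).
  rewrite sin0 !subr0 => ->; rewrite normrM (gtr0_norm u0) ler_piMl ?cos_max //.
  exact: ltW.
have [v0|v0|->] := ltgtP v 0; last by rewrite sin0 normr0.
  by rewrite (ltr0_norm v0) -[v]opprK sinN normrN opprK; apply: main; rewrite oppr_gt0.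
by rewrite (gtr0_norm v0); exact: main.
Qed.

Lemma one_sub_cos_le (v : R) : 1 - cos v <= v ^+ 2 / 2.
Proof.
have e : 1 - cos v = 2 * sin (v / 2) ^+ 2.
  rewrite {1}(_ : v = v / 2 + v / 2); last by field.
  by rewrite cosD -{1}(cos2Dsin2 (v / 2)); ring.
have := sin_abs_le (v / 2); rewrite -(@ler_pXn2r _ 2) ?nnegrE ?normr_ge0 // !real_normK ?num_real //.
rewrite e => h; have -> : v ^+ 2 / 2 = 2 * (v / 2) ^+ 2 by field.
by rewrite ler_wpM2l.
Qed.

(** With h = x/2, (e^x - 1)^2 = e^x (e^h - e^(-h))^2 and |e^h - e^(-h)| >= |h|. *)
Lemma expR_sqr_le (x : R) : expR x * x ^+ 2 <= 4 * (expR x - 1) ^+ 2.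
Proof.
pose h := x / 2; have xh : x = h + h by rewrite /h; field.
have uv : expR h * expR (- h) = 1 by rewrite -expRD subrr expR0.
have key : h ^+ 2 <= (expR h - expR (- h)) ^+ 2.
  have [h0|h0] := leP 0 h.
    rewrite ler_pXn2r ?nnegrE // ?subr_ge0 ?ler_expR; [|by lra..].
    have h1 := expR_ge1Dx h; have : expR (- h) <= 1 by rewrite expR_le1 oppr_le0.
    by lra.
  rewrite -[h ^+ 2]sqrrN -[(_ - _) ^+ 2]sqrrN opprB ler_pXn2r ?nnegrE // ?subr_ge0 ?ler_expR; [|by lra..].
  have h1 := expR_ge1Dx (- h); have : expR h <= 1 by rewrite expR_le1 ltW.
  by lra.
have e1 : expR x - 1 = expR h * (expR h - expR (- h)) by rewrite mulrBr uv -expRD -xh.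
rewrite e1 exprMn -expRM_natr (_ : h * 2%:R = x); last by rewrite xh; ring.
rewrite [4 * _]mulrCA; apply: ler_wpM2l; rewrite ?expR_ge0 // (_ : x ^+ 2 = 4 * h ^+ 2); last by rewrite xh; ring.
by rewrite ler_wpM2l.
Qed.

Lemma cabs_cexp_sub1 a (w : R) : 0 < complex.Re a <= 1 ->
  cabs (cexp (a * w%:C) - 1) ^+ 2 <=
  (1 + 4 * (complex.Im a / complex.Re a) ^+ 2) * (expR w - 1) ^+ 2.
Proof.
move=> /andP[s0 s1]; set p := complex.Re a; set q := complex.Im a.
rewrite cabs_sqr cReB cImB Re_cexp_line Im_cexp_line -/p -/q /= subr0.
set E := expR (p * w).
have E0 : 0 <= E by exact: expR_ge0.
have -> : (E * cos (q * w) - 1) ^+ 2 + (E * sin (q * w)) ^+ 2 = (E - 1) ^+ 2 + 2 * E * (1 - cos (q * w)).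
  have := cos2Dsin2 (q * w); set x := cos _; set y := sin _ => h.
  by rewrite [(E * y) ^+ 2]exprMn (_ : y ^+ 2 = 1 - x ^+ 2); [ring|rewrite -h addrC addKr].
have h1 : 2 * E * (1 - cos (q * w)) <= 4 * (q / p) ^+ 2 * (E - 1) ^+ 2.
  apply: (@le_trans _ _ (E * (q * w) ^+ 2)).
    have E2 : 0 <= 2 * E by rewrite mulr_ge0.
    have := ler_wpM2l E2 (one_sub_cos_le (q * w)) => h; apply: le_trans h _.
    by rewrite le_eqVlt; apply/orP; left; apply/eqP; field.
  have := expR_sqr_le (p * w); rewrite -/E => h2.
  have -> : E * (q * w) ^+ 2 = (q / p) ^+ 2 * (E * (p * w) ^+ 2).
    by field; rewrite gt_eqF.
  by rewrite [4 * _]mulrC -[X in _ <= X]mulrA; apply: ler_wpM2l; rewrite ?sqr_ge0.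
have h2 : (E - 1) ^+ 2 <= (expR w - 1) ^+ 2.
  have [w0|w0] := leP 0 w.
    have g1 : 1 <= E by rewrite -[1](@expR0 R) ler_expR mulr_ge0 // ltW.
    have g2 : E <= expR w by rewrite ler_expR ler_piMl.
    by rewrite ler_pXn2r ?nnegrE //; lra.
  have g1 : E <= 1 by rewrite expR_le1 mulr_ge0_le0 // ltW.
  have g2 : expR w <= E by rewrite ler_expR ler_nMl.
  by rewrite -[(E - 1) ^+ 2]sqrrN -[(_ - 1) ^+ 2]sqrrN ler_pXn2r ?nnegrE //; lra.
apply: le_trans (lerD h2 h1) _; rewrite [X in _ <= X]mulrDl mul1r; apply: lerD => //.
by apply: ler_wpM2l; rewrite // mulr_ge0 ?sqr_ge0.
Qed.

(** The factor e^(-x) of Euler's integral in the variable y = log x. *)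
Definition gam (y : R) : R := expR (- expR y).

Lemma continuous_gam : continuous gam.
Proof.
apply: (@continuous_cmp _ (@expR R)); first exact: continuous_expR.
move=> y; apply: cvgN; exact: continuous_expR.
Qed.

Lemma gam_ge0 y : 0 <= gam y. Proof. exact: expR_ge0. Qed.

Lemma decay_gam n : decay gam 0 n%:R.
Proof.
split; first by apply: continuous_measurable_fun; exact: continuous_gam.
exists (1 + n`!%:R) => y; rewrite mul0r oppr0 expR0 mulr1 ger0_norm ?gam_ge0 //.
have f0 : (0 : R) < n`!%:R by rewrite ltr0n fact_gt0.
have g1 : gam y <= 1 by rewrite expR_le1 oppr_le0 expR_ge0.
split; first by lra.
have := @expr_fact_le R (expR y) n (expR_ge0 _); rewrite -expRM_natr ler_pdivrMr // => h.
rewrite /gam mulrDl mul1r; apply: (@le_trans _ _ (n`!%:R * expR (- (n%:R * y)))); last first.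
  by rewrite lerDr expR_ge0.
rewrite !expRN ler_pdivlMr ?expR_gt0 // mulrC ler_pdivrMr ?expR_gt0 //.
by rewrite [n%:R * y]mulrC [n`!%:R * _]mulrC; apply: h.
Qed.

Definition Gint s : C := mellin gam s.

Lemma decay_gam_Re s : complex.Re s < (Num.truncn (complex.Re s)).+1%:R.
Proof. exact: truncnS_gt. Qed.

Lemma Gint_integrable s : 0 < complex.Re s -> cintegrable (fun y => (gam y)%:C * cexp (s * y%:C)).
Proof. by move=> s0; apply: (mellin_integrable (decay_gam _)); rewrite s0; exact: decay_gam_Re. Qed.

Lemma analytic_Gint s : 0 < complex.Re s -> analytic_at Gint s.
Proof. by move=> s0; apply: (analytic_mellin (decay_gam _)); rewrite s0; exact: decay_gam_Re. Qed.

Lemma cvg_gam_line (p : R) : 0 < p ->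
  gam n.+1%:R * expR (p * n.+1%:R) @[n --> \oo] --> (0 : R) /\
  gam (- n.+1%:R) * expR (p * - n.+1%:R) @[n --> \oo] --> (0 : R).
Proof.
move=> p0; pose N := (Num.truncn p).+1.
have [_ [D hD]] := decay_gam N.
split; apply/rcvgP => e e0.
  have pN : 0 < N%:R - p by rewrite subr_gt0 truncnS_gt.
  have := @cvg_expRN_nat R D _ pN => /rcvgP /(_ _ e0); apply: filterS => n.
  rewrite !subr0; apply: le_lt_trans; rewrite normrM (ger0_norm (expR_ge0 (p * _))).
  apply: le_trans (ler_norm _).
  apply: le_trans (_ : D * expR (- (N%:R * n.+1%:R)) * expR (p * n.+1%:R) <= _).
    by rewrite ler_wpM2r ?expR_ge0 //; exact: (hD _).2.
  by rewrite -mulrA -expRD le_eqVlt; apply/orP; left; apply/eqP; congr (_ * expR _); ring.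
have := @cvg_expRN_nat R 1 _ p0 => /rcvgP /(_ _ e0); apply: filterS => n.
rewrite !subr0 mul1r mulrN; apply: le_lt_trans.
rewrite normrM ler_piMl // ger0_norm ?gam_ge0 // expR_le1 oppr_le0 expR_ge0 //.
Qed.

Lemma is_derive_gam (y : R) : is_derive y 1 gam (- (expR y * gam y)).
Proof.
have d1 : is_derive y 1 (fun x : R => - expR x) (- expR y).
  by apply: is_deriveN.
have := @is_derive1_comp _ (@expR R) (fun x => - expR x) y _ _ (is_derive_expR _) d1.
by move=> h; apply: is_derive_eq h _; rewrite mulrN mulrC.
Qed.

(** Integration by parts: the derivative of gam(y) e^(sy) is the difference of the two integrands,
    and gam(y) e^(sy) vanishes at both ends of the line. *)
Lemma Gint_rec s : 0 < complex.Re s -> Gint (s + 1) = s * Gint s.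
Proof.
move=> s0; have s1 : 0 < complex.Re (s + 1) by rewrite cReD /= ltr_wpDr.
have i0 := Gint_integrable s0; have i1 := Gint_integrable s1.
pose F (y : R) : C := (gam y)%:C * cexp (s * y%:C).
pose f (y : R) : C := s * F y - (gam y)%:C * cexp ((s + 1) * y%:C).
have fE (y : R) : f y = (gam y)%:C * (s * cexp (s * y%:C)) - (expR y * gam y)%:C * cexp (s * y%:C).
  by rewrite /f /F mulrDl mul1r cexpD cexp_real rmorphM /=; ring.
have dre (y : R) : is_derive y 1 (fun x => complex.Re (F x)) (complex.Re (f y)).
  rewrite (_ : (fun x => _) = gam * (fun x => complex.Re (cexp (s * x%:C)))); last first.
    by apply/funext => x; rewrite cReMr.
  have [d1 _] := is_derive_cexp_line s y; have d2 := is_derive_gam y.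
  have -> : complex.Re (f y) = gam y * complex.Re (s * cexp (s * y%:C))
      - expR y * gam y * complex.Re (cexp (s * y%:C)).
    by rewrite fE cReB (cReMr (gam y)) (cReMr (expR y * gam y)).
  apply: is_derive_eq; rewrite -[LHS]/(gam y * complex.Re (s * cexp (s * y%:C))
    + complex.Re (cexp (s * y%:C)) * - (expR y * gam y)); ring.
have dim (y : R) : is_derive y 1 (fun x => complex.Im (F x)) (complex.Im (f y)).
  rewrite (_ : (fun x => _) = gam * (fun x => complex.Im (cexp (s * x%:C)))); last first.
    by apply/funext => x; rewrite cImMr.
  have [_ d1] := is_derive_cexp_line s y; have d2 := is_derive_gam y.
  have -> : complex.Im (f y) = gam y * complex.Im (s * cexp (s * y%:C))
      - expR y * gam y * complex.Im (cexp (s * y%:C)).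
    by rewrite fE cImB (cImMr (gam y)) (cImMr (expR y * gam y)).
  apply: is_derive_eq; rewrite -[LHS]/(gam y * complex.Im (s * cexp (s * y%:C))
    + complex.Im (cexp (s * y%:C)) * - (expR y * gam y)); ring.
have cabsF (y : R) : cabs (F y) = gam y * expR (complex.Re s * y).
  by rewrite /F cabsM cabs_real cabs_cexp_line ger0_norm ?gam_ge0.
have [l1 l2] := cvg_gam_line s0.
have hF1 : F n.+1%:R @[n --> \oo] --> (0 : C).
  apply/ccvgP => e e0; move/rcvgP/(_ _ e0): l1; apply: filterS => n.
  by rewrite !subr0 cabsF; apply: le_lt_trans; exact: ler_norm.
have hF2 : F (- n.+1%:R) @[n --> \oo] --> (0 : C).
  apply/ccvgP => e e0; move/rcvgP/(_ _ e0): l2; apply: filterS => n.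
  by rewrite !subr0 cabsF; apply: le_lt_trans; exact: ler_norm.
have /ccvg_ReIm[/= hr1 hi1] := hF1; have /ccvg_ReIm[/= hr2 hi2] := hF2.
have cRe z : continuous (fun y : R => gam y * complex.Re (cexp (z * y%:C))).
  by move=> y; apply: cvgM; [exact: continuous_gam|exact: continuous_Re_cexp_line].
have cIm z : continuous (fun y : R => gam y * complex.Im (cexp (z * y%:C))).
  by move=> y; apply: cvgM; [exact: continuous_gam|exact: continuous_Im_cexp_line].
have ccf : ccont f.
  split.
    rewrite (_ : (fun y => _) = fun y => complex.Re s * (gam y * complex.Re (cexp (s * y%:C)))
      - complex.Im s * (gam y * complex.Im (cexp (s * y%:C))) - gam y * complex.Re (cexp ((s + 1) * y%:C))).
      move=> y; apply: cvgB; last exact: cRe.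
      by apply: cvgB; apply: cvgMl_tmp; [exact: cRe|exact: cIm].
    by apply/funext => y; rewrite /f cReB (cReM s) /F !(cReMr (gam y)) !(cImMr (gam y)).
  rewrite (_ : (fun y => _) = fun y => complex.Re s * (gam y * complex.Im (cexp (s * y%:C)))
    + complex.Im s * (gam y * complex.Re (cexp (s * y%:C))) - gam y * complex.Im (cexp ((s + 1) * y%:C))).
    move=> y; apply: cvgB; last exact: cIm.
    by apply: cvgD; apply: cvgMl_tmp; [exact: cIm|exact: cRe].
  by apply/funext => y; rewrite /f cImB (cImM s) /F !(cReMr (gam y)) !(cImMr (gam y)).
have if_ : cintegrable f.
  rewrite (_ : f = fun y => s * F y + (-1) * ((gam y)%:C * cexp ((s + 1) * y%:C))).
    by apply: cintegrableD; apply: cintegrableZ.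
  by apply/funext => y; rewrite /f mulN1r.
have z0 : cint f = 0.
  have [ir ii] := if_; have [cr ci] := ccf; rewrite /cint.
  by rewrite (rint_total_deriv cr dre ir hr1 hr2) (rint_total_deriv ci dim ii hi1 hi2).
apply/esym/eqP; rewrite -subr_eq0 -[X in _ == X]z0 /f cintB //; last exact: cintegrableZ.
by rewrite cintZ.
Qed.

Lemma Gint_rec_prod s n : 0 < complex.Re s -> Gint (s + n%:R) = \prod_(k < n) (s + k%:R) * Gint s.
Proof.
move=> s0; elim: n => [|n IH]; first by rewrite addr0 big_ord0 mul1r.
rewrite -[in LHS]addn1 natrD addrA Gint_rec; last by rewrite cReD natrCE /= ltr_wpDr // ler0n.
by rewrite IH big_ord_recr /= mulrA [X in _ = X * _]mulrC.
Qed.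

Lemma Gint_real (x : R) : 0 < x -> Gint x%:C = (rint (fun y => gam y * expR (x * y)))%:C.
Proof.
move=> x0; have e (y : R) : (gam y)%:C * cexp (x%:C * y%:C) = (gam y * expR (x * y))%:C.
  by rewrite -rmorphM cexp_real rmorphM.
apply: eqCplx; rewrite /Gint /mellin (funext e) /cint //=.
by rewrite /rint Rintegral_cst //= mul0r.
Qed.

Lemma gam_integrable (x : R) : 0 < x -> rintegrable (fun y => gam y * expR (x * y)).
Proof.
move=> x0; have [h _] := @Gint_integrable x%:C x0.
rewrite (_ : (fun y => _) = (fun y : R => complex.Re ((gam y)%:C * cexp (x%:C * y%:C)))) //.
by apply/funext => y; rewrite cReMr -rmorphM cexp_real.
Qed.

Lemma gam_rec (x : R) : 0 < x ->
  rint (fun y => gam y * expR ((x + 1) * y)) = x * rint (fun y => gam y * expR (x * y)).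
Proof.
move=> x0; have := @Gint_rec x%:C x0; rewrite -[1]/(1%:C) -rmorphD !Gint_real ?addr_gt0 //.
by rewrite -rmorphM => -[].
Qed.

Lemma gam_int_gt0 (x : R) : 0 < x -> 0 < rint (fun y => gam y * expR (x * y)).
Proof.
move=> x0; pose c : R := gam 1; have c0 : 0 < c by exact: expR_gt0.
pose b : R -> R := fun y => \1_(`[0, 1]%classic : set R) y * c.
have bl (y : R) : b y <= gam y * expR (x * y).
  rewrite /b indicE mem_setE in_itv /=; have [/andP[y0 y1]|_] := boolP (0 <= y <= 1); last first.
    by rewrite mul0r mulr_ge0 ?expR_ge0.
  rewrite mul1r; apply: (@le_trans _ _ (gam y)); first by rewrite ler_expR lerN2 ler_expR.
  by rewrite ler_peMr ?expR_ge0 // -[1](@expR0 R) ler_expR mulr_ge0 // ltW.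
have b0 (y : R) : 0 <= b y by rewrite /b indicE; case: (y \in _); rewrite ?mul1r ?mul0r // ltW.
have ig := gam_integrable x0.
have ib : rintegrable b.
  apply: (rintegrable_le _ ig); last by move=> y; rewrite ger0_norm.
  by apply: measurable_funM; [exact: measurable_indic|exact: measurable_cst].
apply: lt_le_trans (le_rint ib ig bl).
have dl (y : R) : is_derive y 1 (fun u : R => c * u) c.
  rewrite (_ : (fun u => c * u) = c \*: (id : R -> R)); last by [].
  by apply: is_derive_eq; rewrite -[LHS]/(c * 1) mulr1.
rewrite /b (@rint_interval_deriv R (fun u : R => c * u) (fun=> c) 0 1) ?ltr01 //; last first.
  exact: cst_continuous.
by rewrite mulr0 mulr1 subr0.
Qed.

End GammaIntegral.

Section GammaReciprocal.
Context {R : realType}.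
Local Notation C := (Cplx R).
Implicit Types (s a z : C).

Lemma cintegral_cpow (f : R -> R) (w : C) : {in `]0, +oo[, continuous f} ->
  cintegral (fun x => (f x)%:C * cpow x w) =
  cint (fun y => (expR y * f (expR y))%:C * cexp (w * y%:C)).
Proof.
move=> cf; rewrite cintegral_expR.
- by apply: eq_cint => y; rewrite /cpow expRK rmorphM mulrA.
- move=> x x0; rewrite (_ : (fun x => _) = fun x => f x * complex.Re (cexp (w * (ln x)%:C))).
    apply: cvgM; first exact: cf.
    apply: (@continuous_comp _ _ _ (@ln R) (fun y => complex.Re (cexp (w * y%:C)))).
      by apply: continuous_ln; move: x0; rewrite in_itv /= andbT.
    exact: continuous_Re_cexp_line.
  by apply/funext => u; rewrite cReMr.
- move=> x x0; rewrite (_ : (fun x => _) = fun x => f x * complex.Im (cexp (w * (ln x)%:C))).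
    apply: cvgM; first exact: cf.
    apply: (@continuous_comp _ _ _ (@ln R) (fun y => complex.Im (cexp (w * y%:C)))).
      by apply: continuous_ln; move: x0; rewrite in_itv /= andbT.
    exact: continuous_Im_cexp_line.
  by apply/funext => u; rewrite cImMr.
Qed.

Lemma cintegral_expRN (s : C) :
  cintegral (fun x => (expR (- x))%:C * cpow x (s - 1)) = Gint s.
Proof.
rewrite (@cintegral_cpow (fun x => expR (- x))).
  apply: eq_cint => y; rewrite mulrBl cexpB mul1r cexp_real rmorphM /=.
  have e0 : (expR y)%:C != 0 :> C by rewrite -cexp_real cexp_neq0.
  by rewrite -mulrA mulrC -!mulrA mulVf // mulr1.
move=> x _; apply: (@continuous_cmp R (@expR R)); first exact: continuous_expR.
exact: opp_continuous.
Qed.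

(* If Gint a = 0 then Gint (a + n) = 0 for all n, whereas Gint (a + n) / n^a is close
   to Gint n: under the Gamma(n) law x/n has mean 1 and variance 1/n, and
   |u^a - 1| <= K |u - 1|. *)
Lemma Gint_neq0_strip a : 0 < complex.Re a <= 1 -> Gint a != 0.
Proof.
move=> /[dup] sa /andP[s0 _]; apply/eqP => h0.
pose K : R := 1 + 4 * (complex.Im a / complex.Re a) ^+ 2.
have K0 : 0 < K by rewrite ltr_wpDr // mulr_ge0 // sqr_ge0.
(* K/n < 1/4 makes the final bound 2 (1/4 + K/n) G(n) smaller than G(n); the factor 2 is that of
   [cabs_cint_le]. *)
pose n := (Num.truncn (4 * K)).+1; pose N : R := n%:R.
have N0 : 0 < N by rewrite ltr0n.
have Kn : 4 * K < N by exact: truncnS_gt.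
pose l := ln N; pose G x := rint (fun y : R => gam y * expR (x * y)).
have el : expR l = N by rewrite /l lnK.
have eG1 : G (N + 1) = N * G N by exact: gam_rec.
have N1 : 0 < N + 1 by rewrite addr_gt0.
have eG2 : G (N + 1 + 1) = (N + 1) * (N * G N) by rewrite -eG1; exact: gam_rec.
have GN : 0 < G N by exact: gam_int_gt0.
have Nre : 0 < complex.Re (N%:C : C) by [].
have aN : 0 < complex.Re (a + N%:C) by rewrite cReD addr_gt0.
pose h (y : R) : C := cexp (- a * l%:C) * ((gam y)%:C * cexp ((a + N%:C) * y%:C)) - (gam y)%:C * cexp (N%:C * y%:C).
have hE y : h y = (gam y * expR (N * y))%:C * (cexp (a * (y - l)%:C) - 1).
  rewrite /h mulrBr mulr1 [(gam y * _)%:C]rmorphM /= -(cexp_real (N * y)) [(N * y)%:C]rmorphM /=; congr (_ - _).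
  have -> : a * (y - l)%:C = - a * l%:C + a * y%:C by rewrite rmorphB /=; ring.
  by rewrite [(a + _) * _]mulrDl !cexpD; ring.
have ih : cint h = - (G N)%:C.
  rewrite /h cintB; [|by apply: cintegrableZ; exact: Gint_integrable|exact: Gint_integrable].
  rewrite cintZ; last exact: Gint_integrable.
  rewrite -[cint (fun y => _ * cexp ((a + _) * _))]/(Gint (a + N%:C)) -[cint _]/(Gint N%:C).
  by rewrite -natrCE Gint_rec_prod // h0 mulr0 mulr0 sub0r natrCE Gint_real.
have i0 := gam_integrable N0; have i1 := gam_integrable N1.
have i2 : rintegrable (fun y => gam y * expR ((N + 1 + 1) * y)) by apply: gam_integrable; rewrite addr_gt0.
(* The Gamma(n) weight times 1/4 + K (e^y/n - 1)^2, expanded so that the recurrence of Gamma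
   computes its integral. It dominates |h| because z <= z^2 + 1/4. *)
pose g y := (4^-1 + K) * (gam y * expR (N * y)) + (- (2 * K / N)) * (gam y * expR ((N + 1) * y))
  + K / N ^+ 2 * (gam y * expR ((N + 1 + 1) * y)).
have ig : rintegrable g by apply: rintegrableD; [apply: rintegrableD|]; apply: rintegrableZ.
have Ng : rint g = 4^-1 * G N + K * G N / N.
  rewrite /g rintD; [|by apply: rintegrableD; apply: rintegrableZ|exact: rintegrableZ].
  rewrite rintD; [|exact: rintegrableZ|exact: rintegrableZ].
  by rewrite !rintZ // -!/(G _) eG2 eG1; field; rewrite gt_eqF.
have mh : cmeas h.
  rewrite (_ : h = fun y => cexp (- a * l%:C) * ((gam y)%:C * cexp ((a + N%:C) * y%:C)) + (-1) * ((gam y)%:C * cexp (N%:C * y%:C))).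
    have mg : cmeas (fun y : R => (gam y)%:C).
      by apply: cmeas_real; apply: continuous_measurable_fun; exact: continuous_gam.
    apply: cmeasD; apply: cmeasM; try exact: cmeas_cst; apply: cmeasM => //; exact: cmeas_cexp_line.
  by apply/funext => y; rewrite /h mulN1r.
have hg y : cabs (h y) <= g y.
  rewrite hE cabsM cabs_real ger0_norm ?mulr_ge0 ?expR_ge0 //.
  have := cabs_cexp_sub1 (y - l) sa; rewrite -/K; set z := cabs _ => hz.
  have -> : g y = gam y * expR (N * y) * (4^-1 + K * (expR (y - l) - 1) ^+ 2).
    have e1 : expR ((N + 1) * y) = expR (N * y) * expR y by rewrite (mulrDl N) (mul1r y) expRD.
    have e2 : expR ((N + 1 + 1) * y) = expR (N * y) * expR y * expR y.
      by rewrite (mulrDl (N + 1)) (mul1r y) expRD e1.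
    rewrite /g expRB el e1 e2; move: (expR (N * y)) (expR y) (gam y) (gt_eqF N0) => E1 E2 E3.
    by clearbody K N => N1'; field; rewrite N1'.
  apply: ler_wpM2l; first by rewrite mulr_ge0 ?expR_ge0.
  have : 0 <= (z - 2^-1) ^+ 2 by exact: sqr_ge0.
  have -> : (z - 2^-1) ^+ 2 = z ^+ 2 - z + 4^-1 by field.
  by lra.
have := cabs_cint_le mh ig hg; rewrite ih cabsN cabs_real gtr0_norm // Ng.
have : K * G N / N < 4^-1 * G N by rewrite ltr_pdivrMr // mulrAC ltr_pM2r //; lra.
by lra.
Qed.

Lemma Gint_neq0 a : 0 < complex.Re a -> Gint a != 0.
Proof.
have main m : forall s : C, 0 < complex.Re s -> complex.Re s <= m.+1%:R -> Gint s != 0.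
  elim: m => [|m IH] s s0 sm; first by apply: Gint_neq0_strip; rewrite s0.
  have [s1|s1] := leP (complex.Re s) m.+1%:R; first exact: IH.
  have s2 : 0 < complex.Re (s - 1).
    by rewrite cReB /= subr_gt0; apply: le_lt_trans s1; rewrite ler1n.
  rewrite -(subrK 1 s) Gint_rec // mulf_neq0 //.
    by apply: contraTneq s2 => ->; rewrite ltxx.
  by apply: IH => //; rewrite cReB /= lerBlDr -[X in _ <= _ + X]/(1%:R) -natrD addn1.
move=> a0; apply: (main (Num.truncn (complex.Re a))) => //.
by apply: ltW; exact: truncnS_gt.
Qed.

Lemma Gamma_Gint s : 0 < complex.Re s -> Gamma s = Gint s.
Proof.
move=> s0; rewrite /Gamma s0 big_ord0 divr1 -cintegral_expRN.
by congr cintegral; apply/funext => x; rewrite addr0.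
Qed.

(* The value of 1 / Gamma s whenever Re s + n > 0; at the poles of Gamma both sides
   are 0, the inverse of 0 being 0. *)
Definition rgamma_prod n s : C := \prod_(k < n) (s + k%:R) / Gint (s + n%:R).

Lemma Re_natD s n : complex.Re (s + n%:R) = complex.Re s + n%:R.
Proof. by rewrite cReD natrCE. Qed.

Lemma rgamma_prod_shift n m s : 0 < complex.Re s + n%:R -> rgamma_prod (n + m)%N s = rgamma_prod n s.
Proof.
move=> h; have h' : 0 < complex.Re (s + n%:R) by rewrite Re_natD.
rewrite /rgamma_prod natrD addrA (Gint_rec_prod m h') big_split_ord /=.
have -> : \prod_(i < m) (s + (n + i)%N%:R) = \prod_(k < m) (s + n%:R + k%:R) :> C.
  by apply: eq_bigr => i _; rewrite natrD addrA.
have p0 : \prod_(k < m) (s + n%:R + k%:R) != 0 :> C.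
  rewrite prodf_seq_neq0; apply/allP => k _; apply/implyP => _.
  have : 0 < complex.Re (s + n%:R + k%:R) by rewrite Re_natD ltr_wpDr.
  by apply: contraTneq => ->; rewrite ltxx.
by rewrite invfM mulrA mulfK.
Qed.

Lemma rgammaE n s : 0 < complex.Re s + n%:R -> (Gamma s)^-1 = rgamma_prod n s.
Proof.
move=> h; rewrite /Gamma; set m := (if _ then _ else _).
have hm : 0 < complex.Re s + m%:R.
  rewrite /m; case: ifPn => [s0|_]; first by rewrite addr0.
  by rewrite -ltrBlDl sub0r; exact: truncnS_gt.
rewrite -(@rgamma_prod_shift n m) // addnC rgamma_prod_shift // /rgamma_prod.
by rewrite (_ : cintegral _ = Gint (s + m%:R)) ?cintegral_expRN // invfM invrK mulrC.
Qed.

Lemma analytic_prod_shift n a : analytic_at (fun s : C => \prod_(k < n) (s + k%:R) : C) a.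
Proof.
elim: n => [|n IH].
  by apply: (@eq_analytic _ (fun=> 1)) (analytic_cst _ _) => z; rewrite big_ord0.
have h := analytic_add (analytic_id a) (analytic_cst (n%:R : C) a).
by apply: eq_analytic (analytic_mul IH h) => z; rewrite big_ord_recr.
Qed.

(** A single n with Re a + n > 0 serves a whole neighbourhood of a, and there the denominator [Gint]
    has no zero. *)
Lemma analytic_rgamma a : analytic_at (fun s : C => (Gamma s)^-1) a.
Proof.
pose n := (Num.truncn (- complex.Re a)).+1.
have h : 0 < complex.Re a + n%:R by rewrite -ltrBlDl sub0r; exact: truncnS_gt.
apply: (@analytic_ext _ (rgamma_prod n)).
  apply/cnbhsP; exists (complex.Re a + n%:R) => // z hz; rewrite (@rgammaE n) //.
  have := le_lt_trans (Re_le_cabs _) hz; rewrite cReB ltr_norml => /andP[hz1 _].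
  by move: hz1; lra.
apply: analytic_mul; first exact: analytic_prod_shift.
have e : a + n%:R = 1 * a + n%:R by rewrite mul1r.
have h1 : analytic_at (fun z : C => Gint (1 * z + n%:R)) a.
  by apply: analytic_affine; rewrite -e; apply: analytic_Gint; rewrite Re_natD.
have := analytic_inv h1; rewrite -e => /(_ (Gint_neq0 _)).
rewrite Re_natD => /(_ h); apply: eq_analytic => z; by rewrite mul1r.
Qed.

Lemma rgamma_rec s : (Gamma s)^-1 = s * (Gamma (s + 1))^-1.
Proof.
pose n := (Num.truncn (- complex.Re s)).+1.
have h : 0 < complex.Re s + n%:R by rewrite -ltrBlDl sub0r; exact: truncnS_gt.
have h1 : 0 < complex.Re s + n.+1%:R by rewrite -[n.+1%:R]natr1 addrA ltr_wpDr.
rewrite (rgammaE h1) (@rgammaE n); last by rewrite cReD /= addrAC ltr_wpDr.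
rewrite /rgamma_prod big_ord_recl /= addr0 -mulrA; congr (_ * _).
congr (_ / Gint _); last by rewrite -addrA -[n.+1%:R]natr1 [n%:R + 1]addrC.
by apply: eq_bigr => i _; rewrite /bump /= natrD addrA.
Qed.

End GammaReciprocal.

(** * Continuation of Z and zeta *)

Section ThetaLine.
Context {R : realType}.
Local Notation C := (Cplx R).
Implicit Types (x y b : R) (s a z : C).

(** The factor c of the mean value bound c e^(-cd) is traded for 2/d at the cost of half the decay.
    Summed over c = pi n^2, the constants again form a theta series, at d/2. *)
Lemma expRN_lipschitz (c d x y : R) : 0 <= c -> 0 < d -> d <= x -> x <= y ->
  `|expR (- (c * x)) - expR (- (c * y))| <= 2 / d * expR (- (c * (d / 2))) * (y - x).
Proof.
move=> c0 d0 dx xy; rewrite ger0_norm ?subr_ge0 ?ler_expR ?lerN2 ?ler_wpM2l //.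
have -> : expR (- (c * y)) = expR (- (c * x)) * expR (- (c * (y - x))).
  by rewrite -expRD; congr expR; ring.
rewrite -[X in X - _]mulr1 -mulrBr.
have h1 : 1 - expR (- (c * (y - x))) <= c * (y - x).
  by have := expR_ge1Dx (- (c * (y - x))); lra.
have yx : 0 <= y - x by rewrite subr_ge0.
have h2 : expR (- (c * x)) * (1 - expR (- (c * (y - x)))) <= expR (- (c * d)) * (c * (y - x)).
  apply: ler_pM; rewrite ?expR_ge0 // ?subr_ge0 ?expR_le1 ?oppr_le0 ?mulr_ge0 //.
  by rewrite ler_expR lerN2 ler_wpM2l.
apply: le_trans h2 _; rewrite mulrA; apply: ler_wpM2r => //.
have e : expR (- (c * d)) = expR (- (c * (d / 2))) * expR (- (c * (d / 2))).
  by rewrite -expRD; congr expR; field.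
have h3 : c * (d / 2) * expR (- (c * (d / 2))) <= 1.
  rewrite expRN ler_pdivrMr ?expR_gt0 // mul1r.
  by apply: le_trans (expR_ge1Dx _); rewrite lerDr.
have -> : 2 / d * expR (- (c * (d / 2))) = expR (- (c * (d / 2))) * (2 / d) by rewrite mulrC.
rewrite e -mulrA; apply: ler_wpM2l; first exact: expR_ge0.
rewrite ler_pdivlMr //; move: h3; set E := expR _ => h3.
have -> : E * c * d = 2 * (c * (d / 2) * E) by field.
by lra.
Qed.

Lemma theta_lipschitz (d x y : R) : 0 < d -> d <= x -> x <= y ->
  `|theta x - theta y| <= 2 / d * (theta (d / 2) - 1) * (y - x).
Proof.
move=> d0 dx xy; have x0 : 0 < x by apply: lt_le_trans dx.
have y0 : 0 < y by apply: lt_le_trans xy.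
have d20 : 0 < d / 2 by rewrite divr_gt0.
have hd := cvg_theta_series d20.
have hS N : `|series (theta_term x) N - series (theta_term y) N| <= 2 / d * series (theta_term (d / 2)) N * (y - x).
  rewrite /series /= -sumrB -mulrA mulr_suml mulr_sumr; apply: le_trans (ler_norm_sum _ _ _) _.
  apply: ler_sum => n _; rewrite /theta_term !mulNr mulrA; apply: expRN_lipschitz => //.
  by rewrite mulr_ge0 ?pi_ge0 // exprn_ge0.
have l1 : (`|series (theta_term x) N - series (theta_term y) N| : R) @[N --> \oo]
    --> `|(theta x - 1) / 2 - (theta y - 1) / 2|.
  by apply: cvg_norm; apply: cvgB; exact: cvg_theta_series.
have l2 : 2 / d * series (theta_term (d / 2)) N * (y - x) @[N --> \oo]
    --> 2 / d * ((theta (d / 2) - 1) / 2) * (y - x).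
  by apply: cvgM; [apply: cvgMl_tmp; exact: hd|exact: cvg_cst].
have := ler_cvg_to l1 l2 (nearW _ hS).
have -> : (theta x - 1) / 2 - (theta y - 1) / 2 = 2^-1 * (theta x - theta y) by field.
rewrite normrM gtr0_norm ?invr_gt0 // => h.
have -> : 2 / d * (theta (d / 2) - 1) * (y - x) = 2 * (2 / d * ((theta (d / 2) - 1) / 2) * (y - x)) by field; rewrite gt_eqF.
rewrite -ler_pdivrMl //; exact: h.
Qed.

Lemma continuous_theta x : 0 < x -> {for x, continuous (@theta R)}.
Proof.
move=> x0; apply/rcvgP => e e0.
pose d := x / 2; have d0 : 0 < d by rewrite divr_gt0.
pose K := 2 / d * (theta (d / 2) - 1).
have K0 : 0 <= K.
  apply: mulr_ge0; first by rewrite divr_ge0 // ltW.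
  by rewrite subr_ge0 theta_ge1 // divr_gt0.
have K1 : 0 < K + 1 by lra.
apply/nbhs_normP; exists (Num.min d (e / (K + 1))) => /=.
  by rewrite lt_min d0 divr_gt0.
move=> y; rewrite /ball_ /= lt_min => /andP[h1 h2].
have dy : d <= y by move: h1; rewrite ltr_norml => /andP[_]; rewrite /d; lra.
have dx : d <= x by rewrite /d; lra.
have key : `|theta y - theta x| <= K * `|x - y|.
  have [xy|yx] := leP x y.
    by rewrite distrC (distrC x) [`|y - x|]ger0_norm ?subr_ge0 //; exact: theta_lipschitz.
  by rewrite [`|x - y|]ger0_norm ?subr_ge0 ?(ltW yx) //; apply: theta_lipschitz => //; exact: ltW.
apply: le_lt_trans key _; apply: (@le_lt_trans _ _ ((K + 1) * `|x - y|)).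
  by rewrite ler_wpM2r // lerDl.
by move: h2; rewrite ltr_pdivlMr // mulrC.
Qed.

Lemma theta_sub1_le x : 1 <= x -> theta x - 1 <= 4 * expR (- (pi * x)).
Proof.
move=> x1; have x0 : 0 < x by apply: lt_le_trans x1.
pose q := expR (- (pi * x)); have q0 : 0 <= q := expR_ge0 _.
have q2 : q <= 2^-1.
  have h : 2 <= expR (pi * x).
    apply: le_trans (expR_ge1Dx _); rewrite -[X in X <= _]/(1 + 1) lerD2l.
    apply: (@le_trans _ _ (pi * 1)); last by rewrite ler_wpM2l ?pi_ge0.
    by rewrite mulr1; apply: le_trans (pi_ge2 R); rewrite ler1n.
  by rewrite /q expRN lef_pV2 // posrE ?expR_gt0 ?ltr0n.
have hS N : series (theta_term x) N <= 2 * q.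
  apply: (@le_trans _ _ (\sum_(0 <= k < N) q * q ^+ k)).
    by apply: ler_sum => k _; exact: theta_term_geo.
  apply: le_trans (@sum_geo_le R q q 0 N q0 _) _; first by rewrite q0; lra.
  by rewrite expr0 mulr1 ler_pdivrMr; [|lra]; rewrite -mulrA mulrCA ler_peMr //; lra.
have : (theta x - 1) / 2 <= 2 * q by exact: ler_cvg_to (cvg_theta_series x0) (cvg_cst (2 * q)) (nearW _ hS).
rewrite ler_pdivrMr // => h; apply: le_trans h _.
by rewrite le_eqVlt; apply/orP; left; apply/eqP; rewrite -/q; ring.
Qed.

Definition theta_line y : R := theta (expR (2 * y)).
Definition sqrt_theta_line y : R := Num.sqrt (theta_line y).

Lemma theta_line_ge1 y : 1 <= theta_line y.
Proof. by rewrite theta_ge1 // expR_gt0. Qed.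

Lemma sqrt_theta_line_sqr y : sqrt_theta_line y ^+ 2 = theta_line y.
Proof. by rewrite sqr_sqrtr // (le_trans ler01) // theta_line_ge1. Qed.

Lemma sqrt_theta_line_ge1 y : 1 <= sqrt_theta_line y.
Proof. by rewrite -sqrtr1 ler_wsqrtr // theta_line_ge1. Qed.

Lemma continuous_theta_line : continuous theta_line.
Proof.
move=> y; apply: (@continuous_comp _ _ _ (fun y => expR (2 * y)) (@theta R)).
  exact: (@continuous_cmp _ (@expR R) _ (@continuous_expR R) (@continuous_scale_line _ _)).
by apply: continuous_theta; exact: expR_gt0.
Qed.

Lemma continuous_sqrt_theta_line : continuous sqrt_theta_line.
Proof. by apply: continuous_cmp; [exact: sqrt_continuous|exact: continuous_theta_line]. Qed.

Lemma theta_lineN y : theta_line (- y) = expR (1 * y) * theta_line y.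
Proof.
rewrite /theta_line mulrN expRN theta_inv ?expR_gt0 // mul1r; congr (_ * _).
by rewrite mulrC expRM_natr sqrtr_sqr ger0_norm ?expR_ge0.
Qed.

Lemma sqrt_theta_lineN y : sqrt_theta_line (- y) = expR (2^-1 * y) * sqrt_theta_line y.
Proof.
rewrite /sqrt_theta_line theta_lineN sqrtrM ?expR_ge0 //; congr (_ * _).
have -> : 1 * y = 2^-1 * y * 2%:R by field.
by rewrite expRM_natr sqrtr_sqr ger0_norm ?expR_ge0.
Qed.

Lemma theta_line_fast b : exists D, forall y, 0 <= y -> `|theta_line y - 1| <= D * expR (- (b * y)).
Proof.
pose n := (Num.truncn b).+1; have [_ [D hD]] := @decay_gam R n.
exists (4 * D) => y y0; rewrite ger0_norm ?subr_ge0 ?theta_line_ge1 //.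
have e1 : 1 <= expR (2 * y) by rewrite -[1](@expR0 R) ler_expR mulr_ge0.
have D0 : 0 <= D by have := (hD 0).1; rewrite mul0r oppr0 expR0 mulr1; apply: le_trans.
apply: le_trans (theta_sub1_le e1) _; rewrite -mulrA ler_wpM2l //.
apply: (@le_trans _ _ (gam y)).
  rewrite ler_expR lerN2; apply: (@le_trans _ _ (expR (2 * y))).
    by rewrite ler_expR; lra.
  by rewrite ler_peMl ?expR_ge0 //; apply: le_trans (pi_ge2 R); rewrite ler1n.
apply: le_trans (ler_norm _) _; apply: le_trans (hD y).2 _; apply: ler_wpM2l => //.
by rewrite ler_expR lerN2 ler_wpM2r // ltW // truncnS_gt.
Qed.

Lemma sqrt_theta_line_le y : sqrt_theta_line y - 1 <= theta_line y - 1.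
Proof.
rewrite lerD2r -sqrt_theta_line_sqr expr2 ler_peMl ?sqrt_theta_line_ge1 //.
by apply: le_trans (sqrt_theta_line_ge1 y).
Qed.

Lemma sqrt_theta_line_fast b :
  exists D, forall y, 0 <= y -> `|sqrt_theta_line y - 1| <= D * expR (- (b * y)).
Proof.
have [D h] := theta_line_fast b; exists D => y y0; apply: le_trans (h y y0).
rewrite ger0_norm ?subr_ge0 ?sqrt_theta_line_ge1 // ger0_norm ?subr_ge0 ?theta_line_ge1 //.
exact: sqrt_theta_line_le.
Qed.

Definition theta_tail s : C := mellin (fun y => ind0 y * (theta_line y - 1)) s.
Definition sqrt_theta_tail s : C := mellin (fun y => ind0 y * (sqrt_theta_line y - 1)) s.

Lemma analytic_theta_tail s : analytic_at theta_tail s.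
Proof.
apply: (analytic_mellin (decay_tail continuous_theta_line theta_line_fast (complex.Re s - 1) (complex.Re s + 1))).
by apply/andP; split; lra.
Qed.

Lemma analytic_sqrt_theta_tail s : analytic_at sqrt_theta_tail s.
Proof.
apply: (analytic_mellin (decay_tail continuous_sqrt_theta_line sqrt_theta_line_fast (complex.Re s - 1) (complex.Re s + 1))).
by apply/andP; split; lra.
Qed.

Lemma analytic_reflect (f : C -> C) (d a : C) : (forall s, analytic_at f s) -> analytic_at (fun s => f (d - s)) a.
Proof.
move=> hf; have := @analytic_affine R (-1) d f a (hf _).
by apply: eq_analytic => z; rewrite mulN1r addrC.
Qed.

Lemma analytic_inv_sub (d a : C) : a != d -> analytic_at (fun s : C => (s - d)^-1) a.
Proof.
move=> h; apply: (@analytic_inv R (fun s => s - d)); last by rewrite subr_eq0.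
by apply: analytic_sub; [exact: analytic_id|exact: analytic_cst].
Qed.

Lemma simple_pole (A B F : C -> C) a : analytic_at A a -> analytic_at B a -> A a != 0 ->
  (forall z, F z = A z / (z - a) + B z) -> pole_at F a.
Proof.
move=> hA hB A0 hF; exists 1%N, (fun z => A z + (z - a) * B z); split.
- exact: ltn0Sn.
- apply: analytic_add; first exact: hA.
  apply: analytic_mul; last exact: hB.
  by apply: analytic_sub; [exact: analytic_id|exact: analytic_cst].
- by rewrite subrr mul0r addr0.
- apply/cdnbhsP; exists 1 => // z /andP[z0 _].
  have za : z - a != 0 by rewrite -cabs_gt0.
  by rewrite hF expr1 mulrDl [(z - a) * _]mulrC mulfK.
Qed.

(** The candidate for the continuation of [Z_half]: the right side of [mellin_fold] for k = 1/2. *)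
Definition Z_ext s : C := sqrt_theta_tail s + sqrt_theta_tail ((2^-1)%:C - s) + (s - (2^-1)%:C)^-1 - s^-1.

Lemma analytic_Z_ext s : s != 0 -> s != (2^-1)%:C -> analytic_at Z_ext s.
Proof.
move=> s0 s1; apply: analytic_sub; last first.
  by apply: analytic_inv; [exact: analytic_id|exact: s0].
apply: analytic_add; last exact: analytic_inv_sub.
apply: analytic_add; first exact: analytic_sqrt_theta_tail.
by apply: analytic_reflect => z; exact: analytic_sqrt_theta_tail.
Qed.

Lemma meromorphic_Z_ext : meromorphic Z_ext.
Proof.
have h2 : (2^-1)%:C != 0 :> C.
  by apply/eqP => /(congr1 (@complex.Re R)) /= /eqP; rewrite invr_eq0 pnatr_eq0.
move=> a; have [->|a0] := eqVneq a 0.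
  right; apply: (@simple_pole (fun=> -1) (fun s => sqrt_theta_tail s + sqrt_theta_tail ((2^-1)%:C - s) + (s - (2^-1)%:C)^-1)).
  - exact: analytic_cst.
  - apply: analytic_add; last by apply: analytic_inv_sub; rewrite eq_sym.
    apply: analytic_add; first exact: analytic_sqrt_theta_tail.
    by apply: analytic_reflect => z; exact: analytic_sqrt_theta_tail.
  - by rewrite oppr_eq0 oner_eq0.
  - by move=> z; rewrite subr0 mulN1r addrC.
have [->|a1] := eqVneq a (2^-1)%:C; last by left; exact: analytic_Z_ext.
right; apply: (@simple_pole (fun=> 1) (fun s => sqrt_theta_tail s + sqrt_theta_tail ((2^-1)%:C - s) - s^-1)).
- exact: analytic_cst.
- apply: analytic_sub; last by apply: analytic_inv; [exact: analytic_id|exact: h2].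
  apply: analytic_add; first exact: analytic_sqrt_theta_tail.
  by apply: analytic_reflect => z; exact: analytic_sqrt_theta_tail.
- exact: oner_neq0.
- by move=> z; rewrite /Z_ext mul1r; ring.
Qed.

Lemma near_Re_gt (c : R) (a : C) : c < complex.Re a -> \forall z \near a, c < complex.Re z.
Proof.
move=> h; apply/cnbhsP; exists (complex.Re a - c); first by rewrite subr_gt0.
move=> z hz; have := le_lt_trans (Re_le_cabs _) hz; rewrite cReB ltr_norml => /andP[h1 _].
by move: h1; lra.
Qed.

Lemma Z_halfE s : s != 0 -> s != (2^-1)%:C -> Z_half s = Z_ext s.
Proof.
move=> s0 s1; apply: (@meromorphic_continuationE R _ _ _ 1).
- by apply: near_Re_gt; rewrite /= invf_lt1 // ltr1n.
- exact: meromorphic_Z_ext.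
- move=> z /= hz; have h2 : (0 : R) < 2^-1 by rewrite invr_gt0.
  rewrite /Z_ext /sqrt_theta_tail.
  rewrite -(mellin_fold h2 continuous_sqrt_theta_line sqrt_theta_lineN sqrt_theta_line_fast hz).
  rewrite (_ : (fun t => _) = fun t => ((Num.sqrt (theta (t ^+ 2)) - 1) / t)%:C * cpow t z).
    rewrite (@cintegral_cpow R (fun t => (Num.sqrt (theta (t ^+ 2)) - 1) / t)).
      apply: eq_cint => y; congr (_%:C * _).
      have e0 : expR y != 0 by rewrite gt_eqF // expR_gt0.
      by rewrite [expR y * _]mulrC divfK // /sqrt_theta_line /theta_line [2 * y]mulrC expRM_natr.
    move=> x; rewrite in_itv /= andbT => x0; apply: cvgM; last by apply: cvgV; [exact: lt0r_neq0|exact: cvg_id].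
    apply: cvgB; last exact: cvg_cst.
    apply: (@continuous_comp _ _ _ (fun t : R => theta (t ^+ 2)) (@Num.sqrt R)); last exact: sqrt_continuous.
    apply: (@continuous_comp _ _ _ (fun t : R => t ^+ 2) (@theta R)); first exact: exprn_continuous.
    by apply: continuous_theta; rewrite exprn_gt0.
  by apply/funext => t; rewrite rmorphM /= fmorphV mulrAC.
- exact: analytic_Z_ext.
Qed.

End ThetaLine.

Section Zeta.
Context {R : realType}.
Local Notation C := (Cplx R).
Implicit Types (x y b : R) (s a z : C).

Let lpi : C := (ln (@pi R))%:C.

(** The folded transform of theta - 1 divided by pi^(-s/2) Gamma(s/2). Its term -1/s is absorbed
    through 1/(s Gamma(s/2)) = 1/(2 Gamma(s/2 + 1)), so that 0 is visibly not a pole and only s = 1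
    remains singular. *)
Definition zeta_ext s : C :=
  cexp (s / 2 * (ln (@pi R))%:C) * ((Gamma (s / 2))^-1 * (theta_tail s + theta_tail (1%:C - s) + (s - 1%:C)^-1)
    - (Gamma (s / 2 + 1))^-1 / 2).

Lemma analytic_half (f : C -> C) a : (forall s, analytic_at f s) -> analytic_at (fun s => f (s / 2)) a.
Proof.
move=> hf; have := @analytic_affine R (2^-1) 0 f a (hf _).
by apply: eq_analytic => z; rewrite addr0 mulrC.
Qed.

Lemma analytic_half_succ (f : C -> C) a : (forall s, analytic_at f s) -> analytic_at (fun s => f (s / 2 + 1)) a.
Proof.
move=> hf; have := @analytic_affine R (2^-1) 1 f a (hf _).
by apply: eq_analytic => z; rewrite [2^-1 * _]mulrC.
Qed.

Lemma analytic_pi_pow a : analytic_at (fun s : C => cexp (s / 2 * (ln (@pi R))%:C) : C) a.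
Proof.
have := @analytic_affine R (lpi / 2) 0 (@cexp R) a (analytic_cexp _).
by apply: eq_analytic => z; rewrite addr0 /lpi; congr cexp; ring.
Qed.

Let A s : C := cexp (s / 2 * (ln (@pi R))%:C) * (Gamma (s / 2))^-1.
Let B s : C := A s * (theta_tail s + theta_tail (1%:C - s))
  - cexp (s / 2 * (ln (@pi R))%:C) * (2^-1 * (Gamma (s / 2 + 1))^-1).

Let analytic_A a : analytic_at A a.
Proof.
apply: analytic_mul; first exact: analytic_pi_pow.
by apply: (@analytic_half (fun s => (Gamma s)^-1)) => z; exact: analytic_rgamma.
Qed.

Let analytic_B a : analytic_at B a.
Proof.
apply: analytic_sub.
  apply: analytic_mul; first exact: analytic_A.
  apply: analytic_add; first exact: analytic_theta_tail.
  by apply: analytic_reflect => z; exact: analytic_theta_tail.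
apply: analytic_mul; first exact: analytic_pi_pow.
apply: analytic_scale.
by apply: (@analytic_half_succ (fun s => (Gamma s)^-1)) => z; exact: analytic_rgamma.
Qed.

Let zeta_extE z : zeta_ext z = A z / (z - 1%:C) + B z.
Proof. by rewrite /zeta_ext /B /A; ring. Qed.

Lemma analytic_zeta_ext s : s != 1%:C -> analytic_at zeta_ext s.
Proof.
move=> s1; apply: (@eq_analytic _ (fun z => A z * (z - 1%:C)^-1 + B z)); first by move=> z; rewrite zeta_extE.
apply: analytic_add; last exact: analytic_B.
by apply: analytic_mul; [exact: analytic_A|exact: analytic_inv_sub].
Qed.

Lemma Re_half s : complex.Re (s / 2) = complex.Re s / 2.
Proof.
have -> : s / 2 = (2^-1)%:C * s by rewrite fmorphV rmorph_nat mulrC.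
by rewrite cReMr mulrC.
Qed.

Lemma meromorphic_zeta_ext : meromorphic zeta_ext.
Proof.
move=> a; have [->|a1] := eqVneq a 1%:C; last by left; exact: analytic_zeta_ext.
right; apply: (@simple_pole R A B); [exact: analytic_A|exact: analytic_B| |exact: zeta_extE].
have h : 0 < complex.Re (1%:C / 2 : C) by rewrite Re_half /= divr_gt0.
by rewrite mulf_neq0 ?cexp_neq0 // invr_neq0 // Gamma_Gint // Gint_neq0.
Qed.

Lemma Gamma_half_zeta_ext s : 0 < complex.Re s -> s != 1%:C ->
  cexp (- (s / 2 * (ln (@pi R))%:C)) * Gamma (s / 2) * zeta_ext s =
  theta_tail s + theta_tail (1%:C - s) + (s - 1%:C)^-1 - s^-1.
Proof.
move=> s0 s1; have h : 0 < complex.Re (s / 2) by rewrite Re_half divr_gt0.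
have G0 : Gamma (s / 2) != 0 by rewrite Gamma_Gint // Gint_neq0.
have sn0 : s != 0 by apply: contraTneq s0 => ->; rewrite ltxx.
have two : (2 : C) != 0 by rewrite natrCE; apply/eqP => -[] /eqP; rewrite pnatr_eq0.
have e : (Gamma (s / 2 + 1))^-1 / 2 = (Gamma (s / 2))^-1 * s^-1.
  by rewrite (rgamma_rec (s / 2)) mulrAC [s / 2 * s^-1]mulrAC divff // mul1r mulrC.
have E0 := cexp_neq0 (s / 2 * (ln (@pi R))%:C).
rewrite /zeta_ext e cexpN -mulrBr.
move: (theta_tail s + _ + _ - s^-1) (Gamma _) G0 (cexp _) E0 => X G G0 E E0.
by rewrite mulrACA mulVf // mul1r mulrA divff // mul1r.
Qed.

(** Every term of theta is [gam] after an affine change of variable, which produces the power (n +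
    1)^(-s) in its Mellin transform. *)
Lemma theta_term_gam y n : theta_term (expR (2 * y)) n = gam (2 * y + (ln pi + 2 * ln n.+1%:R)).
Proof.
rewrite /theta_term /gam; congr expR; rewrite !expRD lnK ?posrE ?pi_gt0 //.
by rewrite [2 * ln _]mulrC expRM_natr lnK ?posrE ?ltr0n //; ring.
Qed.

Lemma mellin_theta_term s n : 0 < complex.Re s ->
  cintegrable (fun y => (2 * theta_term (expR (2 * y)) n)%:C * cexp (s * y%:C)) /\
  mellin (fun y => 2 * theta_term (expR (2 * y)) n) s =
  cexp (- (s / 2 * (ln (@pi R))%:C)) * Gint (s / 2) * cpow n.+1%:R (- s).
Proof.
move=> s0; have h : 0 < complex.Re (s / 2) by rewrite Re_half divr_gt0.
pose l : R := ln pi + 2 * ln n.+1%:R.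
pose H (y : R) : C := (gam y)%:C * cexp (s / 2 * y%:C).
have cH : ccont H.
  split.
    rewrite (_ : (fun y => _) = fun y => gam y * complex.Re (cexp (s / 2 * y%:C))).
      by move=> y; apply: cvgM; [exact: continuous_gam|exact: continuous_Re_cexp_line].
    by apply/funext => y; rewrite (cReMr (gam y)).
  rewrite (_ : (fun y => _) = fun y => gam y * complex.Im (cexp (s / 2 * y%:C))).
    by move=> y; apply: cvgM; [exact: continuous_gam|exact: continuous_Im_cexp_line].
  by apply/funext => y; rewrite (cImMr (gam y)).
have two : (2 : C) != 0 by rewrite natrCE; apply/eqP => -[] /eqP; rewrite pnatr_eq0.
have iH : cintegrable H by exact: Gint_integrable.
have e (y : R) : (2 * theta_term (expR (2 * y)) n)%:C * cexp (s * y%:C) =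
    cexp (- (s / 2 * l%:C)) * ((2%:R)%:C * H (2 * y + l)).
  rewrite theta_term_gam -/l /H.
  have -> : s / 2 * (2 * y + l)%:C = s * y%:C + s / 2 * l%:C.
    by rewrite rmorphD /= rmorphM /= rmorph_nat mulrDr mulrA divfK.
  rewrite cexpD cexpN rmorphM /=; have := cexp_neq0 (s / 2 * l%:C).
  move: (cexp (s / 2 * l%:C)) (cexp (s * y%:C)) (gam _)%:C (2%:R)%:C => E c g d E0.
  have -> : E^-1 * (d * (g * (c * E))) = E^-1 * E * (d * g * c) by ring.
  by rewrite mulVf // mul1r.
have two0 : (0 : R) < 2 by [].
split; first by rewrite (funext e); apply: cintegrableZ; apply: cintegrable_affine.
rewrite /mellin (funext e) cintZ; last exact: cintegrable_affine.
rewrite -(cint_affine _ two0 cH) -[cint H]/(Gint (s / 2)) [RHS]mulrAC; congr (_ * _).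
rewrite /cpow -cexpD; congr cexp; rewrite /l rmorphD rmorphM /= rmorph_nat mulrDr opprD mulrA divfK //.
by rewrite mulNr.
Qed.

(** Riemann's computation: theta - 1 is integrated term by term. Its terms are positive, so theta -
    1 itself dominates the partial sums. *)
Lemma cvg_dirichlet s : 1 < complex.Re s ->
  \sum_(1 <= n < N) cpow n%:R (- s) @[N --> \oo] --> zeta_ext s.
Proof.
move=> s1; have s0 : 0 < complex.Re s by apply: lt_trans s1.
have sn1 : s != 1%:C by apply: contraTneq s1 => ->; rewrite ltxx.
have h : 0 < complex.Re (s / 2) by rewrite Re_half divr_gt0.
pose P : C := cexp (- (s / 2 * (ln (@pi R))%:C)) * Gint (s / 2).
have P0 : P != 0 by rewrite mulf_neq0 ?cexp_neq0 ?Gint_neq0.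
have dec : decay (fun y => @theta_line R y - 1) 1 (complex.Re s + 1).
  by apply: (decay_full ltr01 continuous_theta_line theta_lineN theta_line_fast); lra.
pose S N (y : R) : R := \sum_(0 <= n < N) 2 * theta_term (expR (2 * y)) n.
have S0 N y : 0 <= S N y by apply: sumr_ge0 => n _; rewrite mulr_ge0 // theta_term_ge0.
have Scvg y : S N y @[N --> \oo] --> theta_line y - 1.
  have hh : 2 * series (theta_term (expR (2 * y))) N @[N --> \oo] --> 2 * ((theta (expR (2 * y)) - 1) / 2).
    by apply: cvgMl_tmp; apply: cvg_theta_series; exact: expR_gt0.
  rewrite (_ : 2 * ((_ - 1) / 2) = theta (expR (2 * y)) - 1) in hh; last by field.
  rewrite (_ : (fun N => S N y) = fun N => 2 * series (theta_term (expR (2 * y))) N); first exact: hh.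
  by apply/funext => N; rewrite /S -mulr_sumr.
have Sle N y : S N y <= theta_line y - 1.
  have nd : nondecreasing_seq (fun N => S N y).
    by apply/nondecreasing_seqP => n; rewrite /S big_nat_recr //= lerDl mulr_ge0 // theta_term_ge0.
  have hc : cvgn (fun N => S N y) by apply/cvg_ex; exists (theta_line y - 1); exact: Scvg.
  by have := nondecreasing_cvgn_le nd hc N; rewrite (cvg_lim (@Rhausdorff R) (Scvg y)).
have SE N : cint (fun y => (S N y)%:C * cexp (s * y%:C)) = P * \sum_(1 <= n < N.+1) cpow n%:R (- s).
  rewrite big_add1 /= mulr_sumr.
  transitivity (\sum_(0 <= n < N) cint (fun y => (2 * theta_term (expR (2 * y)) n)%:C * cexp (s * y%:C))).
    rewrite -cint_sum; last by move=> n; case: (mellin_theta_term n s0).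
    by apply: eq_cint => y; rewrite /S rmorph_sum mulr_suml.
  by apply: eq_bigr => n _; case: (mellin_theta_term n s0).
have mS N : cmeas (fun y => (S N y)%:C * cexp (s * y%:C)).
  apply: cmeasM; last exact: cmeas_cexp_line.
  apply: cmeas_real; rewrite (_ : S N = fun y => \sum_(0 <= n < N) 2 * gam (2 * y + (ln pi + 2 * ln n.+1%:R))).
    apply: measurable_sum => n; apply: continuous_measurable_fun => y; apply: cvgMl_tmp.
    exact: (@continuous_cmp _ _ _ (@continuous_gam R) (@continuous_affine R _ _)).
  by apply/funext => y; apply: eq_bigr => n _; rewrite theta_term_gam.
have key : cint (fun y => (S N y)%:C * cexp (s * y%:C)) @[N --> \oo] --> mellin (fun y => theta_line y - 1) s.
  have dom := @rintegrable_decay R _ _ _ (complex.Re s) 0 dec (lexx _).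
  rewrite subr0 addr0 in dom; have s2 : complex.Re s < complex.Re s + 1 by rewrite ltrDl.
  apply: (@cint_dct R _ _ _ mS _ _ (dom s1 s2)).
  - apply: cmeasM; last exact: cmeas_cexp_line.
    by apply: cmeas_real; case: dec.
  - move=> y; apply/ccvgP => e e0.
    have E0 : 0 < cabs (cexp (s * y%:C)) by rewrite cabs_gt0 cexp_neq0.
    move/rcvgP/(_ _ (divr_gt0 e0 E0)): (Scvg y); apply: filterS => N.
    rewrite (ltr_pdivlMr _ _ E0) => hN.
    have -> : (S N y)%:C * cexp (s * y%:C) - (theta_line y - 1)%:C * cexp (s * y%:C) =
      (S N y - (theta_line y - 1))%:C * cexp (s * y%:C) by rewrite [RHS]mulrC rmorphB /=; ring.
    by rewrite cabsM cabs_real.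
  move=> N y; rewrite cabsM cabs_real cabs_cexp_line ger0_norm //.
  rewrite mul0r oppr0 expR0; apply: (@le_trans _ _ (`|theta_line y - 1| * expR (complex.Re s * y))).
    by rewrite ler_wpM2r ?expR_ge0 //; apply: le_trans (Sle N y) (ler_norm _).
  by rewrite ler_peMr ?mulr_ge0 ?expR_ge0 // -[X in X <= _]addr0 lerD.
have zE : zeta_ext s = P^-1 * mellin (fun y => theta_line y - 1) s.
  rewrite (mellin_fold ltr01 continuous_theta_line theta_lineN theta_line_fast s1).
  rewrite -[mellin _ s]/(theta_tail s) -[mellin _ (1%:C - s)]/(theta_tail (1%:C - s)).
  by rewrite -(Gamma_half_zeta_ext s0 sn1) Gamma_Gint // mulKf.
have lim := @ccvgMl R _ _ _ _ P^-1 _ key; rewrite -zE in lim.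
rewrite -(cvg_shiftS (fun N => \sum_(1 <= n < N) cpow n%:R (- s) : C)).
rewrite (_ : (fun N => _) = fun N => P^-1 * cint (fun y => (S N y)%:C * cexp (s * y%:C))); first exact: lim.
by apply/funext => N; rewrite SE mulKf.
Qed.

Lemma zetaE s : s != 1%:C -> zeta s = zeta_ext s.
Proof.
move=> s1; apply: (@meromorphic_continuationE R _ _ _ 2).
- by apply: near_Re_gt; rewrite natrCE /= ltr1n.
- exact: meromorphic_zeta_ext.
- move=> z /= hz; apply/esym; apply: cvg_lim; first exact: norm_hausdorff.
  exact: cvg_dirichlet.
- exact: analytic_zeta_ext.
Qed.

Lemma zetastarE s : 0 < complex.Re s -> s != 1%:C ->
  zetastar s = theta_tail s + theta_tail (1%:C - s) + (s - 1%:C)^-1 - s^-1.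
Proof.
by move=> s0 s1; rewrite /zetastar zetaE // -Gamma_half_zeta_ext // /cpow !mulNr.
Qed.

End Zeta.

(** * The double series of Bessel functions *)

Section BesselKernel.
Context {R : realType}.
Local Notation C := (Cplx R).
Implicit Types (x y v t : R).

Definition bessel_kernel x v : R := expR (- (x / 2 * (expR v + expR (- v)))).

Lemma continuous_bessel_kernel x : continuous (bessel_kernel x).
Proof.
apply: (@continuous_cmp _ (@expR R)); first exact: continuous_expR.
move=> v; apply: cvgN; apply: cvgMl_tmp; apply: cvgD; first exact: continuous_expR.
by apply: (@continuous_cmp _ (@expR R)); [exact: continuous_expR|exact: opp_continuous].
Qed.

Lemma bessel_kernelN x v : bessel_kernel x (- v) = bessel_kernel x v.
Proof. by rewrite /bessel_kernel opprK [expR (- v) + _]addrC. Qed.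

Lemma decay_bessel_kernel x : 0 < x -> decay (bessel_kernel x) (-1) 1.
Proof.
move=> x0; split; first by apply: continuous_measurable_fun; exact: continuous_bessel_kernel.
have main v : bessel_kernel x v <= 2 / x * expR (- v).
  have X0 : 0 < x / 2 * expR v by rewrite mulr_gt0 ?divr_gt0 ?expR_gt0.
  apply: (@le_trans _ _ (expR (- (x / 2 * expR v)))).
    by rewrite ler_expR lerN2 ler_wpM2l ?divr_ge0 ?(ltW x0) // lerDl expR_ge0.
  rewrite expRN (_ : 2 / x * _ = (x / 2 * expR v)^-1); last first.
    by rewrite expRN !invfM invrK mulrC [x^-1 * 2]mulrC mulrC.
  rewrite lef_pV2 ?posrE ?expR_gt0 //; apply: le_trans (expR_ge1Dx _).
  by rewrite lerDr.
exists (2 / x) => v; rewrite ger0_norm ?expR_ge0 // mulN1r mul1r opprK; split; last exact: main.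
by have := main (- v); rewrite bessel_kernelN opprK.
Qed.

Lemma bessel_line_integrable x t : 0 < x ->
  cintegrable (fun v => (bessel_kernel x v)%:C * cexp ((0 +i* t) * v%:C)).
Proof.
move=> x0; apply: (mellin_integrable (decay_bessel_kernel x0)).
by rewrite /= oppr_lt0 ltr01.
Qed.

Lemma bessel_line_cont x (s : C) : ccont (fun v => (bessel_kernel x v)%:C * cexp (s * v%:C)).
Proof.
split.
  rewrite (_ : (fun v => _) = fun v => bessel_kernel x v * complex.Re (cexp (s * v%:C))).
    by move=> v; apply: cvgM; [exact: continuous_bessel_kernel|exact: continuous_Re_cexp_line].
  by apply/funext => v; rewrite (cReMr (bessel_kernel x v)).
rewrite (_ : (fun v => _) = fun v => bessel_kernel x v * complex.Im (cexp (s * v%:C))).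
  by move=> v; apply: cvgM; [exact: continuous_bessel_kernel|exact: continuous_Im_cexp_line].
by apply/funext => v; rewrite (cImMr (bessel_kernel x v)).
Qed.

Lemma besselK_line x t : 0 < x ->
  besselK (0 +i* t) x = 2^-1 * cint (fun v => (bessel_kernel x v)%:C * cexp ((0 +i* t) * v%:C)).
Proof.
move=> x0; rewrite /besselK; congr (_ * _).
rewrite (_ : (fun u => _) = fun u => (expR (- (x / 2) * (u + u^-1)) / u)%:C * cpow u (- (0 +i* t))); last first.
  by apply/funext => u; rewrite rmorphM /= fmorphV mulrAC.
rewrite (@cintegral_cpow R (fun u => expR (- (x / 2) * (u + u^-1)) / u)); last first.
  move=> u; rewrite in_itv /= andbT => u0; have un0 : u != 0 by rewrite gt_eqF.
  have cV : (fun u : R => u^-1) @ u --> u^-1 by apply: cvgV; [exact: un0|exact: cvg_id].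
  apply: cvgM; last exact: cV.
  apply: (@continuous_comp _ _ _ (fun u : R => - (x / 2) * (u + u^-1)) (@expR R)); last exact: continuous_expR.
  by apply: cvgMl_tmp; apply: cvgD; [exact: cvg_id|exact: cV].
have e0 : - (0 +i* t : C) = 0 +i* - t by apply: eqCplx; rewrite /= ?oppr0.
rewrite (_ : (fun y => _) = fun v => (bessel_kernel x v)%:C * cexp ((0 +i* - t) * v%:C)); last first.
  apply/funext => v; rewrite e0; congr (_%:C * _).
  by rewrite [expR v * _]mulrC divfK ?gt_eqF ?expR_gt0 // /bessel_kernel (expRN v) mulNr.
(* The definition gives the exponent -it and the claim has +it; after folding, the evenness of the
   kernel makes both integrands equal. *)
rewrite cint_fold; [|exact: bessel_line_cont|exact: bessel_line_integrable].
rewrite [RHS]cint_fold; [|exact: bessel_line_cont|exact: bessel_line_integrable].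
apply: eq_cint => v; congr (_ * _); rewrite bessel_kernelN addrC.
have e1 (u : R) : (0 +i* - t : C) * u%:C = (0 +i* t) * (- u)%:C by rewrite -e0 rmorphN /= mulNr mulrN.
by rewrite !e1 opprK.
Qed.

End BesselKernel.

Section DoubleSum.
Context {R : realType}.
Local Notation C := (Cplx R).
Implicit Types (x y v t : R).

(** Coefficients of the square root of theta minus 1. The missing constant term gives the decay in
    [coef_abs_sum_le2]. *)
Definition coef (m : nat) : R := if m is 0%N then 0 else c_half m.
Definition nome y : R := expR (- (pi * expR (2 * y))).

Lemma coef_le m : `|coef m| <= `|c_half m : R|.
Proof. by case: m => [|m] //=; rewrite normr0. Qed.

Lemma nome_ge0 y : 0 <= nome y. Proof. exact: expR_ge0. Qed.

Lemma continuous_nome : continuous nome.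
Proof.
apply: (@continuous_cmp _ (@expR R)); first exact: continuous_expR.
move=> y; apply: cvgN; apply: cvgMl_tmp.
exact: (@continuous_cmp _ (@expR R) _ (@continuous_expR R) (@continuous_scale_line _ _)).
Qed.

Lemma cvg_coef_sum y : \sum_(m < N) coef m * nome y ^+ m @[N --> \oo] --> sqrt_theta_line y - 1.
Proof.
have h := c_half_series (expR_gt0 (2 * y)).
rewrite -(cvg_shiftS (fun N => \sum_(m < N) coef m * nome y ^+ m)).
rewrite (_ : (fun N => _) = fun N => \sum_(m < N.+1) c_half m * expR (- (pi * expR (2 * y))) ^+ m - 1).
  apply: cvgB; last exact: cvg_cst.
  by rewrite (cvg_shiftS (fun N => \sum_(m < N) c_half m * expR (- (pi * expR (2 * y))) ^+ m)); exact: h.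
apply/funext => N; rewrite !big_ord_recl /= c_half0 expr0 mul0r add0r mul1r addrAC subrr add0r //.
Qed.

Definition coef_abs_sum N y : R := \sum_(m < N) `|coef m| * nome y ^+ m.

Lemma coef_abs_sum_ge0 N y : 0 <= coef_abs_sum N y.
Proof. by apply: sumr_ge0 => m _; rewrite mulr_ge0 // exprn_ge0 // nome_ge0. Qed.

Lemma coef_abs_sum_le1 N y : coef_abs_sum N y <= expR (2 / (pi * expR (2 * y))).
Proof.
have h : 0 < pi * expR (2 * y) :> R by rewrite mulr_gt0 ?pi_gt0 ?expR_gt0.
apply: le_trans (c_half_abs_sum N h); apply: ler_sum => m _.
by rewrite ler_wpM2r ?exprn_ge0 ?expR_ge0 // coef_le.
Qed.

(** With p the fourth root of the nome, q^m = p^(4m) <= p^(3 + m) for m >= 1. Three quarters of the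
    decay are kept, and the last quarter pays for the convergence of the sum. *)
Lemma coef_abs_sum_le2 N y :
  coef_abs_sum N y <= expR (- (3 / 4 * (pi * expR (2 * y)))) * expR (8 / (pi * expR (2 * y))).
Proof.
set X := pi * expR (2 * y); have X0 : 0 < X by rewrite mulr_gt0 ?pi_gt0 ?expR_gt0.
pose h := X / 4; have h0 : 0 < h by rewrite divr_gt0.
pose p := expR (- h); have p0 : 0 <= p := expR_ge0 _.
have p1 : p <= 1 by rewrite expR_le1 oppr_le0 ltW.
have -> : expR (- (3 / 4 * X)) = p ^+ 3.
  by rewrite -expRM_natr; congr expR; rewrite /h; field.
have -> : 8 / X = 2 / h by rewrite /h; field; rewrite gt_eqF.
have qp : nome y = p ^+ 4.
  by rewrite /nome -/X -expRM_natr; congr expR; rewrite /h; field.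
apply: le_trans (_ : p ^+ 3 * \sum_(m < N) `|c_half m| * p ^+ m <= _); last first.
  by rewrite ler_wpM2l ?exprn_ge0 // c_half_abs_sum.
rewrite mulr_sumr; apply: ler_sum => -[[|m] hm] _ /=.
  by rewrite normr0 mul0r mulr_ge0 ?exprn_ge0 // mulr_ge0 ?exprn_ge0.
rewrite mulrCA; apply: ler_wpM2l => //; rewrite qp -exprM -exprD.
by apply: ler_wiXn2l => //; lia.
Qed.

(** For u = |y| and X = e^(2u) the exponent is at most -(3/4) pi X + 8/(pi X) + 2X/pi. As pi >= 2
    and X >= 1 this is at most 4 - X/2, and X >= 1 + 2u concludes. *)
Lemma coef_abs_sum_prod M N y :
  coef_abs_sum M y * coef_abs_sum N (- y) <= expR 4 * expR (- `|y|).
Proof.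
have main K L u : 0 <= u -> coef_abs_sum K u * coef_abs_sum L (- u) <= expR 4 * expR (- u).
  move=> u0; pose X := expR (2 * u).
  have X1 : 1 + 2 * u <= X by exact: expR_ge1Dx.
  have X0 : 0 < X by exact: expR_gt0.
  have p2 : 2 <= pi :> R := pi_ge2 R.
  have p0 : 0 < pi :> R := pi_gt0 R.
  apply: le_trans (ler_pM _ _ (coef_abs_sum_le2 K u) (coef_abs_sum_le1 L (- u))) _; rewrite ?coef_abs_sum_ge0 //.
  rewrite -!expRD ler_expR -/X mulrN expRN -/X.
  have h1 : 8 / (pi * X) <= 4.
    rewrite ler_pdivrMr ?mulr_gt0 //; apply: (@le_trans _ _ (4 * (2 * 1))); first by lra.
    by rewrite ler_wpM2l // ler_pM //; lra.
  have h2 : 2 / (pi / X) <= X.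
    by rewrite invfM invrK mulrA ler_piMl ?(ltW X0) // ler_pdivrMr // mul1r.
  have h3 : 2 * X <= pi * X by rewrite ler_wpM2r // ltW.
  by move: h1 h2 h3; set a := 8 / _; set b := 2 / _; set c := pi * X; lra.
have [y0|y0] := leP 0 y; first by rewrite ger0_norm //; exact: main.
rewrite ltr0_norm // mulrC; have := main N M (- y); rewrite opprK oppr_ge0 => h.
by apply: h; exact: ltW.
Qed.

Definition pair_bound y : R := expR 4 * expR (- `|y|).

Lemma rintegrable_pair_bound : rintegrable pair_bound.
Proof.
have h y : pair_bound y <= expR 4 * expR (1 * y) /\ pair_bound y <= expR 4 * expR (- (1 * y)).
  rewrite mul1r /pair_bound; split; apply: ler_wpM2l; rewrite ?expR_ge0 // ler_expR.
    by rewrite lerNl -normrN ler_norm.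
  by rewrite lerN2 ler_norm.
have h0 y : 0 <= pair_bound y by rewrite mulr_ge0 ?expR_ge0.
apply: (@rintegrable_two_sided R _ (expR 4) 1 1); rewrite ?ltr01 //.
- apply: continuous_measurable_fun => y; apply: cvgMl_tmp.
  apply: (@continuous_cmp _ (@expR R) (fun y => - `|y|)); first exact: continuous_expR.
  by move=> u; apply: cvgN; exact: norm_continuous.
- by move=> y; rewrite ger0_norm //; exact: (h y).1.
- by move=> y; rewrite ger0_norm //; exact: (h y).2.
Qed.

Definition pair_fun (m n : nat) y : R := coef m * coef n * (nome y ^+ m * nome (- y) ^+ n).

Lemma measurable_pair_fun m n : measurable_fun setT (pair_fun m n).
Proof.
apply: continuous_measurable_fun => y; apply: cvgMl_tmp.
have cX k : continuous (fun y => nome y ^+ k).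
  by move=> u; apply: (@continuous_cmp R (fun x => x ^+ k)); [exact: exprn_continuous|exact: continuous_nome].
apply: cvgM; first exact: cX.
by apply: (@continuous_cmp R (fun y => nome y ^+ n)); [exact: cX|exact: opp_continuous].
Qed.

Lemma pair_fun_norm m n y : `|pair_fun m n y| = `|coef m| * nome y ^+ m * (`|coef n| * nome (- y) ^+ n).
Proof.
rewrite /pair_fun !normrM !normrX !(ger0_norm (nome_ge0 _)); ring.
Qed.

Lemma pair_fun_sum N y : \sum_(m < N) \sum_(n < N) `|pair_fun m n y| <= pair_bound y.
Proof.
apply: le_trans (coef_abs_sum_prod N N y); rewrite /coef_abs_sum mulr_suml.
apply: ler_sum => m _; rewrite mulr_sumr; apply: ler_sum => n _.
by rewrite pair_fun_norm.
Qed.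

Lemma pair_fun_le m n y : `|pair_fun m n y| <= pair_bound y.
Proof.
pose N := (maxn m n).+1; apply: le_trans (pair_fun_sum N y).
have hm : (m < N)%N by rewrite ltnS leq_maxl.
have hn : (n < N)%N by rewrite ltnS leq_maxr.
rewrite (bigD1 (Ordinal hm)) //= (bigD1 (Ordinal hn)) //= -addrA lerDl.
by rewrite addr_ge0 // sumr_ge0 // => i _; rewrite sumr_ge0.
Qed.

Lemma rintegrable_pair_fun m n : rintegrable (fun y => `|pair_fun m n y|).
Proof.
apply: integrable_norm; apply: (rintegrable_le (measurable_pair_fun m n) rintegrable_pair_bound).
exact: pair_fun_le.
Qed.

Lemma rint_sum (I : Type) (r : seq I) (f : I -> R -> R) : (forall i, rintegrable (f i)) ->
  rintegrable (fun y => \sum_(i <- r) f i y) /\ rint (fun y => \sum_(i <- r) f i y) = \sum_(i <- r) rint (f i).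
Proof.
move=> hf; elim: r => [|i r [IH1 IH2]].
  rewrite big_nil (_ : (fun y => _) = fun=> 0); last by apply/funext => y; rewrite big_nil.
  by split; [exact: integrable0|rewrite /rint Rintegral_cst //= mul0r].
rewrite (_ : (fun y => _) = fun y => f i y + \sum_(j <- r) f j y); last first.
  by apply/funext => y; rewrite big_cons.
by rewrite big_cons -IH2; split; [exact: rintegrableD|exact: rintD].
Qed.

Definition pair_int t (p : nat * nat) : C := mellin (pair_fun p.1 p.2) (0 +i* t).

Lemma cabs_line_imag t y : cabs (cexp ((0 +i* t) * y%:C)) = 1 :> R.
Proof. by rewrite cabs_cexp_line /= mul0r expR0. Qed.

Lemma cmeas_pair_int t m n : cmeas (fun y : R => (pair_fun m n y)%:C * cexp ((0 +i* t) * y%:C)).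
Proof.
by apply: cmeasM; [apply: cmeas_real; exact: measurable_pair_fun|exact: cmeas_cexp_line].
Qed.

Lemma cintegrable_pair_int t m n : cintegrable (fun y : R => (pair_fun m n y)%:C * cexp ((0 +i* t) * y%:C)).
Proof.
apply: (cintegrable_le (cmeas_pair_int t m n) (rintegrable_pair_fun m n)) => y.
by rewrite cabsM cabs_real cabs_line_imag mulr1.
Qed.

(** The double sum is moved under the integral, where it is bounded pointwise and uniformly in N by
    an integrable function; the factor 2 comes from [cabs_cint_le]. *)
Lemma pair_int_abs_sum t N :
  \sum_(m < N) \sum_(n < N) cabs (pair_int t (nat_of_ord m, nat_of_ord n)) <= 2 * rint pair_bound.
Proof.
have h m n : cabs (pair_int t (m, n)) <= 2 * rint (fun y => `|pair_fun m n y|).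
  apply: (cabs_cint_le (cmeas_pair_int t m n) (rintegrable_pair_fun m n)) => y.
  by rewrite cabsM cabs_real cabs_line_imag mulr1.
apply: (@le_trans _ _ (\sum_(m < N) \sum_(n < N) 2 * rint (fun y => `|pair_fun m n y|))).
  by apply: ler_sum => m _; apply: ler_sum => n _; exact: h.
under eq_bigr do rewrite -mulr_sumr.
rewrite -mulr_sumr; apply: ler_wpM2l => //.
have e (m : 'I_N) := @rint_sum _ (index_enum 'I_N) (fun n y => `|pair_fun m n y|) (fun n => rintegrable_pair_fun m n).
under eq_bigr => m _ do rewrite -(e m).2.
have [e1 <-] := @rint_sum _ (index_enum 'I_N) (fun m y => \sum_(n < N) `|pair_fun m n y|) (fun m => (e m).1).
apply: le_rint e1 rintegrable_pair_bound _ => y; exact: pair_fun_sum.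
Qed.

Definition cross_int t : C := mellin (fun y => (sqrt_theta_line y - 1) * (sqrt_theta_line (- y) - 1)) (0 +i* t).

Lemma cvg_pair_int_sum t :
  \sum_(m < N) \sum_(n < N) pair_int t (nat_of_ord m, nat_of_ord n) @[N --> \oo] --> cross_int t.
Proof.
pose S N y : R := \sum_(m < N) coef m * nome y ^+ m.
have SE N y : S N y * S N (- y) = \sum_(m < N) \sum_(n < N) pair_fun m n y.
  rewrite /S mulr_suml; apply: eq_bigr => m _; rewrite mulr_sumr; apply: eq_bigr => n _.
  by rewrite /pair_fun; ring.
rewrite (_ : (fun N => _) = fun N => cint (fun y => (S N y * S N (- y))%:C * cexp ((0 +i* t) * y%:C))); last first.
  apply/funext => N; transitivity (\sum_(m < N) cint (fun y => \sum_(n < N) (pair_fun m n y)%:C * cexp ((0 +i* t) * y%:C))).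
    by apply: eq_bigr => m _; rewrite cint_sum // => n; exact: cintegrable_pair_int.
  rewrite -cint_sum; last by move=> m; apply: cintegrable_sum => n; exact: cintegrable_pair_int.
  apply: eq_cint => y; rewrite SE rmorph_sum mulr_suml; apply: eq_bigr => m _.
  by rewrite rmorph_sum mulr_suml.
apply: (@cint_dct R _ _ pair_bound).
- move=> N; apply: cmeasM; last exact: cmeas_cexp_line.
  apply: cmeas_real; rewrite (_ : (fun y => _) = fun y => \sum_(m < N) \sum_(n < N) pair_fun m n y).
    by apply: measurable_sum => m; apply: measurable_sum => n; exact: measurable_pair_fun.
  by apply/funext => y; exact: SE.
- apply: cmeasM; last exact: cmeas_cexp_line.
  have c1 : continuous (fun y : R => sqrt_theta_line y - 1).
    by move=> u; apply: cvgB; [exact: continuous_sqrt_theta_line|exact: cvg_cst].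
  apply: cmeas_real; apply: continuous_measurable_fun => y; apply: cvgM; first exact: c1.
  by apply: (@continuous_cmp R (fun y => sqrt_theta_line y - 1)); [exact: c1|exact: opp_continuous].
- move=> y; have h : S N y * S N (- y) @[N --> \oo] --> (sqrt_theta_line y - 1) * (sqrt_theta_line (- y) - 1).
    by apply: cvgM; exact: cvg_coef_sum.
  apply/ccvgP => e e0; move/rcvgP/(_ _ e0): h; apply: filterS => N hN.
  have -> : forall (a b : R) (z : C), a%:C * z - b%:C * z = (a - b)%:C * z by move=> a b z; rewrite -mulrBl rmorphB.
  by rewrite cabsM cabs_real cabs_line_imag mulr1.
- exact: rintegrable_pair_bound.
- move=> N y; rewrite cabsM cabs_real cabs_line_imag mulr1 SE; apply: le_trans (pair_fun_sum N y).
  apply: le_trans (ler_norm_sum _ _ _) _; apply: ler_sum => m _; exact: ler_norm_sum.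
Qed.

Lemma pair_int0 t m n : ((m == 0) || (n == 0))%N -> pair_int t (m, n) = 0.
Proof.
move=> h; rewrite /pair_int /mellin -[RHS](@cint0 R); apply: eq_cint => y /=.
have -> : pair_fun m n y = 0.
  by move: h; rewrite /pair_fun => /orP[]/eqP -> /=; rewrite ?mulr0 ?mul0r.
by rewrite mul0r.
Qed.

(** The substitution v = 2y + l with e^l = sqrt(m/n) makes the exponent symmetric: m e^(2y) + n
    e^(-2y) = sqrt(mn) (e^v + e^(-v)). The phase e^(ity) becomes e^(itv/2) times the constant
    e^(-itl/2). *)
Lemma pair_intE t m n : (0 < m)%N -> (0 < n)%N -> pair_int t (m, n) =
  (c_half m * c_half n)%:C * (cexp (0 +i* (t / 4 * (ln n%:R - ln m%:R)))
    * besselK (0 +i* (t / 2)) (2 * pi * Num.sqrt (m%:R * n%:R))).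
Proof.
move=> m0 n0; have M0 : 0 < m%:R :> R by rewrite ltr0n.
have N0 : 0 < n%:R :> R by rewrite ltr0n.
set x := 2 * pi * _; have r0 : 0 < Num.sqrt (m%:R * n%:R) :> R by rewrite sqrtr_gt0 mulr_gt0.
have x0 : 0 < x by rewrite mulr_gt0 // mulr_gt0 // pi_gt0.
pose l : R := (ln m%:R - ln n%:R) / 2.
rewrite besselK_line //; set H := fun v => _.
have cH : ccont H by exact: bessel_line_cont.
have iH : cintegrable H by exact: bessel_line_integrable.
have two0 : (0 : R) < 2 by [].
have two : (2%:R)%:C != 0 :> C by apply/eqP => -[] /eqP; rewrite pnatr_eq0.
rewrite (cint_affine l two0 cH) -cintZ; last exact: cintegrable_affine.
have i2 : cintegrable (fun v : R => 2^-1 * ((2%:R)%:C * H (2 * v + l))) by apply: cintegrableZ; exact: cintegrable_affine.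
rewrite -cintZ // -cintZ; last exact: cintegrableZ.
rewrite /pair_int /mellin /=; apply: eq_cint => y.
have -> : pair_fun m n y = c_half m * c_half n * bessel_kernel x (2 * y + l).
  rewrite /pair_fun; have -> : coef n = c_half n by case: (n) n0.
  have -> : coef m = c_half m by case: (m) m0.
  congr (_ * _); rewrite /nome /bessel_kernel -!expRM_natr -expRD; congr expR.
  have hx : x / 2 = pi * expR ((ln m%:R + ln n%:R) / 2).
    have e : Num.sqrt (m%:R * n%:R) = expR ((ln m%:R + ln n%:R) / 2) :> R.
      rewrite -[RHS](ger0_norm (expR_ge0 _)) -sqrtr_sqr -expRM_natr divfK ?gt_eqF //.
      by rewrite expRD !lnK.
    by rewrite /x e; field.
  rewrite hx mulrDr -!mulrA -!expRD.
  have em : expR ((ln m%:R + ln n%:R) / 2 + (2 * y + l)) = m%:R * expR (2 * y) :> R.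
    by rewrite -[in RHS](lnK M0) -expRD; congr expR; rewrite /l; field.
  have en : expR ((ln m%:R + ln n%:R) / 2 + - (2 * y + l)) = n%:R * expR (2 * - y) :> R.
    by rewrite -[in RHS](lnK N0) -expRD; congr expR; rewrite /l; field.
  by rewrite em en; ring.
have eI : (0 +i* t : C) * y%:C = 0 +i* (t / 4 * (ln n%:R - ln m%:R)) + (0 +i* (t / 2)) * (2 * y + l)%:C.
  by apply: eqCplx; rewrite ?cReD ?cImD ?cReM ?cImM /= /l; field.
rewrite eI cexpD rmorphM /= /H; move: (bessel_kernel x _)%:C (cexp _) (cexp _) (_ * _)%:C => k e2 e1 d.
have -> : d * (e1 * (2^-1 * ((2%:R)%:C * (k * e2)))) = 2^-1 * (2%:R)%:C * (d * k * (e1 * e2)) by ring.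
by rewrite rmorph_nat mulVf ?mul1r //; move: two; rewrite rmorph_nat.
Qed.

End DoubleSum.

(** * Unordered summation over pairs of indices *)

Section Family.
Context {R : realType}.
Local Notation C := (Cplx R).

Definition box N : seq (nat * nat) := [seq (m, n) | m <- iota 0 N, n <- iota 0 N].

Lemma mem_box N p : (p \in box N) = (p.1 < N)%N && (p.2 < N)%N.
Proof.
apply/allpairsP/andP => [[q []]|[h1 h2]].
  by rewrite !mem_iota !add0n => /andP[_ h1] /andP[_ h2] ->.
by exists p; rewrite !mem_iota !add0n /= h1 h2; split=> //; case: (p).
Qed.

Lemma uniq_box N : uniq (box N).
Proof. by apply: allpairs_uniq; rewrite ?iota_uniq // => -[a b] [c d] _ _ /= [-> ->]. Qed.

Lemma big_box (V : nmodType) (F : nat * nat -> V) N :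
  \sum_(p <- box N) F p = \sum_(m < N) \sum_(n < N) F (nat_of_ord m, nat_of_ord n).
Proof.
rewrite /box big_allpairs -{1}[N]subn0 -/(index_iota 0 N) big_mkord; apply: eq_bigr => m _.
by rewrite -{1}[N]subn0 -/(index_iota 0 N) big_mkord.
Qed.

Lemma sub_sum (T : eqType) (V : nmodType) (F : T -> V) (s1 s2 : seq T) : uniq s1 -> uniq s2 ->
  {subset s1 <= s2} -> \sum_(p <- s2) F p = \sum_(p <- s1) F p + \sum_(p <- s2 | p \notin s1) F p.
Proof.
move=> u1 u2 h; rewrite (bigID (mem s1)) /=; congr (_ + _); rewrite -big_filter.
apply: perm_big; apply: uniq_perm; rewrite ?filter_uniq // => p.
by rewrite mem_filter; apply: andb_idr; exact: h.
Qed.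

Lemma box_sub M N : (M <= N)%N -> {subset box M <= box N}.
Proof. by move=> h p; rewrite !mem_box => /andP[h1 h2]; rewrite !(leq_trans _ h). Qed.

Lemma sub_box (D : seq (nat * nat)) : exists N, {subset D <= box N}.
Proof.
exists (\max_(p <- D) maxn p.1 p.2).+1 => p hp; rewrite mem_box !ltnS.
by rewrite -geq_max; exact: (leq_bigmax_seq _ hp).
Qed.

Lemma box_sum_mono (g : nat * nat -> R) : (forall p, 0 <= g p) ->
  nondecreasing_seq (fun N => \sum_(p <- box N) g p).
Proof.
move=> g0 M N h; rewrite (sub_sum g (uniq_box M) (uniq_box N) (box_sub h)) lerDl.
by apply: sumr_ge0 => p _; exact: g0.
Qed.

Lemma box_sum_cvg (g : nat * nat -> R) (V : R) : (forall p, 0 <= g p) ->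
  (forall N, \sum_(p <- box N) g p <= V) -> cvgn (fun N => \sum_(p <- box N) g p).
Proof.
move=> g0 hV; apply: nondecreasing_is_cvgn; first exact: box_sum_mono.
by exists V => _ [N _ <-].
Qed.

(** Absolute summability along squares controls every finite set containing a large square. In this
    form the limit serves the unordered sum and the summation over mn < N alike. *)
Lemma family_limit (b : nat * nat -> C) (V : R) : (forall N, \sum_(p <- box N) cabs (b p) <= V) ->
  exists T : C, \sum_(p <- box N) b p @[N --> \oo] --> T /\
    forall e : R, 0 < e -> exists N, forall D, uniq D -> {subset box N <= D} ->
      cabs (\sum_(p <- D) b p - T) < e.
Proof.
move=> hV; pose A N := \sum_(p <- box N) cabs (b p).
have b0 p : 0 <= cabs (b p) := cabs_ge0 _.
have cA : cvgn A by exact: box_sum_cvg b0 hV.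
(* Adding |b| makes the terms nonnegative, so both r + |b| and |b| have bounded monotone box
   sums. *)
have real_part (r : nat * nat -> R) : (forall p, `|r p| <= cabs (b p)) ->
    exists l : R, \sum_(p <- box N) r p @[N --> \oo] --> l.
  move=> hr; have hr' p := hr p; have cr : cvgn (fun N => \sum_(p <- box N) (cabs (b p) + r p)).
    apply: (@box_sum_cvg _ (2 * V)) => [p|N].
      by have := hr p; rewrite ler_norml => /andP[h _]; rewrite -lerBlDr sub0r lerNl; move: h; lra.
    rewrite big_split /= mulr_natl mulr2n; apply: lerD; first exact: hV.
    apply: le_trans (hV N); apply: ler_sum => p _; exact: le_trans (ler_norm _) (hr p).
  move/cvg_ex: cr => [l1 h1]; move/cvg_ex: cA => [l2 h2]; exists (l1 - l2).
  rewrite (_ : (fun N => _) = fun N => \sum_(p <- box N) (cabs (b p) + r p) - A N).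
    by apply: cvgB; [exact: h1|exact: h2].
  by apply/funext => N; rewrite /A big_split /= addrAC subrr add0r.
have [l1 h1] := real_part (fun p => complex.Re (b p)) (fun p => Re_le_cabs _).
have [l2 h2] := real_part (fun p => complex.Im (b p)) (fun p => Im_le_cabs _).
pose T : C := l1 +i* l2; exists T.
have hT : \sum_(p <- box N) b p @[N --> \oo] --> T.
  apply/ccvg_ReIm => /=; split.
    by rewrite (_ : (fun N => _) = fun N => \sum_(p <- box N) complex.Re (b p)); [exact: h1|apply/funext => N; rewrite cRe_sum].
  by rewrite (_ : (fun N => _) = fun N => \sum_(p <- box N) complex.Im (b p)); [exact: h2|apply/funext => N; rewrite cIm_sum].
split; first exact: hT.
move=> e e0; have e2 : 0 < e / 2 by rewrite divr_gt0.
have AL N : A N <= limn A by apply: nondecreasing_cvgn_le cA N; exact: box_sum_mono.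
have near1 : \forall N \near \oo, cabs (\sum_(p <- box N) b p - T) < e / 2.
  by move/ccvgP: hT; exact.
have near2 : \forall N \near \oo, `|A N - limn A| < e / 2.
  by move/rcvgP: cA; exact.
have [N [hN1 hN2]] : exists N, cabs (\sum_(p <- box N) b p - T) < e / 2 /\ `|A N - limn A| < e / 2.
  by have [N _ hN] := filterI near1 near2; exists N; exact: (hN N (leqnn N)).
exists N => D uD sD; rewrite (sub_sum b (uniq_box N) uD sD) addrAC.
have [N' sN'] := sub_box D.
have tail : cabs (\sum_(p <- D | p \notin box N) b p) <= limn A - A N.
  apply: le_trans (cabs_sum _ _ _) _; rewrite lerBrDl.
  rewrite -(sub_sum (fun p => cabs (b p)) (uniq_box N) uD sD).
  apply: le_trans (AL N'); rewrite /A (sub_sum (fun p => cabs (b p)) uD (uniq_box N') sN') lerDl.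
  by apply: sumr_ge0.
apply: le_lt_trans (cabsD _ _) _; rewrite [e]splitr; apply: ltr_leD => //.
apply: le_trans tail _; apply: le_trans (ltW hN2); rewrite distrC; exact: ler_norm.
Qed.

Lemma family_totally (b : nat * nat -> C) (T : C) :
  (forall e : R, 0 < e -> exists N, forall D, uniq D -> {subset box N <= D} ->
    cabs (\sum_(p <- D) b p - T) < e) ->
  summability.partial_sum b @ summability.totally --> T.
Proof.
move=> h; apply/(@ccvgP R _ _ (@filter_filter _ _ (@summability.totally_filter _))) => e e0.
have [N hN] := h e e0.
exists (finmap.seq_fset tt (box N)) => // X /= /finmap.fsubsetP sX.
rewrite /summability.partial_sum -(@finmap.big_seq_fsetE _ _ _ _ X predT b).
apply: hN; first exact: finmap.fset_uniq.
by move=> p hp; apply: (sX p); move: hp; rewrite -(finmap.seq_fsetE tt).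
Qed.

(** Pairs (d, n/d) are grouped along the hyperbolas p.1 p.2 = n. When the product is nonzero both
    entries are below N, so the box misses nothing; pairs with a zero entry satisfy the filter but
    contribute 0. *)
Lemma divisor_pairs (V : nmodType) (F : nat * nat -> V) N : (forall p, (p.1 * p.2 = 0)%N -> F p = 0) ->
  \sum_(1 <= n < N) \sum_(d <- divisors n) F (d, (n %/ d)%N) =
  \sum_(p <- [seq p <- box N | (p.1 * p.2 < N)%N]) F p.
Proof.
move=> F0; transitivity (\sum_(1 <= n < N) \sum_(p <- box N | (p.1 * p.2 == n)%N) F p).
  rewrite big_nat [RHS]big_nat; apply: eq_bigr => n /andP[n1 nN].
  rewrite -(big_map (fun d => (d, (n %/ d)%N)) predT F) -[RHS]big_filter; apply: perm_big.
  apply: uniq_perm; first by rewrite map_inj_uniq ?divisors_uniq // => a b [].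
    by rewrite filter_uniq // uniq_box.
  move=> [a b]; rewrite mem_filter mem_box /=; apply/mapP/andP => [[d]|[/eqP e _]].
    rewrite -dvdn_divisors // => dn [-> ->]; rewrite mulnC divnK //; split=> //.
    by rewrite !(leq_ltn_trans _ nN) ?leq_div // dvdn_leq.
  have a0 : (0 < a)%N by move: n1; rewrite -e; case: (a).
  by exists a; rewrite -?dvdn_divisors -?e ?dvdn_mulr ?mulKn // e.
under eq_bigr do rewrite big_mkcond /=.
rewrite exchange_big /= [RHS]big_filter [RHS]big_mkcond /=; apply: eq_bigr => p _.
rewrite -big_mkcond /=; case: ifPn => [pN|]; last first.
  rewrite -leqNgt => pN; rewrite big_nat_cond big_pred0 // => n.
  by apply/negP => /andP[/andP[_ h]] /eqP e; move: pN; rewrite e leqNgt h.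
have [p0|p0] := posnP (p.1 * p.2)%N.
  by rewrite F0 // big1.
rewrite (eq_bigl (pred1 (p.1 * p.2)%N)); last by move=> n; rewrite /= eq_sym.
by rewrite -big_filter filter_pred1_uniq ?iota_uniq ?big_seq1 // mem_index_iota p0.
Qed.

End Family.

Section ThreeSums.
Context {R : realType}.
Local Notation C := (Cplx R).
Variable t : R.
Local Notation P := (pair_int t).

Let V : R := 2 * rint (@pair_bound R).

Let hV N : \sum_(p <- box N) cabs (P p) <= V.
Proof. by rewrite big_box; exact: pair_int_abs_sum. Qed.

Let hV' N : \sum_(p <- box N) cabs (P (p.2, p.1)) <= V.
Proof. by rewrite big_box exchange_big -(big_box (fun p => cabs (P p))). Qed.

Let diag p : C := if p.1 == p.2 then P p else 0.

Lemma diag_sumE N : diag_sum t N = \sum_(p <- box N) diag p.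
Proof.
rewrite big_box; transitivity (\sum_(m < N) P (nat_of_ord m, nat_of_ord m)).
  rewrite -(big_mkord xpredT (fun m => P (m, m))) /diag_sum; case: N => [|N]; first by rewrite !big_geq.
  rewrite [RHS]big_ltn // pair_int0 // add0r [LHS]big_nat [RHS]big_nat; apply: eq_bigr => m /andP[m0 _].
  rewrite pair_intE // subrr mulr0 -expr2 -[m%:R * _]expr2 sqrtr_sqr ger0_norm ?ler0n //.
  by rewrite (_ : (0 +i* 0 : R[i]) = 0) // cexp0 mul1r.
apply: eq_bigr => m _; rewrite (bigD1 m) //= /diag /= eqxx big1 ?addr0 // => n nm.
by rewrite ifN // eq_sym.
Qed.

(** The integrals for (m, n) and (n, m) have the same Bessel factor and conjugate phases, whose sum
    is twice the cosine. *)
Lemma pair_termE m n : 2 * pair_term t (m, n) =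
  if (m < n)%N then P (m, n) + P (n, m) else 0.
Proof.
rewrite /pair_term; case: m => [|m] /=.
  by rewrite mulr0 (@pair_int0 R t 0 n) // (@pair_int0 R t n 0) ?orbT // addr0; case: ifP.
case: ifP => [mn|_]; last by rewrite mulr0.
have n0 : (0 < n)%N by apply: leq_trans mn.
rewrite (pair_intE t (ltn0Sn m) n0) (pair_intE t n0 (ltn0Sn m)).
rewrite (mulrC (n%:R : R) m.+1%:R) (mulrC (c_half n : R) (c_half m.+1)).
have -> : ln (n%:R / m.+1%:R) = ln n%:R - ln m.+1%:R :> R by rewrite ln_div // posrE ltr0n.
set K := besselK _ _; set x := ln n%:R; set y := ln m.+1%:R; set d := c_half m.+1 * c_half n.
have E : cexp (0 +i* (t / 4 * (x - y))) + cexp (0 +i* (t / 4 * (y - x))) = 2 * (cos (t / 4 * (x - y)))%:C :> C.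
  have -> : t / 4 * (y - x) = - (t / 4 * (x - y)) by ring.
  apply: eqCplx; rewrite ?cReD ?cImD ?Re_cexp ?Im_cexp natrCE ?cReMr ?cImMr /= expR0 ?cosN ?sinN; ring.
have -> : (d * cos (t / 4 * (x - y)))%:C = d%:C * (cos (t / 4 * (x - y)))%:C by rewrite rmorphM.
rewrite -mulrDr -mulrDl E; clearbody K d; move: (cos _)%:C d%:C K => u v w; ring.
Qed.

Lemma box_split N : \sum_(p <- box N) P p = \sum_(p <- box N) diag p + 2 * \sum_(p <- box N) pair_term t p.
Proof.
rewrite mulr_sumr !big_box.
have -> : \sum_(m < N) \sum_(n < N) P (nat_of_ord m, nat_of_ord n) =
    \sum_(m < N) \sum_(n < N) (diag (nat_of_ord m, nat_of_ord n)
      + (if (m < n)%N then P (nat_of_ord m, nat_of_ord n) else 0)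
      + (if (n < m)%N then P (nat_of_ord m, nat_of_ord n) else 0)).
  apply: eq_bigr => m _; apply: eq_bigr => n _; rewrite /diag /=.
  by case: ltngtP => _; rewrite ?addr0 ?add0r.
under eq_bigr do rewrite !big_split /=.
rewrite !big_split /= -addrA; congr (_ + _); rewrite [X in _ + X]exchange_big -big_split /=.
apply: eq_bigr => m _; rewrite -big_split /=; apply: eq_bigr => n _.
by rewrite pair_termE; case: ifP => // _; rewrite addr0.
Qed.

(** The sums of the theorem are rearrangements of the single absolutely summable family [pair_int]:
    the diagonal, the pairs off it joined in twos, and the summation along hyperbolas. *)
Lemma three_sums : exists S : C * C * C,
  [/\ diag_sum t @ \oo --> S.1.1, pair_sum t @ summability.totally --> S.1.2,
      divisor_sum t @ \oo --> S.2,
      S.1.1 + 2 * S.1.2 = cross_int t & S.2 = cross_int t].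
Proof.
have [T [hT1 hT2]] := family_limit hV.
have eT : T = cross_int t.
  apply: (ccvg_unique hT1); rewrite (funext (big_box P)); exact: cvg_pair_int_sum.
have hdiag N : \sum_(p <- box N) cabs (diag p) <= V.
  apply: le_trans (hV N); apply: ler_sum => p _; rewrite /diag.
  by case: ifP => _; [exact: lexx|rewrite cabs0 cabs_ge0].
have [S1 [h1 _]] := family_limit hdiag.
have hpair N : \sum_(p <- box N) cabs (pair_term t p) <= V + V.
  apply: le_trans (lerD (hV N) (hV' N)); rewrite -big_split /=; apply: ler_sum => -[m n] _ /=.
  have h2 : cabs (2 * pair_term t (m, n)) <= cabs (P (m, n)) + cabs (P (n, m)).
    by rewrite pair_termE; case: ifP => _; [exact: cabsD|rewrite cabs0 addr_ge0 // cabs_ge0].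
  apply: le_trans h2; rewrite cabsM cabs_nat ler_peMl ?cabs_ge0 // ler1n //.
have [S2 [h2 h2']] := family_limit hpair.
exists (S1, S2, T); split=> /=.
- rewrite (funext diag_sumE); exact: h1.
- exact: family_totally h2'.
- apply/ccvgP => e e0; have [M hM] := hT2 e e0.
  (* Entries below M have product less than M M, so from here on the region p.1 p.2 < N inside
     [box N] contains [box M]. *)
  exists (M * M + M)%N => // N /= hN.
  have -> : divisor_sum t N = \sum_(p <- [seq p <- box N | (p.1 * p.2 < N)%N]) P p.
    rewrite -divisor_pairs; last first.
      by move=> [a b] /= /eqP; rewrite muln_eq0 => ab; exact: pair_int0.
    rewrite /divisor_sum big_nat [RHS]big_nat; apply: eq_bigr => n /andP[n0 _].
    rewrite mulr_sumr mulr_suml big_seq [RHS]big_seq; apply: eq_bigr => d; rewrite -dvdn_divisors // => dn.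
    have d0 : (0 < d)%N by exact: dvdn_gt0 dn.
    have nd0 : (0 < n %/ d)%N by rewrite divn_gt0 // dvdn_leq.
    rewrite (pair_intE t d0 nd0) -natrM (mulnC d) divnK //.
    have en : ln n%:R = ln d%:R + ln (n %/ d)%:R :> R.
      by rewrite -lnM ?posrE ?ltr0n // -natrM mulnC divnK.
    have -> : cexp (0 +i* (t / 4 * (ln (n %/ d)%:R - ln d%:R))) =
        cpow n%:R (0 +i* (t / 4)) * cpow d%:R (0 +i* - (t / 2)) :> C.
      rewrite /cpow -cexpD; congr cexp.
      by apply: eqCplx; rewrite ?cReD ?cImD ?cReM ?cImM /= en; field.
    by ring.
  apply: hM; first by rewrite filter_uniq // uniq_box.
  move=> p; rewrite mem_filter !mem_box => /andP[p1 p2].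
  have pp : (p.1 * p.2 <= M * M)%N by apply: leq_mul; exact: ltnW.
  move: hN pp p1 p2; move: (p.1 * p.2)%N (M * M)%N p.1 p.2 => u v a b hN pp p1 p2.
  by apply/and3P; split; lia.
- have h3 : \sum_(p <- box N) diag p + 2 * \sum_(p <- box N) pair_term t p @[N --> \oo] --> S1 + 2 * S2.
    apply: (@ccvgD R); first exact: h1.
    by apply: ccvgMl; exact: h2.
  by rewrite -eT; apply: (ccvg_unique h3); rewrite -(funext box_split); exact: hT1.
- exact: eT.
Qed.

End ThreeSums.

(** * The critical line *)

Section CriticalLine.
Context {R : realType}.
Local Notation C := (Cplx R).
Implicit Types (t : R).
Local Notation UT := (@theta_tail R).
Local Notation UZ := (@sqrt_theta_tail R).

(** The separate terms of the algebraic identity grow like e^(-y/2) as y -> -oo. Their combination g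
    is even and integrable, so it is first folded onto y >= 0, where each term can be integrated by
    itself. *)
Lemma cross_intE t : cross_int t = UT (2^-1 +i* t) + UT (2^-1 +i* - t)
  - (UZ (2^-1 +i* t) + UZ (0 +i* t)) - (UZ (2^-1 +i* - t) + UZ (0 +i* - t)).
Proof.
pose g (y : R) : R := (sqrt_theta_line y - 1) * (sqrt_theta_line (- y) - 1).
have c1 : continuous (fun y : R => sqrt_theta_line y - 1).
  by move=> u; apply: cvgB; [exact: continuous_sqrt_theta_line|exact: cvg_cst].
have cg : continuous g.
  move=> y; apply: cvgM; first exact: c1.
  by apply: (@continuous_cmp R (fun y => sqrt_theta_line y - 1)); [exact: c1|exact: opp_continuous].
have cont : ccont (fun y => (g y)%:C * cexp ((0 +i* t) * y%:C)).
  split.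
    rewrite (_ : (fun v => _) = fun v => g v * complex.Re (cexp ((0 +i* t) * v%:C))).
      by move=> v; apply: cvgM; [exact: cg|exact: continuous_Re_cexp_line].
    by apply/funext => v; rewrite (cReMr (g v)).
  rewrite (_ : (fun v => _) = fun v => g v * complex.Im (cexp ((0 +i* t) * v%:C))).
    by move=> v; apply: cvgM; [exact: cg|exact: continuous_Im_cexp_line].
  by apply/funext => v; rewrite (cImMr (g v)).
have gle y : `|g y| <= pair_bound y.
  pose S N (u : R) : R := \sum_(m < N) coef m * nome u ^+ m.
  have h : `|S N y * S N (- y)| @[N --> \oo] --> `|g y|.
    by apply: cvg_norm; apply: cvgM; exact: cvg_coef_sum.
  have hS N u : `|S N u| <= coef_abs_sum N u.
    apply: le_trans (ler_norm_sum _ _ _) _; apply: ler_sum => m _.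
    by rewrite normrM normrX (ger0_norm (nome_ge0 _)).
  have hb N : `|S N y * S N (- y)| <= pair_bound y.
    apply: le_trans (coef_abs_sum_prod N N y); rewrite normrM.
    by apply: ler_pM => //; exact: hS.
  by apply: (ler_cvg_to h (cvg_cst (pair_bound y))); apply: nearW; exact: hb.
have int : cintegrable (fun y => (g y)%:C * cexp ((0 +i* t) * y%:C)).
  apply: (@cintegrable_le R _ pair_bound); [|exact: rintegrable_pair_bound|].
    apply: cmeasM; last exact: cmeas_cexp_line.
    by apply: cmeas_real; exact: continuous_measurable_fun.
  by move=> y; rewrite cabsM cabs_real cabs_line_imag mulr1.
pose fT (s : C) (y : R) : C := (ind0 y * (theta_line y - 1))%:C * cexp (s * y%:C).
pose fZ (s : C) (y : R) : C := (ind0 y * (sqrt_theta_line y - 1))%:C * cexp (s * y%:C).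
have iT (s : C) : cintegrable (fT s).
  apply: (mellin_integrable (decay_tail continuous_theta_line theta_line_fast (complex.Re s - 1) (complex.Re s + 1))).
  by apply/andP; split; lra.
have iZ (s : C) : cintegrable (fZ s).
  apply: (mellin_integrable (decay_tail continuous_sqrt_theta_line sqrt_theta_line_fast (complex.Re s - 1) (complex.Re s + 1))).
  by apply/andP; split; lra.
have UTE (s : C) : UT s = cint (fT s) by [].
have UZE (s : C) : UZ s = cint (fZ s) by [].
have iB (h k : R -> C) : cintegrable h -> cintegrable k -> cintegrable (fun y => h y - k y).
  move=> ih ik; rewrite (_ : (fun y => _) = fun y => h y + -1 * k y).
    by apply: cintegrableD; [exact: ih|exact: cintegrableZ].
  by apply/funext => y; rewrite mulN1r.
set a : C := 2^-1 +i* t; set b : C := 2^-1 +i* - t; set c : C := 0 +i* t; set d : C := 0 +i* - t.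
have j1 := cintegrableD (iT a) (iT b).
have j2 := cintegrableD (iZ a) (iZ c).
have j3 := cintegrableD (iZ b) (iZ d).
have j4 := iB _ _ j1 j2.
rewrite (UTE a) (UTE b) (UZE a) (UZE b) (UZE c) (UZE d).
rewrite -(cintD (iT a) (iT b)) -(cintD (iZ a) (iZ c)) -(cintD (iZ b) (iZ d)) -(cintB j1 j2) -(cintB j4 j3).
rewrite /cross_int /mellin (cint_fold cont int).
apply: eq_cint => y; rewrite /fT /fZ.
have gN : g (- y) = g y by rewrite /g opprK; exact: mulrC.
have gE : g y = expR (2^-1 * y) * (theta_line y - 1) - (sqrt_theta_line y - 1) * (expR (2^-1 * y) + 1).
  by rewrite /g sqrt_theta_lineN -sqrt_theta_line_sqr; ring.
have e (r : R) : cexp ((2^-1 +i* r) * y%:C) = (expR (2^-1 * y))%:C * cexp ((0 +i* r) * y%:C) :> C.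
  rewrite -cexp_real -cexpD; congr cexp.
  by apply: eqCplx; rewrite ?cReD ?cImD ?cReM ?cImM /=; ring.
have e2 : (0 +i* t : C) * (- y)%:C = (0 +i* - t) * y%:C.
  by apply: eqCplx; rewrite ?cReM ?cImM /=; ring.
rewrite /a /b /c /d !e e2 gN gE; move: (expR _) (cexp _) (cexp _) (ind0 y) (theta_line y) (sqrt_theta_line y) => x u v w p q.
by rewrite !(rmorphB, rmorphD, rmorphM) /= !rmorph1; ring.
Qed.

(** [Z_sym] after cancellation of the polar terms 1/(it) and 1/(-it), hence meaningful and
    continuous at t = 0. *)
Definition Z_sym_ext t : C := UZ (2^-1 +i* t) + UZ (0 +i* - t) + (UZ (2^-1 +i* - t) + UZ (0 +i* t))
  - (2^-1 +i* t)^-1 - (2^-1 +i* - t)^-1.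

Lemma Z_symE t : t != 0 -> Z_sym t = Z_sym_ext t.
Proof.
move=> t0.
have ne0 (r : R) : (2^-1 +i* r : C) != 0.
  by apply/eqP => -[/eqP]; rewrite invr_eq0 pnatr_eq0.
have neh (r : R) : r != 0 -> (2^-1 +i* r : C) != (2^-1)%:C.
  by move=> r0; apply/eqP => -[] /eqP; rewrite (negbTE r0).
have nt0 : - t != 0 by rewrite oppr_eq0.
rewrite /Z_sym !Z_halfE ?neh // /Z_ext /Z_sym_ext.
have d1 (r : R) : (2^-1)%:C - (2^-1 +i* r) = 0 +i* - r :> C.
  by apply: eqCplx; rewrite ?cReB ?cImB /= ?subrr ?sub0r.
have d2 (r : R) : (2^-1 +i* r) - (2^-1)%:C = 0 +i* r :> C.
  by apply: eqCplx; rewrite ?cReB ?cImB /= ?subrr ?subr0.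
rewrite !d1 !d2 opprK.
have -> : (0 +i* - t : C)^-1 = - (0 +i* t)^-1.
  by rewrite -invrN; congr (_^-1); apply: eqCplx; rewrite /= ?oppr0.
ring.
Qed.

Lemma zetastar_line t : zetastar (2^-1 +i* t) = Z_sym_ext t + cross_int t.
Proof.
have s1 : (2^-1 +i* t : C) != 1%:C.
  apply/eqP => -[] h _; have : (2^-1 : R) < 1 by rewrite invf_lt1 // ltr1n.
  by rewrite h ltxx.
have p : 0 < complex.Re (2^-1 +i* t : C) by rewrite /= invr_gt0.
rewrite (zetastarE p s1) cross_intE /Z_sym_ext.
have -> : 1%:C - (2^-1 +i* t) = 2^-1 +i* - t :> C.
  by apply: eqCplx; rewrite ?cReB ?cImB /= ?sub0r //; field.
have -> : (2^-1 +i* t - 1%:C : C)^-1 = - (2^-1 +i* - t)^-1.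
  by rewrite -invrN; congr (_^-1); apply: eqCplx; rewrite ?cReB ?cImB ?cReN ?cImN /= ?subr0 ?opprK //; field.
ring.
Qed.

(** The boolean selects the approach through d - it or d + it, so that both conjugate arguments are
    covered. *)
Lemma vertical_cvg (f : C -> C) (d : R) (sg : bool) : analytic_at f (d +i* 0) ->
  f (d +i* (if sg then - t else t)) @[t --> (0 : R)^'] --> f (d +i* 0).
Proof.
move=> /analytic_cvg hf; apply/ccvgP => e e0.
move/ccvgP/(_ _ e0)/cnbhsP: hf => [r r0 hr].
have := @dnbhs0_lt R R r r0; apply: filterS => t tr; apply: hr.
rewrite (_ : _ - _ = 0 +i* (if sg then - t else t)); last first.
  by apply: eqCplx; rewrite ?cReB ?cImB /= ?subrr ?subr0.
by rewrite cabs_sqrt /= expr0n add0r sqrtr_sqr; case: (sg); rewrite ?normrN.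
Qed.

Lemma cvg_Z_sym_ext : Z_sym_ext t @[t --> (0 : R)^'] --> Z_sym_ext 0.
Proof.
have hV : analytic_at (fun s : C => s^-1) (2^-1 +i* 0).
  apply: analytic_inv; first exact: analytic_id.
  by apply/eqP => -[/eqP]; rewrite invr_eq0 pnatr_eq0.
have u1 := @vertical_cvg UZ 2^-1 false (analytic_sqrt_theta_tail _).
have u2 := @vertical_cvg UZ 2^-1 true (analytic_sqrt_theta_tail _).
have u3 := @vertical_cvg UZ 0 false (analytic_sqrt_theta_tail _).
have u4 := @vertical_cvg UZ 0 true (analytic_sqrt_theta_tail _).
have v1 := vertical_cvg false hV; have v2 := vertical_cvg true hV.
have vN (f : R -> C) (l : C) : f t @[t --> (0 : R)^'] --> l -> - f t @[t --> (0 : R)^'] --> - l.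
  by move=> h; rewrite -mulN1r (_ : (fun t => _) = fun t => -1 * f t); [apply: ccvgMl; exact: h|apply/funext => t; rewrite mulN1r].
rewrite /Z_sym_ext oppr0; apply: ccvgD; last by apply: vN; exact: v2.
apply: ccvgD; last by apply: vN; exact: v1.
by apply: ccvgD; apply: ccvgD; [exact: u1|exact: u4|exact: u2|exact: u3].
Qed.

Lemma cvg_zetastar_line : zetastar (2^-1 +i* t) @[t --> (0 : R)^'] --> zetastar (2^-1 : C).
Proof.
have h0 : (2^-1 : C) = 2^-1 +i* 0.
  by apply: eqCplx; rewrite natrCE -fmorphV.
rewrite h0; apply: (@vertical_cvg (@zetastar R) 2^-1 false).
have Re0 : 0 < complex.Re (2^-1 +i* 0 : C) by rewrite /= invr_gt0.
apply: (@analytic_ext R (fun s => UT s + UT (1%:C - s) + (s - 1%:C)^-1 - s^-1)).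
  have h1 : 2^-1 < 1 :> R by rewrite invf_lt1 // ltr1n.
  apply/cnbhsP; exists 2^-1; first by rewrite invr_gt0.
  move=> z hz; have := le_lt_trans (Re_le_cabs _) hz; rewrite cReB /= ltr_norml => /andP[h2 h3].
  rewrite zetastarE //; first by move: h2; lra.
  by apply/eqP => e; move: h3; rewrite e /=; lra.
apply: analytic_sub; last first.
  apply: analytic_inv; first exact: analytic_id.
  by apply/eqP => -[/eqP]; rewrite invr_eq0 pnatr_eq0.
apply: analytic_add; last first.
  apply: analytic_inv_sub; apply/eqP => -[] h; have : (2^-1 : R) < 1 by rewrite invf_lt1 // ltr1n.
  by rewrite h ltxx.
apply: analytic_add; first exact: analytic_theta_tail.
by apply: analytic_reflect => z; exact: analytic_theta_tail.
Qed.

End CriticalLine.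

Theorem corollary1 (R : realType) :
  exists S1 S2 S3 : R -> Cplx R,
    [/\ forall t : R,
          [/\ diag_sum t @ \oo --> S1 t,
              pair_sum t @ summability.totally --> S2 t
            & divisor_sum t @ \oo --> S3 t],
        forall t : R, t != 0 ->
          zetastar (2^-1 +i* t) = Z_sym t + S1 t + 2 * S2 t /\
          zetastar (2^-1 +i* t) = Z_sym t + S3 t,
        exists2 L : Cplx R, Z_sym t @[t --> (0 : R)^'] --> L &
          zetastar 2^-1 = L + S1 0 + 2 * S2 0 /\
          zetastar 2^-1 = L + S3 0
      & (Z_sym t + S1 t + 2 * S2 t) @[t --> (0 : R)^'] --> zetastar 2^-1 /\
        (Z_sym t + S3 t) @[t --> (0 : R)^'] --> zetastar 2^-1].
Proof.
have [S hS] := choice (@three_sums R).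
have h0 : (2^-1 : Cplx R) = 2^-1 +i* 0.
  by apply: eqCplx; rewrite natrCE -fmorphV.
have e1 t : t != 0 -> zetastar (2^-1 +i* t) = Z_sym t + (S t).1.1 + 2 * (S t).1.2.
  by move=> t0; case: (hS t) => _ _ _ h _; rewrite zetastar_line (Z_symE t0) -[RHS]addrA h.
have e2 t : t != 0 -> zetastar (2^-1 +i* t) = Z_sym t + (S t).2.
  by move=> t0; case: (hS t) => _ _ _ _ h; rewrite zetastar_line (Z_symE t0) h.
have nz (P : R -> Prop) : (forall t : R, t != 0 -> P t) -> \forall t \near (0 : R)^', P t.
  by move=> h; apply: filterS (nbhs_dnbhs_neq (0 : R)) => t; exact: h.
exists (fun t => (S t).1.1), (fun t => (S t).1.2), (fun t => (S t).2); split.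
- by move=> t; case: (hS t) => a1 a2 a3 _ _; split; [exact: a1|exact: a2|exact: a3].
- by move=> t t0; split; [exact: e1|exact: e2].
(* [zetastar_line] holds at t = 0 as well, so the limit formula is its instance there, with [Z_sym]
   replaced by its continuous extension. *)
- exists (Z_sym_ext (0 : R)).
    apply: cvg_trans (@cvg_Z_sym_ext R); apply: near_eq_cvg; apply: nz => t t0.
    by rewrite Z_symE.
  case: (hS 0) => _ _ _ h1 h2; split; rewrite h0 zetastar_line ?h2 //.
  by rewrite -[RHS]addrA h1.
- split.
    apply: cvg_trans (@cvg_zetastar_line R); apply: near_eq_cvg; apply: nz => t t0; exact: e1.
  apply: cvg_trans (@cvg_zetastar_line R); apply: near_eq_cvg; apply: nz => t t0; exact: e2.
Qed.
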